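(* Let $\mathbb{H}$ be a separable real Hilbert space, $A:\mathbb{H}\rightrightarrows\mathbb{H}$ a maximal monotone operator with $\mathrm{Int}(\mathrm{D}(A))\neq\emptyset$, $\Pi$ a generalized projection on $\overline{\mathrm{D}(A)}$, and $m\in\mathbb{D}(\mathbb{R}^{+},\mathbb{H})$ with $m_{0}\in\overline{\mathrm{D}(A)}$. Let $m^{(n)}\in\mathbb{D}(\mathbb{R}^{+},\mathbb{H})$ and $(x^{(n)},k^{(n)})=\mathcal{SP}(A,\Pi;m^{(n)})$, $n\in\mathbb{N}^{*}$. Then: (I) Suppose that $\|m^{(n)}-m\|_{T}\to0$ for every $T>0$. Then, for every $T>0$: (j) for any $a\in\mathrm{Int}(\mathrm{D}(A))$, any $r_{0}>0$ such that $\overline{B(a,r_{0})}\subset\overline{\mathrm{D}(A)}$, and any (finite) $\mu\ge A^{\#}_{a,r_{0}}$, there exist a constant $C=C(a,r_{0},\mu,T,\boldsymbol{\gamma}_{m}(\cdot,T))>0$ (depending only on the indicated quantities) and $n_{0}\in\mathbb{N}^{*}$ such that for all $n\ge n_{0}$ $$\|x^{(n)}\|_{T}^{2}+\mathrm{Var}_{T}(k^{(n)})\le\|x^{(n)}\|_{T}^{2}+\mathrm{Var}_{T}(k^{(n),c})+\mathrm{Var}_{T}(k^{(n),d})\le C(1+\|m\|_{T}^{2});$$ (jj) there exist $x,k\in\mathbb{D}(\mathbb{R}^{+},\mathbb{H})$ (not depending on $T$) such that $\|x^{(n)}-x\|_{T}+\|k^{(n)}-k\|_{T}\to0$ as $n\to\infty$,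 and $\|x\|_{T}^{2}+\mathrm{Var}_{T}(k)\le C(1+\|m\|_{T}^{2})$, with $C$ as in (j); (jjj) $(x,k)=\mathcal{SP}(A,\Pi;m)$. (II) If $m^{(n)}\to m$ in $\mathbb{D}(\mathbb{R}^{+},\mathbb{H})$ (Skorokhod topology $J_{1}$), then there exist $x,k\in\mathbb{D}(\mathbb{R}^{+},\mathbb{H})$ such that $(x^{(n)},k^{(n)},m^{(n)})\to(x,k,m)$ in $\mathbb{D}(\mathbb{R}^{+},\mathbb{H}\times\mathbb{H}\times\mathbb{H})$ (topology $J_{1}$), and $(x,k)=\mathcal{SP}(A,\Pi;m)$. (III) Let $\pi_{n}$ be partitions of $\mathbb{R}^{+}$ with $\|\pi_{n}\|\to0$. If $m^{(n)}_{t}=\sum_{r\in\pi_{n}}m_{r}\mathbf{1}_{[r,r')}(t)$ is the $\pi_{n}$-discretization of $m$ and $(x^{(n)},k^{(n)})=\mathcal{SP}(A,\Pi;m^{(n)})$, $n\in\mathbb{N}$, then there exist $x,k\in\mathbb{D}(\mathbb{R}^{+},\mathbb{H})$ such that $(x^{(n)},k^{(n)},m^{(n)})\to(x,k,m)$ in $\mathbb{D}(\mathbb{R}^{+},\mathbb{H}\times\mathbb{H}\times\mathbb{H})$ (topology $J_{1}$), and $(x,k)=\mathcal{SP}(A,\Pi;m)$.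
   Context: $\mathbb{R}^{+}=[0,\infty)$. $\mathrm{D}(A)=\{z\in\mathbb{H}:A(z)\neq\emptyset\}$ and $\mathrm{Gr}(A)=\{(z,y):y\in A(z)\}$. $\mathbb{D}(\mathbb{R}^{+},E)$ is the set of càdlàg functions $\mathbb{R}^{+}\to E$; by convention $x_{0-}=x_{0}$, and $\Delta x_{t}=x_{t}-x_{t-}$. $y^{(n)}\to y$ in $\mathbb{D}(\mathbb{R}^{+},E)$ (topology $J_{1}$) means: there exist strictly increasing continuous bijections $\lambda^{(n)}$ of $\mathbb{R}^{+}$ with $\sup_{t\ge0}|\lambda^{(n)}_{t}-t|\to0$ and $\sup_{t\in[0,T]}|y^{(n)}_{\lambda^{(n)}_{t}}-y_{t}|\to0$ for all $T>0$. $\|x\|_{T}=\sup_{t\in[0,T]}|x_{t}|$; $\mathrm{Var}_{T}(k)$ is the total variation of $k$ on $[0,T]$; $\mathrm{BV}_{loc}(\mathbb{R}^{+};\mathbb{H})$ is the set of functions with finite total variation on every $[0,T]$. The càdlàg modulus of $y$ is $\boldsymbol{\gamma}_{y}(\delta,T)=\inf\{\max_{i\le r}\sup_{s,t\in[t_{i-1},t_{i})}|y_{s}-y_{t}|:0=t_{0}<\dots<t_{r}=T,\ \inf_{i<r}(t_{i}-t_{i-1})\ge\delta\}$. $A^{\#}_{a,r_{0}}=\sup\{|\hat u|:\hat u\in Au,\ u\in\overline{B(a,r_{0})}\}$. A partition of $\mathbb{R}^{+}$ is $\pi=\{0=t_{0}<t_{1}<t_{2}<\dots\}$ with $t_{n}\to\infty$;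 for $r=t_{i}\in\pi$, $r'=t_{i+1}$ is its successor; $\|\pi\|=\sup_{r\in\pi}(r'-r)$. A map $\Pi:\mathbb{H}\to\mathbb{H}$ is a generalized projection on $\overline{\mathrm{D}(A)}$ if $\Pi(\mathbb{H})\subset\overline{\mathrm{D}(A)}$, $\Pi(x)=x$ for all $x\in\overline{\mathrm{D}(A)}$, and $|\Pi(x)-\Pi(y)|\le|x-y|$ for all $x,y\in\mathbb{H}$. For a càdlàg $k\in\mathrm{BV}_{loc}(\mathbb{R}^{+};\mathbb{H})$ put $k^{d}_{t}=\sum_{0\le s\le t}\Delta k_{s}$ and $k^{c}=k-k^{d}$ (continuous); $k^{(n),c},k^{(n),d}$ denote these parts of $k^{(n)}$. Integrals $\int_{s}^{t}$ with respect to $dk$ are Lebesgue–Stieltjes integrals over $(s,t]$. ''$d\ell_{t}\in A(y_{t})(dt)$'' means $\int_{s}^{t}\langle y_{r}-\alpha,d\ell_{r}-\beta\,dr\rangle\ge 0$ for all $0\le s\le t$ and all $(\alpha,\beta)\in\mathrm{Gr}(A)$. $(x,k)=\mathcal{SP}(A,\Pi;m)$ means: $x,k\in\mathbb{D}(\mathbb{R}^{+},\mathbb{H})$; $x_{t}\in\overline{\mathrm{D}(A)}$ for all $t\ge0$; $k\in\mathrm{BV}_{loc}(\mathbb{R}^{+};\mathbb{H})$, $k_{0}=0$; $x_{t}+k_{t}=m_{t}$ for all $t\ge0$; $dk^{c}_{t}\in A(x_{t})(dt)$; and $x_{t}=\Pi(x_{t-}+\Delta m_{t})$ for all $t\ge0$.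 *)

(* Defs.v *)
(* A path R^+ -> E is encoded as a function R -> E of which
   only the values on [0, +oo[ are ever used. *)
From HB Require Import structures.
From mathcomp Require Export all_boot all_order all_algebra.
From mathcomp Require Export sesquilinear.
From mathcomp Require Export all_classical all_reals all_analysis.
From mathcomp.analysis Require showcase.summability.

Set Implicit Arguments.
Unset Strict Implicit.
Unset Printing Implicit Defensive.

Export Order.TTheory GRing.Theory Num.Theory.
Export numFieldNormedType.Exports.

Local Open Scope classical_set_scope.
Local Open Scope ring_scope.

Section Paths.
Context {R : realType} {E : normedModType R}.
Implicit Types (x y : R -> E) (T : R).

Definition cadlag x : Prop :=
  (forall t, 0 <= t -> x r @[r --> t^'+] --> x t) /\
  (forall t, 0 < t -> cvg (x r @[r --> t^'-])).

(* Convention: x_{0-} = x_0. *)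
Definition left_lim x (t : R) : E :=
  if 0 < t then lim (x r @[r --> t^'-]) else x 0.

Definition jump x (t : R) : E := x t - left_lim x t.

Definition sup_norm x T : \bar R := ereal_sup [set `|x t|%:E | t in `[0, T]].

(* [total_variation] of the library is only for real-valued functions. *)
Definition Var (a b : R) x : \bar R :=
  ereal_sup [set (\sum_(0 <= i < size s)
                  `|x (nth b (a :: s) i.+1) - x (nth b (a :: s) i)|)%:E
            | s in itv_partition a b].

Definition BV_loc x : Prop := forall T, 0 <= T -> (Var 0 T x < +oo)%E.

(* The sum over the uncountable index set [0, t] is the limit of the net of
   finite partial sums; it converges absolutely when x is in BV_loc. *)
Definition disc_part x (t : R) : E :=
  summability.sum (fun s : R => if 0 <= s <= t then jump x s else 0).

Definition cont_part x (t : R) : E := x t - disc_part x t.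

(* The partition 0 = t_0 < t_1 < ... < t_r = T is 0 :: s, so t_i is
   [nth T (0 :: s) i] and r = size s. The last block [t_{r-1}, t_r) is exempt
   from the lower bound on the mesh. *)
Definition cadlag_modulus x (T : R) (delta : R) : \bar R :=
  ereal_inf [set
    \big[maxe/0%E]_(0 <= i < size s)
       ereal_sup [set `|x p.1 - x p.2|%:E | p in
         `[nth T (0 :: s) i, nth T (0 :: s) i.+1[ `*`
         `[nth T (0 :: s) i, nth T (0 :: s) i.+1[]
    | s in [set s | itv_partition 0 T s /\
                    forall i, (i.+1 < size s)%N ->
                      delta <= nth T (0 :: s) i.+1 - nth T (0 :: s) i]].

Definition time_change (lam : R -> R) : Prop :=
  [/\ set_bij `[0, +oo[ `[0, +oo[ lam,
      {in `[0, +oo[ &, {homo lam : s t / s < t}} &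
      {within `[0, +oo[, continuous lam}].

Definition J1_cvg (y_ : nat -> R -> E) y : Prop :=
  exists lam : nat -> R -> R,
    [/\ forall n, time_change (lam n),
        ereal_sup [set `|lam n t - t|%:E | t in `[0, +oo[]
          @[n --> \oo] --> 0%E &
        forall T, 0 < T ->
          ereal_sup [set `|y_ n (lam n t) - y t|%:E | t in `[0, T]]
            @[n --> \oo] --> 0%E].

(* A partition {0 = t_0 < t_1 < ...} of R^+ is given by its enumeration. *)
Definition is_partition (p : nat -> R) : Prop :=
  [/\ p 0%N = 0, forall i, p i < p i.+1 & p i @[i --> \oo] --> +oo].

Definition mesh (p : nat -> R) : \bar R :=
  ereal_sup (range (fun i => (p i.+1 - p i)%:E)).

Definition discretization (p : nat -> R) x (t : R) : E :=
  \big[+%R/0]_(0 <= i <oo) (\1_(`[p i, p i.+1[) t *: x (p i)).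

End Paths.

Section Operators.
Context {R : realType} {H : completeNormedModType R} (dot : {dot H for idfun}).
Implicit Types (A : H -> set H) (x k m : R -> H).

Definition hilbert_norm : Prop := forall u : H, `|u| ^+ 2 = dot u u.

Definition separable : Prop := exists2 D : set H, countable D & dense D.

Definition domain A : set H := [set z | A z !=set0].

Definition graph A : set (H * H) := [set p | A p.1 p.2].

Definition monotone A : Prop :=
  forall p q, graph A p -> graph A q -> 0 <= dot (p.1 - q.1) (p.2 - q.2).

Definition maximal_monotone A : Prop :=
  monotone A /\
  forall B : H -> set H,
    monotone B -> graph A `<=` graph B -> graph B `<=` graph A.

Definition gen_projection A (Pi : H -> H) : Prop :=
  [/\ range Pi `<=` closure (domain A),
      {in closure (domain A), forall u, Pi u = u} &
      forall u v, `|Pi u - Pi v| <= `|u - v|].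

Definition A_sharp A (a : H) (r0 : R) : \bar R :=
  ereal_sup [set `|w|%:E | w in \bigcup_(u in closed_ball a r0) A u].

(* The H-valued measure dl on ]0, +oo[ of l in BV_loc, in polar form
   dl = h d|l|: V is a distribution function of the variation measure |l|,
   and the equality of measures is tested on the intervals ]s, t] and
   coordinatewise. *)
Definition polar_decomposition (l : R -> H) (V : cumulative R R) (h : R -> H)
    : Prop :=
  [/\ forall s t, 0 <= s <= t -> Var s t l = (V t - V s)%:E,
      forall r, `|h r| <= 1,
      forall e, measurable_fun (setT : set (measurableTypeR R))
                  (fun r => dot (h r) e) &
      forall e s t, 0 <= s <= t ->
        dot (l t - l s) e =
        (\int[lebesgue_stieltjes_measure V]_(r in `]s, t]) dot (h r) e)%R].

(* [LS_integral f l s t I] : I is the Lebesgue-Stieltjes integral over ]s, t]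
   of <f_r, dl_r> = <f_r, h_r> d|l|_r. *)
Definition LS_integral (f l : R -> H) (s t I : R) : Prop :=
  exists (V : cumulative R R) (h : R -> H),
    [/\ polar_decomposition l V h,
        (lebesgue_stieltjes_measure V).-integrable `]s, t]
          (fun r => (dot (f r) (h r))%:E) &
        I = (\int[lebesgue_stieltjes_measure V]_(r in `]s, t])
               dot (f r) (h r))%R].

(* dl_t \in A(y_t)(dt); the integral of <y - alpha, dl - beta dr> over ]s, t] is
   split into its Lebesgue-Stieltjes and its Lebesgue part. *)
Definition differential_in A (y l : R -> H) : Prop :=
  forall s t alpha beta, 0 <= s <= t -> graph A (alpha, beta) ->
    exists2 I, LS_integral (fun r => y r - alpha) l s t I &
      0 <= I - (\int[lebesgue_measure]_(r in `]s, t])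
                  dot (y r - alpha) beta)%R.

Definition SP A (Pi : H -> H) m x k : Prop :=
  [/\ cadlag x /\ cadlag k,
      forall t, 0 <= t -> closure (domain A) (x t),
      BV_loc k /\ k 0 = 0,
      forall t, 0 <= t -> x t + k t = m t &
      differential_in A x (cont_part k) /\
      forall t, 0 <= t -> x t = Pi (left_lim x t + jump m t)].

End Operators.

(* Main.v *)
(* Testing dk^c in A(x)(dt) against (al, be) in Gr(A) gives, on a block [s, t]
   where m is c-close to a point mb, the energy inequality
     int_s^t <x_r - al, be> dr
       <= <mb - al, k_t - k_s> - (|k_t|^2 - |k_s|^2) / 2 + c Var(k; [s, t]),
   in which the jumps enter with the favourable sign because Pi is
   nonexpansive. With (al, be) over a ball inside D(A) it bounds k and Var(k) in
   terms of the number of blocks, i.e. of the cadlag modulus of m. With (al, be)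
   the states of an implicit Euler scheme for the limit datum (resolvents exist
   by Minty's theorem), alternated with applications of Pi, it bounds the
   distance of every k^n o lam^n to one and the same scheme; hence these paths
   are uniformly Cauchy, and only the test states, not the solutions, have to
   live on a common clock.

   In the limit the energy inequality on blocks of vanishing size, glued by
   Cousin's lemma, becomes the differential inclusion for k^c; the density of
   dk^c with respect to its variation measure is an almost everywhere limit of
   dyadic difference quotients, which form a bounded martingale in L^2. The
   discretizations of m converge in J1 along the time changes which are linear
   on the blocks of m and send each end point of a block to the next point of
   the partition. *)
From HB Require Import structures.
From mathcomp Require Import finmap ring lra zify.
Require Import Defs.
From mathcomp Require Import measurable_realfun.
Set Implicit Arguments.
Unset Strict Implicit.
Unset Printing Implicit Defensive.
Local Open Scope classical_set_scope.
Local Open Scope ring_scope.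

(** The obstacle behind the energy inequality is that continuous and discontinuous parts do not
    converge separately: step paths may converge uniformly to a continuous path, as happens for
    discretizations, so the inclusion for the continuous part does not pass to the limit by itself.
    The energy inequality involves only k, its variation and the time integral of x; the
    decomposition of the limit is recovered afterwards, with finitely many jumps treated
    individually and all others absorbed in a small tail. In the comparison with a scheme the order
    of choices matters. The variation of the scheme is bounded independently of its accuracy eta;
    then eta is fixed, then one scheme, and only then the closeness theta of the time changes to the
    identity, because theta is multiplied by the slopes |be| of that scheme. The constant must be a
    function of a, r0, mu, T and the modulus, chosen before A, Pi and m. Only one value d at which
    the modulus is below r0 / 8 enters, through the bound T / d + 1 on the number of blocks. *)

Section Hilbert.
Context {R : realType} {H : completeNormedModType R} (dot : {dot H for idfun}).
Hypothesis Hnorm : hilbert_norm dot.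
Implicit Types u v w : H.

Lemma dotC u v : dot u v = dot v u.
Proof. by rewrite hermC expr0 mul1r. Qed.

Lemma dotDl u v w : dot (u + v) w = dot u w + dot v w.
Proof. exact: linearDl. Qed.

Lemma dotDr u v w : dot u (v + w) = dot u v + dot u w.
Proof. by rewrite dotC dotDl !(dotC u). Qed.

Lemma dotNl u v : dot (- u) v = - dot u v.
Proof. exact: linearNl. Qed.

Lemma dotNr u v : dot u (- v) = - dot u v.
Proof. by rewrite dotC dotNl dotC. Qed.

Lemma dotZl a u v : dot (a *: u) v = a * dot u v.
Proof. exact: linearZl_LR. Qed.

Lemma dotZr a u v : dot u (a *: v) = a * dot u v.
Proof. by rewrite dotC dotZl dotC. Qed.

Lemma dot0l u : dot 0 u = 0.
Proof. exact: linear0l. Qed.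

Lemma dot0r u : dot u 0 = 0.
Proof. by rewrite dotC dot0l. Qed.

Definition dotE := (dotDl, dotDr, dotNl, dotNr, dotZl, dotZr, dot0l, dot0r).

Lemma norm2D u v : `|u + v| ^+ 2 = `|u| ^+ 2 + 2 * dot u v + `|v| ^+ 2.
Proof. by rewrite !Hnorm !dotE (dotC v u); ring. Qed.

Lemma norm2B u v : `|u - v| ^+ 2 = `|u| ^+ 2 - 2 * dot u v + `|v| ^+ 2.
Proof. by rewrite !Hnorm !dotE (dotC v u); ring. Qed.

Lemma dot_le u v : dot u v <= `|u| * `|v|.
Proof.
have [->|u0] := eqVneq u 0; first by rewrite dot0l normr0 mul0r.
have [->|v0] := eqVneq v 0; first by rewrite dot0r normr0 mulr0.
have nu : 0 < `|u| by rewrite normr_gt0.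
have nv : 0 < `|v| by rewrite normr_gt0.
have := sqr_ge0 `|(`|v| *: u - `|u| *: v)|.
rewrite norm2B !normrZ !normr_id dotZl dotZr => h.
have {h}: 0 <= 2 * (`|u| * `|v|) * (`|u| * `|v| - dot u v) by nra.
by rewrite pmulr_rge0 ?subr_ge0// !mulr_gt0.
Qed.

Lemma normr_dot_le u v : `|dot u v| <= `|u| * `|v|.
Proof.
rewrite ler_norml dot_le andbT.
by have := dot_le (- u) v; rewrite dotNl normrN => h; lra.
Qed.

Lemma dot_ge u v : - (`|u| * `|v|) <= dot u v.
Proof. by have := normr_dot_le u v; rewrite ler_norml => /andP[]. Qed.

(** Vector identities below are proved by pairing both sides with an arbitrary w: after [dotE] the
    goal is a scalar identity, within reach of [ring]. *)
Lemma eq_dot u v : (forall w, dot u w = dot v w) -> u = v.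
Proof.
move=> h; apply/eqP; rewrite -subr_eq0 -normr_eq0 -sqrf_eq0 Hnorm !dotE !h.
by apply/eqP; ring.
Qed.

Lemma cauchy_seq_cvg (z : nat -> H) :
  (forall e : R, 0 < e -> exists N, forall n, (N <= n)%N -> `|z N - z n| <= e) ->
  cvgn z.
Proof.
move=> h; apply/cauchy_cvgP/cauchy_exP => e e0.
have [N hN] := h (e / 2) (divr_gt0 e0 (ltr0n _ 2)).
exists (z N); exists N => //= n /hN zn.
by rewrite -ball_normE /=; apply: le_lt_trans zn _; lra.
Qed.

Lemma cvgn_le_harmonic (f : nat -> R) l b : f n @[n --> \oo] --> l ->
  (forall n, f n <= b + n.+1%:R^-1) -> l <= b.
Proof.
move=> fl fb; rewrite -(subr0 l).
apply: (@cvgr_to_le _ \oo _ _ (fun n => f n - n.+1%:R^-1)).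
  by apply: cvgB => //; exact: cvg_harmonic.
by near=> n; rewrite lerBlDr; exact: fb.
Unshelve. all: by end_near. Qed.

(** The first-order condition along a segment: divide by t and let t tend to 0. The single value t =
    (x - p) / (2 x), for which (1 - t) x - p = (x - p) / 2, already gives the contradiction. *)
Lemma le_of_scaled (x p : R) : 0 <= p ->
  (forall t, 0 < t < 1 -> t * ((1 - t) * x - p) <= 0) -> x <= p.
Proof.
move=> p0 key; rewrite leNgt; apply/negP => px.
have x0 : 0 < x by lra.
have t01 : 0 < (x - p) / (2 * x) < 1.
  apply/andP; split; first by apply: divr_gt0; lra.
  by rewrite ltr_pdivrMr ?mulr_gt0//; lra.
have /andP[t0 _] := t01; have := key _ t01.
rewrite pmulr_rle0// mulrBl mul1r.
have -> : (x - p) / (2 * x) * x = (x - p) / 2 by field; rewrite gt_eqF.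
lra.
Qed.

End Hilbert.

(** * Monotone extension and resolvents *)

(** The convex hull of the points (al, be, <al, be>) with (al, be) in G, generated by binary
    mixtures. Its third coordinate dominates the pairing of the other two; this is how monotonicity
    enters the duality argument. *)
Inductive hull {R : realType} {H : normedModType R} (dot : H -> H -> R)
    (G : set (H * H)) : H -> H -> R -> Prop :=
| hull_base al be : G (al, be) -> hull dot G al be (dot al be)
| hull_mix a b c a' b' c' t : hull dot G a b c -> hull dot G a' b' c' ->
    0 <= t <= 1 ->
    hull dot G ((1 - t) *: a + t *: a') ((1 - t) *: b + t *: b')
             ((1 - t) * c + t * c').

Section Minty.
Context {R : realType} {H : completeNormedModType R} (dot : {dot H for idfun}).
Hypothesis Hnorm : hilbert_norm dot.
Variable G : set (H * H).
Hypothesis Gmono : forall p q, G p -> G q -> 0 <= dot (p.1 - q.1) (p.2 - q.2).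

(** Polarization: for two points of the hull, c1 + c2 - <a2, b1> - <a1, b2> is affine in each of
    them and nonnegative on G by monotonicity, so two inductions give its sign on the hull. On the
    diagonal it is 2 (c - <a, b>). *)
Lemma hull_dot_le a b c : hull dot G a b c -> dot a b <= c.
Proof.
have base_hull al be a' b' c' : G (al, be) -> hull dot G a' b' c' ->
    0 <= c' - dot a' be - dot al b' + dot al be.
  move=> Gp; elim=> {a' b' c'}
      [al' be' Gq|a1 b1 c1 a2 b2 c2 t _ h1 _ h2 /andP[t0 t1]].
    by have := Gmono Gq Gp; rewrite /= !dotE; lra.
  rewrite !dotE; have := mulr_ge0 t0 h2.
  have /mulr_ge0/(_ h1) : 0 <= 1 - t by lra.
  lra.
have hull_hull a1 b1 c1 a2 b2 c2 : hull dot G a1 b1 c1 -> hull dot G a2 b2 c2 ->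
    0 <= c2 + c1 - dot a2 b1 - dot a1 b2.
  move=> h1; elim=> {a2 b2 c2}
      [al' be' Gq|a2 b2 c2 a3 b3 c3 t _ h2 _ h3 /andP[t0 t1]].
    by have := base_hull _ _ _ _ _ Gq h1; lra.
  rewrite !dotE; have := mulr_ge0 t0 h3.
  have /mulr_ge0/(_ h2) : 0 <= 1 - t by lra.
  lra.
by move=> h; have := hull_hull _ _ _ _ _ _ h h; lra.
Qed.

(* Maximising the concave function F over the hull of G is dual to the
   one-point extension problem: a maximising sequence has converging centers
   Z, and first-order optimality in the direction of a point of G is the
   required inequality at that point. *)
Lemma monotone_extension y :
  exists z, forall al be, G (al, be) -> 0 <= dot (z - al) (y - z - be).
Proof.
have [[[al0 be0] G0]|G0] := pselect (G !=set0); last first.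
  by exists 0 => al be Gp; exfalso; apply: G0; exists (al, be).
(* Completing the square, the inequality at (al, be) reads |z - Z al be|^2 <= - F al be <al, be>:
   the point z has to lie in all balls of a family with centers [Z]. *)
pose Z a b : H := 2^-1 *: (a - b + y).
pose F a b c : R := - (c - dot a y) - `|Z a b| ^+ 2.
pose S := [set r | exists a b c, hull dot G a b c /\ r = F a b c].
have ZZ a b : `|Z a b| ^+ 2 = 4^-1 * `|a - b + y| ^+ 2.
  by rewrite normrZ exprMn ger0_norm ?invr_ge0//; congr (_ * _); field.
have F_le0 a b c : hull dot G a b c -> F a b c <= 0.
  move=> /hull_dot_le h; rewrite /F ZZ Hnorm !dotE.
  have := sqr_ge0 `|a + b - y|; rewrite Hnorm !dotE.
  rewrite (dotC _ b a) (dotC _ y a) (dotC _ y b); lra.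
(* F is concave with the exact quadratic defect t (1 - t) |Z - Z'|^2. At t = 1/2 this makes the
   centers of a maximising sequence Cauchy; for small t it gives the optimality condition. *)
have FD (t : R) (a b : H) (c : R) (a' b' : H) (c' : R) :
    F ((1 - t) *: a + t *: a') ((1 - t) *: b + t *: b') ((1 - t) * c + t * c') =
    (1 - t) * F a b c + t * F a' b' c' + t * (1 - t) * `|Z a b - Z a' b'| ^+ 2.
  rewrite /F; have -> : Z ((1 - t) *: a + t *: a') ((1 - t) *: b + t *: b') =
      (1 - t) *: Z a b + t *: Z a' b'.
    by apply: (eq_dot Hnorm) => w; rewrite !dotE; field.
  move: (Z a b) (Z a' b') => p q.
  by rewrite !Hnorm !dotE (dotC _ q p); ring.
have supS : has_sup S.
  split; first by exists (F al0 be0 (dot al0 be0)), al0, be0, (dot al0 be0);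
    split => //; exact: hull_base.
  by exists 0 => _ [a [b [c [h ->]]]]; exact: F_le0.
set M := sup S.
have FM a b c : hull dot G a b c -> F a b c <= M.
  by move=> h; apply: ub_le_sup; [exact: supS.2|exists a, b, c].
have /choice[s sP] : forall n : nat, exists p : H * H * R,
    hull dot G p.1.1 p.1.2 p.2 /\ M - n.+1%:R^-1 < F p.1.1 p.1.2 p.2.
  move=> n; have n0 : 0 < n.+1%:R^-1 :> R by rewrite invr_gt0.
  have [_ [a [b [c [h ->]]]] hr] := sup_adherent n0 supS.
  by exists (a, b, c).
pose z n := Z (s n).1.1 (s n).1.2.
have zcvg : cvgn z.
  apply: cauchy_seq_cvg => e e0.
  have [N hN] : exists N : nat, 4 * N.+1%:R^-1 < e ^+ 2.
    have e40 : 0 < e ^+ 2 / 4 by rewrite divr_gt0 ?exprn_gt0.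
    have /cvgrPdist_lt/(_ _ e40)[N _ /(_ N (leqnn _))] := @cvg_harmonic R.
    rewrite /= /harmonic sub0r normrN ger0_norm ?invr_ge0// => h.
    by exists N; move: h; set x := _^-1; lra.
  exists N => n Nn; rewrite -(@ler_pXn2r _ 2) ?nnegrE ?(ltW e0)//.
  have [h1 f1] := sP N; have [h2 f2] := sP n.
  have h01 : 0 <= (2^-1 : R) <= 1 by apply/andP; split; lra.
  have := FM _ _ _ (hull_mix h1 h2 h01); rewrite FD -/(z N) -/(z n).
  have : n.+1%:R^-1 <= N.+1%:R^-1 :> R by rewrite lef_pV2 ?posrE ?ler_nat.
  have aux (i j X Y W e2 : R) : j <= i -> M - i < X -> M - j < Y ->
    (1 - 2^-1) * X + 2^-1 * Y + 2^-1 * (1 - 2^-1) * W <= M -> 4 * i < e2 ->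
    W <= e2 by lra.
  by move=> ij /(aux _ _ _ _ _ _ ij f1 f2) /(_ hN).
have zl : z n @[n --> \oo] --> limn z by [].
exists (limn z) => al be Gp.
set zi := Z al be; set p := `|2^-1 *: (al + be - y)| ^+ 2.
have Fi : F al be (dot al be) = - p.
  rewrite /F /p ZZ normrZ exprMn ger0_norm ?invr_ge0// !Hnorm !dotE.
  by rewrite (dotC _ be al) (dotC _ y al) (dotC _ y be); field.
have key t : 0 < t < 1 -> t * ((1 - t) * `|limn z - zi| ^+ 2 - p) <= 0.
  move=> /andP[t0 t1].
  apply: (@cvgn_le_harmonic _ (fun n => t * ((1 - t) * `|z n - zi| ^+ 2 - p))).
    apply: cvgM; first exact: cvg_cst.
    apply: cvgB; last exact: cvg_cst.
    apply: cvgM; first exact: cvg_cst.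
    rewrite expr2; under eq_fun do rewrite expr2.
    by apply: cvgM; apply: cvg_norm; apply: cvgB => //; exact: cvg_cst.
  move=> n; have [hn fn] := sP n.
  have t01 : 0 <= t <= 1 by rewrite !ltW.
  have := FM _ _ _ (hull_mix hn (hull_base dot Gp) t01).
  rewrite FD Fi -/(z n) -/zi add0r.
  have aux (j X D : R) : M - j < X -> X <= 0 ->
    (1 - t) * X + t * - p + t * (1 - t) * D <= M -> t * ((1 - t) * D - p) <= j.
    move=> ? ? ?; have : t * X <= 0 by rewrite pmulr_rle0.
    lra.
  exact: aux fn (F_le0 _ _ _ hn).
have {key} : `|limn z - zi| ^+ 2 <= p.
  by apply: le_of_scaled => //; exact: sqr_ge0.
rewrite (norm2B Hnorm) /zi ZZ /p normrZ exprMn ger0_norm ?invr_ge0//.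
rewrite /Z dotZr !Hnorm !dotE.
rewrite !(dotC _ (limn z)) (dotC _ be al) (dotC _ y al) (dotC _ y be); lra.
Qed.

End Minty.

Section ClosureBall.
Context {R : realType} {H : normedModType R}.

Lemma closure_normP (A : set H) x :
  closure A x <-> forall e : R, 0 < e -> exists2 y, A y & `|x - y| < e.
Proof.
split=> [h e e0|h B].
  have [y [Ay]] := h (ball x e) (nbhsx_ballx _ _ e0).
  by rewrite -ball_normE /=; exists y.
rewrite -nbhs_ballE => -[e /= e0 eB]; have [y Ay xy] := h e e0.
by exists y; split => //; apply: eB; rewrite -ball_normE.
Qed.

Lemma closed_ballP (a : H) (r : R) u : 0 < r -> closed_ball a r u <-> `|u - a| <= r.
Proof. by move=> r0; rewrite closed_ballE// /closed_ball_ /= distrC. Qed.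

End ClosureBall.

(** * Resolvents and local boundedness of a maximal monotone operator *)

Section Operator.
Context {R : realType} {H : completeNormedModType R} (dot : {dot H for idfun}).
Hypothesis Hnorm : hilbert_norm dot.
Variable A : H -> set H.
Hypothesis Amax : maximal_monotone dot A.
Implicit Types u v w z : H.

Lemma mono u v w z : A u v -> A w z -> 0 <= dot (u - w) (v - z).
Proof. by move=> uv wz; exact: (Amax.1 (u, v) (w, z)). Qed.

Lemma maximal_ext z w : (forall al be, A al be -> 0 <= dot (z - al) (w - be)) ->
  A z w.
Proof.
move=> h; pose B u v := A u v \/ (u = z /\ v = w).
have Bm : monotone dot B.
  move=> [u v] [u' v'] [/= uv|/= [-> ->]] [/= uv'|/= [-> ->]].
  - exact: mono.
  - by have := h _ _ uv; rewrite !dotE; lra.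
  - exact: h.
  - by rewrite !subrr dot0l.
have AB : graph A `<=` graph B by move=> p; left.
by have := Amax.2 _ Bm AB (z, w); apply; right.
Qed.

(** Minty's theorem. [G] is the graph of h A; the point provided by [monotone_extension] is
    monotonically related to all of it, hence belongs to it by maximality. *)
Lemma resolvent h y : 0 < h -> exists v be, A v be /\ y = v + h *: be.
Proof.
move=> h0; pose G : set (H * H) := [set p | A p.1 (h^-1 *: p.2)].
have Gm p q : G p -> G q -> 0 <= dot (p.1 - q.1) (p.2 - q.2).
  move=> Gp Gq; have := mono Gp Gq.
  by rewrite -scalerBr dotZr pmulr_rge0// invr_gt0.
have [z zP] := monotone_extension Hnorm Gm y.
exists z, (h^-1 *: (y - z)); split; last first.
  by rewrite scalerA mulfV ?gt_eqF// scale1r addrC subrK.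
apply: maximal_ext => al be Aab.
have : G (al, h *: be) by rewrite /G /= scalerA mulVf ?gt_eqF// scale1r.
move=> /zP; rewrite -(@pmulr_rge0 _ h^-1) ?invr_gt0// -dotZr scalerBr.
by rewrite scalerA mulVf ?gt_eqF// scale1r.
Qed.

(** Comparison with a point w of the domain close to u: monotonicity gives |v - w| <= |u - w| + h
    |w'| with w' in A w, a bound that uses the slope at w only and so allows u in the closure. *)
Lemma resolvent_cvg u e : closure (domain A) u -> 0 < e ->
  exists2 h0, 0 < h0 & forall h v be, 0 < h -> h <= h0 -> A v be ->
    u = v + h *: be -> `|u - v| <= e.
Proof.
move=> /closure_normP uA e0.
have e30 : 0 < e / 3 by lra.
have [w [w' ww'] uw] := uA _ e30.
have w0 : 0 < `|w'| + 1 by rewrite ltr_wpDl.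
exists (e / 3 / (`|w'| + 1)); first exact: divr_gt0.
move=> h v be h0; rewrite ler_pdivlMr// => hh0 Avb E.
have hw : h * `|w'| <= e / 3 by nra.
have := mono Avb ww'; rewrite -(pmulr_rge0 _ h0) -dotZr scalerBr.
have -> : h *: be = (u - w) - (v - w) by rewrite E; apply: (eq_dot Hnorm) => z;
  rewrite !dotE; ring.
set d := v - w; have -> : dot d (u - w - d - h *: w') =
   dot d (u - w) - `|d| ^+ 2 - h * dot d w'.
  by rewrite Hnorm !dotE; ring.
have := dot_le Hnorm d (u - w); have := dot_ge Hnorm d w'.
move=> h1 h2 h3.
have : `|d| * `|d| <= `|d| * (2 * e / 3).
  have := normr_ge0 d; have := ltW uw; nra.
move=> h4; have de : `|d| <= 2 * e / 3.
  have [->|d0] := eqVneq `|d| 0; first lra.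
  by rewrite -(ler_pM2l (x := `|d|))// lt_def d0 normr_ge0.
have -> : u - v = (u - w) - d by rewrite /d opprB addrA subrK.
by apply: le_trans (ler_normB _ _) _; lra.
Qed.

(** Monotonicity between u and v, whose difference is h be'. Inside a block it propagates the
    smallness of the first Euler increment to all later ones. *)
Lemma resolvent_decr h u be v be' : 0 < h -> A u be -> A v be' ->
  u = v + h *: be' -> `|be'| <= `|be|.
Proof.
move=> h0 Aub Avb' E; have := mono Avb' Aub.
have -> : v - u = - (h *: be') by rewrite E opprD addrA subrr sub0r.
rewrite dotNl dotZl dotDr dotNr -Hnorm oppr_ge0 pmulr_rle0// => h1.
have := dot_le Hnorm be' be => h2.
have : `|be'| * `|be'| <= `|be'| * `|be| by nra.
have [->//|b0] := eqVneq `|be'| 0.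
by rewrite ler_pM2l// lt_def b0 normr_ge0.
Qed.

(* Baire gives one ball on which the convex functions
   x |-> sup <w, x - u> are bounded; convexity moves it to a. *)
Lemma locally_bounded a : (domain A)° a ->
  exists r mu, [/\ 0 < r, forall u, `|u - a| <= r -> domain A u &
    forall u w, `|u - a| <= r -> A u w -> `|w| <= mu].
Proof.
move=> /nbhs_closedballP[r0 ar0].
have r_gt0 : 0 < r0%:num by [].
set r := r0%:num in ar0 r_gt0 *.
have aD u : `|u - a| <= r -> domain A u.
  by move=> ur; apply: ar0; apply/closed_ballP.
pose E n : set H := [set x | `|x - a| <= r /\
  forall u w, `|u - a| <= r -> A u w -> dot w (x - u) <= n%:R].
have Ecl n x : closure (E n) x -> E n x.
  move=> /closure_normP xE; split.
    apply/ler_addgt0Pr => e e0; have [y [yr _] xy] := xE _ e0.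
    have -> : x - a = (x - y) + (y - a) by rewrite addrA subrK.
    by apply: le_trans (ler_normD _ _) _; lra.
  move=> u w ur Auw; apply/ler_addgt0Pr => e e0.
  have w0 : 0 < `|w| + 1 by rewrite ltr_wpDl.
  have [y [_ yP] xy] := xE _ (divr_gt0 e0 w0).
  have -> : x - u = (x - y) + (y - u) by rewrite addrA subrK.
  rewrite dotDr addrC; apply: lerD; first exact: yP.
  apply: le_trans (dot_le Hnorm _ _) _.
  have : `|w| * `|x - y| <= (`|w| + 1) * `|x - y| by rewrite ler_wpM2r ?lerDl.
  move/le_trans; apply; rewrite mulrC -ler_pdivlMr//; exact: ltW.
have [n nD] : exists n, ~ dense (~` E n).
  apply: contrapT => /forallNP nD.
  have /Baire : forall n, open (~` E n) /\ dense (~` E n).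
    move=> n; split; last by apply: contrapT; exact: nD.
    rewrite openC; have -> : E n = closure (E n).
      by apply/seteqP; split; [exact: subset_closure|exact: Ecl].
    exact: closed_closure.
  move=> /(_ (ball a r)) []; [|exact: ball_open|].
    by exists a; exact: ballxx.
  move=> x [ax xE]; have xr : `|x - a| <= r.
    by move: ax; rewrite -ball_normE /= distrC => /ltW.
  have [x' Axx'] := aD _ xr.
  have [n nx] : exists n : nat, `|x'| * (2 * r) < n%:R.
    exists (Num.truncn (`|x'| * (2 * r))).+1.
    exact: truncnS_gt.
  apply: (xE n) => //; split => // u w ur Auw.
  have := mono Axx' Auw; rewrite dotC !dotE => h.
  apply: le_trans (ltW nx); apply: (@le_trans _ _ (dot x' (x - u))).
    by rewrite !dotE; lra.
  apply: le_trans (dot_le Hnorm _ _) _; rewrite ler_wpM2l//.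
  have -> : x - u = (x - a) - (u - a) by rewrite opprB addrA subrK.
  by apply: le_trans (ler_normB _ _) _; lra.
have [c [rho rho0 cE]] : exists c, exists2 rho, 0 < rho &
    forall x, `|c - x| < rho -> E n x.
  apply: contrapT => h; apply: nD => O [c Oc] Oop.
  have := open_nbhs_nbhs (conj Oop Oc); rewrite -nbhs_ballE => -[rho /= rho0 cO].
  have [x [cx Ex]] : exists x, `|c - x| < rho /\ ~ E n x.
    apply: contrapT => /forallNP h2; apply: h; exists c, rho => // x cx.
    by apply: contrapT => Ex; apply: (h2 x).
  by exists x; split => //; apply: cO; rewrite -ball_normE.
have [cr _] : E n c by apply: cE; rewrite subrr normr0.
(* The reflection of c in a: the midpoints of c' and the points of the ball around c fill a ball
   around a, and at c' the functional <w, . - u> is bounded by means of any z in A c'. *)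
pose c' := a + a - c.
have c'r : `|c' - a| <= r by rewrite /c' addrAC addrK -normrN opprB.
have [z Ac'z] := aD _ c'r.
pose N := n%:R / 2 + `|z| * r.
have EN u w x : `|u - a| <= r -> A u w -> `|x - a| < rho / 2 -> dot w (x - u) <= N.
  move=> ur Auw xa; pose y := x + x - c'.
  have [yr yP] : E n y.
    apply: cE; have -> : c - y = (a - x) + (a - x).
      by rewrite /y /c'; apply: (eq_dot Hnorm) => ?; rewrite !dotE; ring.
    rewrite distrC in xa.
    by apply: le_lt_trans (ler_normD _ _) _; lra.
  have := yP _ _ ur Auw; rewrite /y.
  have := mono Ac'z Auw; rewrite (dotC dot _ (z - w)) => h1 h2.
  have h3 : dot z (c' - u) <= `|z| * (2 * r).
    apply: le_trans (dot_le Hnorm _ _) _; rewrite ler_wpM2l//.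
    have -> : c' - u = (c' - a) - (u - a) by rewrite opprB addrA subrK.
    by apply: le_trans (ler_normB _ _) _; lra.
  by move: h1 h2 h3; rewrite /N !dotE; lra.
exists (Num.min r (rho / 4)), (8 / rho * N); split.
- by rewrite lt_min r_gt0; lra.
- by move=> u; rewrite le_min => /andP[+ _]; exact: aD.
move=> u w; rewrite le_min => /andP[ur urho] Auw.
have [->|w0] := eqVneq w 0.
  rewrite normr0 mulr_ge0//; first by rewrite divr_ge0// ltW.
  by rewrite addr_ge0// ?divr_ge0// mulr_ge0// ltW.
have nw : 0 < `|w| by rewrite normr_gt0.
(* A test point at distance rho / 8 from u in the direction of w, where <w, x - u> = (rho / 8)
   |w|. *)
pose x := u + (rho / 8 / `|w|) *: w.
have xa : `|x - a| < rho / 2.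
  have -> : x - a = (u - a) + (rho / 8 / `|w|) *: w by rewrite /x addrAC.
  apply: le_lt_trans (ler_normD _ _) _; rewrite normrZ ger0_norm; last first.
    by rewrite divr_ge0// divr_ge0// ltW.
  by rewrite divfK ?gt_eqF//; lra.
have := EN _ _ _ ur Auw xa.
rewrite /x [u + _]addrC addrK dotZr -Hnorm => h.
rewrite mulrC -ler_pdivrMr ?divr_gt0//.
apply: le_trans h; rewrite expr2 mulrA divfK ?gt_eqF// invf_div.
by rewrite mulrC.
Qed.

End Operator.

(** * Cadlag paths and total variation *)

Section Cousin.
Context {R : realType}.
Implicit Types (P Q : R -> R -> Prop) (r s t u v w : R).

(** Let r be the supremum of the points reached from s: the left half of the local hypothesis shows
    that r is reached, the right half that one can go beyond. With v = r the local hypothesis also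
    contains P r r. *)
Lemma cousin P s t : s <= t ->
  (forall u v w, s <= u -> u <= v -> v <= w -> w <= t ->
     P u v -> P v w -> P u w) ->
  (forall r, s <= r -> r <= t -> exists2 d, 0 < d &
     (forall v, r <= v -> v < r + d -> v <= t -> P r v) /\
     (forall u, s <= u -> r - d < u -> u <= r -> P u r)) ->
  P s t.
Proof.
move=> st Ptrans Ploc; pose S := [set r | s <= r <= t /\ P s r].
have Ss : S s.
  rewrite /S /=; split; first by rewrite lexx.
  by have [d d0 [+ _]] := Ploc s (lexx s) st; apply; lra.
have supS : has_sup S by split; [exists s|exists t => r [/andP[]]].
set r := sup S.
have sr : s <= r by apply: ub_le_sup => //; exact: supS.2.
have rt : r <= t by apply: ge_sup; [exists s|move=> v [/andP[]]].
have [d d0 [Pr Pl]] := Ploc r sr rt.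
have Psr : P s r.
  have [u Su ru] := sup_adherent d0 supS; have [/andP[su ut] Psu] := Su.
  have ur : u <= r by apply: ub_le_sup => //; exact: supS.2.
  by apply: (Ptrans s u r) => //; exact: Pl.
have [rt'|] := ltP r t; last by move=> tr; have <- : r = t by apply/le_anti/andP.
have [v [rv vd vt]] : exists v, [/\ r < v, v < r + d & v <= t].
  have [h|h] := leP (r + d / 2) t; first by exists (r + d / 2); split; lra.
  by exists t; split; lra.
have : S v.
  split; first by apply/andP; split; lra.
  by apply: (Ptrans s r v) => //; [exact: ltW|apply: Pr => //; exact: ltW].
by move=> /(ub_le_sup supS.2); rewrite -/r leNgt rv.
Qed.

(** The number of intervals is recorded because it enters the a priori constant and is preserved by
    time changes. *)
Inductive blocks Q : R -> R -> nat -> Prop :=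
| blocks_nil t : blocks Q t t 0
| blocks_cons s t u n : s < t -> Q s t -> blocks Q t u n -> blocks Q s u n.+1.

Lemma blocks_cat Q s t u n p : blocks Q s t n -> blocks Q t u p ->
  blocks Q s u (n + p).
Proof.
by elim=> {s t n} // s t v n st Qst _ IH /IH; exact: blocks_cons.
Qed.

Lemma blocks_le Q s t n : blocks Q s t n -> s <= t.
Proof. by elim=> {s t n} // s t u n /ltW st _ _; exact: le_trans. Qed.

Lemma blocks_exists Q s t : s <= t ->
  (forall r, s <= r -> r <= t -> exists2 d, 0 < d &
     (forall v, r < v -> v < r + d -> v <= t -> Q r v) /\
     (forall u, s <= u -> r - d < u -> u < r -> Q u r)) ->
  exists n, blocks Q s t n.
Proof.
move=> st Qloc; apply: (@cousin (fun u v => exists n, blocks Q u v n)) => //.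
  by move=> u v w _ _ _ _ [n h] [p h']; exists (n + p)%N; exact: blocks_cat h h'.
move=> r sr rt; have [d d0 [Qr Ql]] := Qloc _ sr rt; exists d => //; split.
- move=> v; rewrite le_eqVlt => /predU1P[<- _ _|rv vd vt].
    by exists 0; exact: blocks_nil.
  by exists 1; apply: blocks_cons (blocks_nil _ _) => //; exact: Qr.
- move=> u su du; rewrite le_eqVlt => /predU1P[->|ur].
    by exists 0; exact: blocks_nil.
  by exists 1; apply: blocks_cons (blocks_nil _ _) => //; exact: Ql.
Qed.

End Cousin.

Section Cadlag.
Context {R : realType} {E : normedModType R}.
Implicit Types (x : R -> E) (r s t u v e d : R).

Lemma cadlag_right x t e : cadlag x -> 0 <= t -> 0 < e ->
  exists2 d, 0 < d & forall r, t <= r -> r < t + d -> `|x r - x t| <= e.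
Proof.
move=> [+ _] t0 e0 => /(_ t t0) /cvgrPdist_le/(_ _ e0)[d /= d0 h].
exists d => // r; rewrite le_eqVlt => /predU1P[<- _|tr rd].
  by rewrite subrr normr0 ltW.
by rewrite distrC; apply: h => //=; rewrite ltr0_norm; lra.
Qed.

Lemma cadlag_left x t e : cadlag x -> 0 < t -> 0 < e ->
  exists2 d, 0 < d & forall r, t - d < r -> r < t -> `|x r - left_lim x t| <= e.
Proof.
move=> [_ +] t0 e0 => /(_ t t0) /cvgrPdist_le/(_ _ e0)[d /= d0 h].
exists d => // r dr rt; rewrite /left_lim t0.
by rewrite distrC; apply: h => //=; rewrite gtr0_norm; lra.
Qed.

Lemma left_limE x t l : 0 < t ->
  (forall e, 0 < e -> exists2 d, 0 < d &
     forall r, t - d < r -> r < t -> `|x r - l| <= e) -> left_lim x t = l.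
Proof.
move=> t0 h; rewrite /left_lim t0; apply/cvg_lim => //.
apply/cvgrPdist_le => e e0; have [d d0 dP] := h _ e0.
exists d => //= r; rewrite /= => rd rt; rewrite distrC; apply: dP => //.
by move: rd; rewrite gtr0_norm; lra.
Qed.

Lemma cadlag_intro x :
  (forall t e, 0 <= t -> 0 < e ->
     exists2 d, 0 < d & forall r, t <= r -> r < t + d -> `|x r - x t| <= e) ->
  (forall t, 0 < t -> exists l, forall e, 0 < e ->
     exists2 d, 0 < d & forall r, t - d < r -> r < t -> `|x r - l| <= e) ->
  cadlag x.
Proof.
move=> hr hl; split=> t t0.
  apply/cvgrPdist_le => e e0; have [d d0 dP] := hr _ _ t0 e0.
  exists d => //= r; rewrite /= => rd tr; rewrite distrC; apply: dP.
    exact: ltW.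
  by move: rd; rewrite ltr0_norm; lra.
have [l lP] := hl _ t0; apply/cvg_ex; exists l.
apply/cvgrPdist_le => e e0; have [d d0 dP] := lP _ e0.
exists d => //= r; rewrite /= => rd rt; rewrite distrC; apply: dP => //.
by move: rd; rewrite gtr0_norm; lra.
Qed.

(** The right end is left out, so a large jump of x at t is harmless: the blocks of a cadlag path
    may end at its jumps. *)
Definition osc_le x e s t := forall r, s <= r -> r < t -> `|x r - x s| <= e.

Lemma cadlag_osc x t e : cadlag x -> 0 <= t -> 0 < e -> exists2 d, 0 < d &
  (forall u v, t <= u -> u < t + d -> t <= v -> v < t + d -> `|x u - x v| <= e) /\
  (forall u v, 0 <= u -> t - d < u -> u < t -> 0 <= v -> t - d < v -> v < t ->
     `|x u - x v| <= e).
Proof.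
move=> xc t0 e0; have e20 : 0 < e / 2 by lra.
have tri (a b l : E) : `|a - l| <= e / 2 -> `|b - l| <= e / 2 -> `|a - b| <= e.
  move=> h1 h2; have -> : a - b = (a - l) - (b - l) by rewrite opprB addrA subrK.
  by apply: le_trans (ler_normB _ _) _; lra.
have [d1 d10 h1] := cadlag_right xc t0 e20.
have [d2 d20 h2] : exists2 d, 0 < d &
    forall r, 0 <= r -> t - d < r -> r < t -> `|x r - left_lim x t| <= e / 2.
  move: t0; rewrite le_eqVlt => /predU1P[<-|t0].
    by exists 1 => // r r0 _; rewrite ltNge r0.
  by have [d d0 h] := cadlag_left xc t0 e20; exists d => // r _; exact: h.
exists (Num.min d1 d2); first by rewrite lt_min d10.
split=> u v.
  move=> tu ud tv vd; apply: (tri _ _ (x t)); apply: h1 => //.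
    by apply: lt_le_trans ud _; rewrite lerD2l ge_min lexx.
  by apply: lt_le_trans vd _; rewrite lerD2l ge_min lexx.
move=> u0 du ut v0 dv vt; apply: (tri _ _ (left_lim x t)); apply: h2 => //.
  by apply: le_lt_trans du; rewrite lerD2l lerN2 ge_min lexx orbT.
by apply: le_lt_trans dv; rewrite lerD2l lerN2 ge_min lexx orbT.
Qed.

Lemma cadlag_blocks x T e : cadlag x -> 0 <= T -> 0 < e ->
  exists n, blocks (osc_le x e) 0 T n.
Proof.
move=> xc T0 e0; apply: blocks_exists => // r r0 rT.
have [d d0 [hr hl]] := cadlag_osc xc r0 e0; exists d => //; split.
- by move=> v rv vd _ w rw wv; apply: hr => //; lra.
- by move=> u u0 du ur w uw wr; apply: hl => //; lra.
Qed.

Lemma cadlag_bounded x T : cadlag x ->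
  exists2 B, 0 <= B & forall t, 0 <= t -> t <= T -> `|x t| <= B.
Proof.
move=> xc; have [T0|T0] := ltP T 0; first by exists 0 => // t t0; lra.
have [n] := cadlag_blocks xc T0 ltr01.
suff H s t : blocks (osc_le x 1) s t n ->
    exists2 B, 0 <= B & forall r, s <= r -> r <= t -> `|x r| <= B by exact: H.
elim=> {s t T T0 n} [t|s t u n st ost _ [B B0 BP]].
  by exists `|x t| => // r h1 h2; have -> : r = t by apply/le_anti/andP.
exists (`|x s| + 1 + B) => [|r sr ru]; first by rewrite !addr_ge0.
have [tr|rt] := leP t r.
  by apply: le_trans (BP _ tr ru) _; rewrite lerDr addr_ge0.
have -> : x r = x s + (x r - x s) by rewrite addrC subrK.
apply: le_trans (ler_normD _ _) _; have := ost _ sr rt.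
by have := normr_ge0 (x s); lra.
Qed.

(** Points approaching t from the left transfer the estimate to the left limits. At t = 0 the
    conditions force r = 0, in accordance with the convention for the left limit there. *)
Lemma left_lim_near x y t e : cadlag x -> cadlag y -> 0 <= t ->
  (forall d, 0 < d -> exists r, [/\ 0 <= r, t - d < r, r <= t,
     0 < t -> r < t & `|x r - y r| <= e]) ->
  `|left_lim x t - left_lim y t| <= e.
Proof.
move=> xc yc; rewrite le_eqVlt => /predU1P[<- h|t0 h].
  have [r [r0 _ rt _]] := h _ ltr01; rewrite /left_lim ltxx.
  by have -> : r = 0 by apply/le_anti/andP.
apply/ler_addgt0Pr => eta eta0; have e20 : 0 < eta / 2 by lra.
have [d1 d10 h1] := cadlag_left xc t0 e20.
have [d2 d20 h2] := cadlag_left yc t0 e20.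
have d0 : 0 < Num.min d1 d2 by rewrite lt_min d10.
have [r [r0 dr _ /(_ t0) rt xy]] := h _ d0.
have dd1 : Num.min d1 d2 <= d1 by rewrite ge_min lexx.
have dd2 : Num.min d1 d2 <= d2 by rewrite ge_min lexx orbT.
have h1r : `|x r - left_lim x t| <= eta / 2 by apply: h1 => //; lra.
have h2r : `|y r - left_lim y t| <= eta / 2 by apply: h2 => //; lra.
have -> : left_lim x t - left_lim y t =
    (x r - y r) - (x r - left_lim x t) + (y r - left_lim y t).
  by rewrite opprB [_ - _ + (_ - x r)]addrC !addrA !subrK.
apply: le_trans (ler_normD _ _) _; apply: le_trans (lerD (ler_normB _ _) (lexx _)) _.
lra.
Qed.

End Cadlag.

(** * Total variation of vector-valued paths *)

Section Variation.
Context {R : realType} {E : normedModType R}.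
Implicit Types (x : R -> E) (a b c s t u v e d T : R) (p : seq R).

Fixpoint psum x a p : R :=
  if p is c :: p' then `|x c - x a| + psum x c p' else 0.

Lemma psum_ge0 x a p : 0 <= psum x a p.
Proof. by elim: p a => //= c p IH a; rewrite addr_ge0. Qed.

Lemma psumE x a b p :
  \sum_(0 <= i < size p) `|x (nth b (a :: p) i.+1) - x (nth b (a :: p) i)| =
  psum x a p.
Proof.
elim: p a => [|c p IH] a /=; first by rewrite big_nil.
by rewrite big_nat_recl//= -IH.
Qed.

Lemma psum_cat x a p q : psum x a (p ++ q) = psum x a p + psum x (last a p) q.
Proof. by elim: p a => [|c p IH] a /=; rewrite ?add0r// IH addrA. Qed.

Lemma VarE a b x :
  Var a b x = ereal_sup [set (psum x a p)%:E | p in itv_partition a b].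
Proof. by rewrite /Var; congr ereal_sup; apply: eq_imagel => p _; rewrite psumE. Qed.

Lemma psum_le_Var x a b p : itv_partition a b p -> ((psum x a p)%:E <= Var a b x)%E.
Proof. by move=> h; rewrite VarE; apply: ereal_sup_ubound; exists p. Qed.

Lemma itv_partition_ex a b : a <= b -> exists p, itv_partition a b p.
Proof.
rewrite le_eqVlt => /predU1P[->|ab]; first by exists [::]; rewrite /itv_partition /=.
by exists [:: b]; exact: itv_partition1.
Qed.

Lemma itv_partition_in a b p t : itv_partition a b p -> t \in a :: p -> a <= t <= b.
Proof.
elim: p a t => [|c p IH] a t; first by move=> [_ /eqP /= <-]; rewrite inE => /eqP ->; rewrite lexx.
move=> [/= /andP[ac cp] lp]; have h : itv_partition c b p by split.
have /andP[_ cb] := IH c c h (mem_head _ _).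
rewrite inE => /predU1P[->|/(IH c t h)/andP[ct ->]].
  by rewrite lexx (le_trans (ltW ac) cb).
by rewrite (le_trans (ltW ac) ct).
Qed.

Lemma Var_ge0 a b x : a <= b -> (0 <= Var a b x)%E.
Proof.
move=> /itv_partition_ex[p /(psum_le_Var x)]; apply: le_trans.
by rewrite lee_fin psum_ge0.
Qed.

Lemma Var_ge a b x : a <= b -> (`|x b - x a|%:E <= Var a b x)%E.
Proof.
rewrite le_eqVlt => /predU1P[->|ab]; first by rewrite subrr normr0 Var_ge0.
have := psum_le_Var x (itv_partition1 ab); by rewrite /= addr0.
Qed.

(** Telescoping along a partition. Bounds of variations below are obtained by exhibiting such a
    control function psi. *)
Lemma Var_le_psi a b x (psi : R -> R) :
  (forall u v, a <= u -> u <= v -> v <= b -> `|x v - x u| <= psi v - psi u) ->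
  (Var a b x <= (psi b - psi a)%:E)%E.
Proof.
move=> h; rewrite VarE; apply: ge_ereal_sup => _ [p [ap /eqP lp] <-].
rewrite lee_fin; elim: p a h ap lp => [|c p IH] a h /=; first by move=> _ ->; rewrite subrr.
move=> /andP[ac cp] lp.
have cb : c <= b.
  rewrite -lp; move: cp; elim: p c {IH lp ac} => //= d p IH c /andP[/ltW cd /IH].
  exact: le_trans.
have := h a c (lexx _) (ltW ac) cb.
have := IH c (fun u v cu => h u v (le_trans (ltW ac) cu)) cp lp.
by lra.
Qed.

Lemma Var_superadd a b c x : a <= b -> b <= c ->
  (Var a b x + Var b c x <= Var a c x)%E.
Proof.
move=> ab bc; rewrite [X in (X + _)%E]VarE [X in (_ + X)%E]VarE.
have [->|fin] := eqVneq (Var a c x) +oo%E; first exact: leey.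
have Vfin : Var a c x \is a fin_num.
  by rewrite ge0_fin_numE ?Var_ge0 ?(le_trans ab)// lt_neqAle fin leey.
rewrite -(fineK Vfin); set V := fine _.
have sub p q : itv_partition a b p -> itv_partition b c q ->
    psum x a p + psum x b q <= V.
  move=> hp hq; have [_ /eqP lp] := hp.
  rewrite -lee_fin (fineK Vfin) -lp -psum_cat; apply: psum_le_Var.
  exact: itv_partition_cat hp hq.
have [q0 q0P] := itv_partition_ex bc.
have h1 q : itv_partition b c q ->
    (ereal_sup [set (psum x a p)%:E | p in itv_partition a b] <= (V - psum x b q)%:E)%E.
  move=> hq; apply: ge_ereal_sup => _ [p hp <-].
  by rewrite lee_fin; have := sub _ _ hp hq; lra.
have [p0 p0P] := itv_partition_ex ab.
set Sa := ereal_sup _ in h1 *.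
have Safin : Sa \is a fin_num.
  rewrite fin_numE; apply/andP; split.
    rewrite gt_eqF// (@lt_le_trans _ _ (psum x a p0)%:E) ?ltNyr//.
    by apply: ereal_sup_ubound; exists p0.
  by rewrite lt_eqF// (le_lt_trans (h1 _ q0P)) ?ltry.
rewrite -(fineK Safin) -leeBrDl// -EFinB; apply: ge_ereal_sup => _ [q hq <-].
by rewrite lee_fin; have := h1 _ hq; rewrite -(fineK Safin) lee_fin; lra.
Qed.

Definition Vr a b x : R := fine (Var a b x).

Section Finite.
Variables (x : R -> E) (T : R).
Hypothesis xbv : (Var 0 T x < +oo)%E.

Lemma Var_fin a b : 0 <= a -> a <= b -> b <= T -> Var a b x = (Vr a b x)%:E.
Proof.
move=> a0 ab bT; rewrite fineK// ge0_fin_numE ?Var_ge0//.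
apply: le_lt_trans xbv; apply: (@le_trans _ _ (Var 0 b x)).
  apply: le_trans (Var_superadd x a0 ab).
  by rewrite leeDr// Var_ge0.
apply: le_trans (Var_superadd x (le_trans a0 ab) bT).
by rewrite leeDl// Var_ge0.
Qed.

Lemma Vr_ge0 a b : 0 <= a -> a <= b -> b <= T -> 0 <= Vr a b x.
Proof. by move=> a0 ab bT; rewrite -lee_fin -Var_fin// Var_ge0. Qed.

Lemma Vr_ge a b : 0 <= a -> a <= b -> b <= T -> `|x b - x a| <= Vr a b x.
Proof. by move=> a0 ab bT; rewrite -lee_fin -Var_fin// Var_ge. Qed.

(** One half is [Var_superadd]. For the other, the control function is the variation counted from a
    up to b, continued beyond b by the variation counted from b. *)
Lemma VrD a b c : 0 <= a -> a <= b -> b <= c -> c <= T ->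
  Vr a c x = Vr a b x + Vr b c x.
Proof.
move=> a0 ab bc cT; have b0 := le_trans a0 ab; have bT := le_trans bc cT.
have sup u v w : 0 <= u -> u <= v -> v <= w -> w <= T ->
    Vr u v x + Vr v w x <= Vr u w x.
  move=> u0 uv vw wT; have := Var_superadd x uv vw.
  by rewrite !Var_fin ?lee_fin//; lra.
apply/le_anti/andP; split; last exact: sup.
pose psi t := if t <= b then Vr a t x else Vr a b x + Vr b t x.
suff : (Var a c x <= (psi c - psi a)%:E)%E.
  rewrite Var_fin ?(le_trans ab)// lee_fin => /le_trans; apply.
  have Vaa : 0 <= Vr a a x by apply: Vr_ge0 => //; lra.
  rewrite /psi ab; case: ifPn => [cb|_]; last by lra.
  have -> : c = b by apply/le_anti/andP.
  have Vbb : 0 <= Vr b b x by apply: Vr_ge0.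
  by lra.
apply: Var_le_psi => u v au uv vc.
rewrite /psi; case: (leP v b) => vb.
  rewrite (le_trans uv vb).
  have := Vr_ge (le_trans a0 au) uv (le_trans vc cT).
  have := @sup a u v a0 au uv (le_trans vc cT).
  by lra.
case: (leP u b) => ub.
  have -> : x v - x u = (x v - x b) + (x b - x u) by rewrite addrA subrK.
  apply: le_trans (ler_normD _ _) _.
  have := Vr_ge (le_trans a0 au) ub bT.
  have := Vr_ge b0 (ltW vb) (le_trans vc cT).
  have := @sup a u b a0 au ub bT.
  by lra.
have := Vr_ge (le_trans a0 au) uv (le_trans vc cT).
have := @sup b u v b0 (ltW ub) uv (le_trans vc cT).
by lra.
Qed.

Lemma Vr_xx a : 0 <= a -> a <= T -> Vr a a x = 0.
Proof. by move=> a0 aT; have := VrD a0 (lexx a) (lexx a) aT; lra. Qed.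

Lemma Vr_le a b c d : 0 <= a -> a <= b -> b <= c -> c <= d -> d <= T ->
  Vr b c x <= Vr a d x.
Proof.
move=> a0 ab bc cd dT; have b0 := le_trans a0 ab; have c0 := le_trans b0 bc.
rewrite (@VrD a b d)// ?(le_trans bc)// (@VrD b c d)//.
have := Vr_ge0 a0 ab (le_trans bc (le_trans cd dT)).
have := Vr_ge0 c0 cd dT; lra.
Qed.

(** Take a nearly optimal partition of [s, T] with first point c after s. Replacing s by some t
    before c loses at most |x t - x s|, so the variation over [t, T] is almost that over [s, T]. *)
Lemma Vr_right s : 0 <= s -> s < T ->
  (forall e, 0 < e -> exists2 d, 0 < d &
     forall t, s <= t -> t < s + d -> `|x t - x s| <= e) ->
  forall e, 0 < e -> exists2 d, 0 < d &
     forall t, s <= t -> t < s + d -> t <= T -> Vr s t x <= e.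
Proof.
move=> s0 sT xs e e0; have e20 : 0 < e / 2 by lra.
have Vfin := Var_fin s0 (ltW sT) (lexx T).
have : Var s T x \is a fin_num by rewrite Vfin.
rewrite VarE => /(ub_ereal_sup_adherent e20)[_ [p sp <-]].
rewrite -VarE Vfin -EFinB lte_fin => hp.
case: p sp hp => [[_ /eqP /= E1]|c p [/= /andP[sc cp] lp] hp]; first by lra.
have [d d0 dP] := xs _ e20.
exists (Num.min d (c - s)); first by rewrite lt_min d0 subr_gt0.
move=> t st td tT.
have dd : Num.min d (c - s) <= d by rewrite ge_min lexx.
have dc : Num.min d (c - s) <= c - s by rewrite ge_min lexx orbT.
have xt : `|x t - x s| <= e / 2 by apply: dP => //; lra.
have tc : t < c by lra.
have : psum x t (c :: p) <= Vr t T x.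
  rewrite -lee_fin -Var_fin ?(le_trans s0)//; apply: psum_le_Var.
  by split => //=; rewrite tc.
rewrite /= => h; have := VrD s0 st tT (lexx T).
have : `|x c - x s| <= `|x c - x t| + `|x t - x s| by rewrite ler_distD.
lra.
Qed.

Lemma Vr_left t : 0 < t -> t <= T ->
  (forall e, 0 < e -> exists2 d, 0 < d &
     forall s, t - d < s -> s < t -> `|x t - x s| <= e) ->
  forall e, 0 < e -> exists2 d, 0 < d &
     forall s, t - d < s -> s <= t -> 0 <= s -> Vr s t x <= e.
Proof.
move=> t0 tT xt e e0; have e20 : 0 < e / 2 by lra.
have Vfin := Var_fin (lexx 0) (ltW t0) tT.
have : Var 0 t x \is a fin_num by rewrite Vfin.
rewrite VarE => /(ub_ereal_sup_adherent e20)[_ [p sp <-]].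
rewrite -VarE Vfin -EFinB lte_fin => hp.
case/lastP: p sp hp => [[_ /eqP /= E1]|p c [pp lp] hp]; first by lra.
move: pp lp hp; rewrite rcons_path last_rcons => /andP[pp pc] /eqP ct.
rewrite -cats1 psum_cat /= addr0 ct; set b := last 0 p in pc *.
have [d d0 dP] := xt _ e20; rewrite ct in pc => hp.
exists (Num.min d (t - b)); first by rewrite lt_min d0 subr_gt0.
move=> s ds st s0.
have dd : Num.min d (t - b) <= d by rewrite ge_min lexx.
have db : Num.min d (t - b) <= t - b by rewrite ge_min lexx orbT.
have bs : b < s by lra.
move: st; rewrite le_eqVlt => /predU1P[->|st].
  by rewrite Vr_xx ?(ltW t0)// ltW.
have xts : `|x t - x s| <= e / 2 by apply: dP => //; lra.
have : psum x 0 (rcons p s) <= Vr 0 s x.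
  rewrite -lee_fin -Var_fin ?(le_trans (ltW st))//; apply: psum_le_Var.
  by split; rewrite ?last_rcons ?eqxx// rcons_path pp.
rewrite -cats1 psum_cat /= addr0 -/b => h.
have := VrD (lexx 0) s0 (ltW st) tT.
have : `|x t - x b| <= `|x t - x s| + `|x s - x b| by rewrite ler_distD.
lra.
Qed.

End Finite.

Lemma Vr_le_psi a b x (psi : R -> R) : a <= b ->
  (forall u v, a <= u -> u <= v -> v <= b -> `|x v - x u| <= psi v - psi u) ->
  Vr a b x <= psi b - psi a.
Proof.
move=> ab h; rewrite -lee_fin fineK; first exact: Var_le_psi.
by rewrite ge0_fin_numE ?Var_ge0// (le_lt_trans (Var_le_psi h)) ?ltry.
Qed.

End Variation.

(** * Jumps of a path of bounded variation *)

Section Jumps.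
Context {R : realType} {E : completeNormedModType R}.
Variable k : R -> E.
Hypotheses (kc : cadlag k) (kbv : BV_loc k).
Implicit Types (r s t u v e T : R) (A F : {fset R}).

Local Notation V s t := (Vr s t k).

Lemma BVfin T : (Var 0 T k < +oo)%E.
Proof.
have [T0|T0] := leP 0 T; first exact: kbv.
(* For T < 0 there is no partition, and the supremum of the empty set is [-oo]. *)
rewrite VarE (_ : [set _ | _ in _] = set0) ?ereal_sup0 ?ltNye//.
apply/seteqP; split=> // y [p pP _]; have /andP[_] := itv_partition_in pP (mem_head _ _).
by rewrite leNgt T0.
Qed.

Lemma jump0 : jump k 0 = 0.
Proof. by rewrite /jump /left_lim ltxx subrr. Qed.

Lemma jump_le_V s t : 0 <= s -> s < t -> `|jump k t| <= V s t.
Proof.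
move=> s0 st; have t0 := le_lt_trans s0 st; apply/ler_addgt0Pr => e e0.
have [d d0 dP] := cadlag_left kc t0 e0.
have [u [su du ut]] : exists u, [/\ s <= u, t - d < u & u < t].
  have [h|h] := leP (t - d / 2) s; first by exists s; split; lra.
  by exists (t - d / 2); split; lra.
have := Vr_ge (BVfin t) (le_trans s0 su) (ltW ut) (lexx t).
have := Vr_le (BVfin t) s0 su (ltW ut) (lexx t) (lexx t).
have -> : jump k t = (k t - k u) + (k u - left_lim k t) by rewrite addrA subrK.
have := dP _ du ut; have := ler_normD (k t - k u) (k u - left_lim k t); lra.
Qed.

(** Once sorted, the jump times cut ]s, t] into consecutive intervals, each of which pays for one
    jump by its own variation. *)
Lemma jumps_le_V A s t : 0 <= s -> s <= t ->
  \sum_(r <- A | s < r <= t) `|jump k r| <= V s t.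
Proof.
move=> s0 st; rewrite -big_filter; set l := [seq r <- A | s < r <= t].
have -> : \sum_(r <- l) `|jump k r| = \sum_(r <- sort <=%R l) `|jump k r|.
  by apply: perm_big; rewrite perm_sym perm_sort.
have : sorted <%R (sort <=%R l) by rewrite sort_lt_sorted filter_uniq// fset_uniq.
have : forall r, r \in sort <=%R l -> s < r <= t.
  by move=> r; rewrite mem_sort mem_filter => /andP[].
move: (sort <=%R l) => {l}q; elim: q s s0 st => [|r q IH] s s0 st h.
  by move=> _; rewrite big_nil (Vr_ge0 (BVfin t)).
move=> /= pq; have /andP[sr rt] := h r (mem_head _ _).
rewrite big_cons (VrD (BVfin t) s0 (ltW sr) rt (lexx t)).
have r0 := le_trans s0 (ltW sr).
apply: lerD; first exact: jump_le_V.
apply: IH => //; last exact: path_sorted pq.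
move=> r' r'q; have /andP[_ ->] := h r' (mem_behead (s := r :: q) r'q).
rewrite andbT; move: pq; rewrite lt_path_sortedE => /andP[/allP/(_ _ r'q)] //.
Qed.

Definition jsum A s t : E := \sum_(r <- A | s < r <= t) jump k r.
Definition jabs A s t : R := \sum_(r <- A | s < r <= t) `|jump k r|.

Lemma jsum_le_jabs A s t : `|jsum A s t| <= jabs A s t.
Proof. exact: ler_norm_sum. Qed.

Lemma jabs_ge0 A s t : 0 <= jabs A s t.
Proof. exact: sumr_ge0. Qed.

Lemma big_ocD (M : zmodType) (f : R -> M) A s t u : s <= t -> t <= u ->
  \sum_(r <- A | s < r <= u) f r =
  \sum_(r <- A | s < r <= t) f r + \sum_(r <- A | t < r <= u) f r.
Proof.
move=> st tu; rewrite (bigID (fun r => r <= t)) /=; congr (_ + _).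
  apply: eq_bigl => r; case: (leP r t) => rt; rewrite ?andbF ?andbT//.
  by rewrite (le_trans rt tu) andbT.
apply: eq_bigl => r; case: (leP r t) => rt; rewrite ?andbF ?andbT//.
by rewrite (le_lt_trans st rt).
Qed.

Lemma big_fsetUD (M : nmodType) (f : R -> M) A F s t : (F `<=` A)%fset ->
  \sum_(r <- A | s < r <= t) f r =
  \sum_(r <- F | s < r <= t) f r + \sum_(r <- (A `\` F)%fset | s < r <= t) f r.
Proof.
move=> FA; rewrite -big_cat; apply: perm_big; apply: uniq_perm.
- exact: fset_uniq.
- rewrite cat_uniq !fset_uniq andbT /=; apply/hasPn => r.
  by rewrite in_fsetD => /andP[].
move=> r; rewrite mem_cat in_fsetD; case: (boolP (r \in F)) => //=.
by move=> /(fsubsetP FA).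
Qed.

Definition jtot t : R := sup (range (fun A => jabs A 0 t)).

Lemma jtot_sup t : 0 <= t -> has_sup (range (fun A => jabs A 0 t)).
Proof.
move=> t0; split; first by exists (jabs fset0 0 t), fset0.
by exists (V 0 t) => _ [A _ <-]; exact: jumps_le_V.
Qed.

Lemma jabs_jtot A t : 0 <= t -> jabs A 0 t <= jtot t.
Proof. by move=> t0; apply: ub_le_sup; [case: (jtot_sup t0)|exists A]. Qed.

(** A, for the jumps in ]s, t], and an arbitrary B, for those in ]0, s], are combined into one test
    set, their union. *)
Lemma jabs_jtotB A s t : 0 <= s -> s <= t -> jabs A s t <= jtot t - jtot s.
Proof.
move=> s0 st; rewrite lerBrDl -lerBrDr; apply: ge_sup.
  by case: (jtot_sup s0).
move=> _ [B _ <-]; rewrite lerBrDr; apply: le_trans (jabs_jtot (A `|` B)%fset (le_trans s0 st)).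
rewrite /jabs (big_ocD _ _ s0 st); apply: lerD.
  by rewrite (big_fsetUD _ _ _ (fsubsetUr A B)) lerDl sumr_ge0.
by rewrite (big_fsetUD _ _ _ (fsubsetUl A B)) lerDl sumr_ge0.
Qed.

Lemma jtot_le_V s t : 0 <= s -> s <= t -> jtot t - jtot s <= V s t.
Proof.
move=> s0 st; have t0 := le_trans s0 st.
rewrite lerBlDr; apply: ge_sup; first by case: (jtot_sup t0).
move=> _ [A _ <-]; rewrite /jabs (big_ocD _ _ s0 st) addrC.
by apply: lerD; [exact: jumps_le_V|exact: jabs_jtot].
Qed.

(** The mass of the jumps in ]0, t] that F misses. It is nondecreasing in t, so its increments can
    serve as additive error terms when intervals are glued. *)
Definition jtail F t : R := jtot t - jabs F 0 t.

Lemma jtailB F s t : 0 <= s -> s <= t ->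
  jtail F t - jtail F s = jtot t - jtot s - jabs F s t.
Proof. by move=> s0 st; rewrite /jtail /jabs (big_ocD _ _ s0 st); ring. Qed.

Lemma jabs_jtail A F s t : 0 <= s -> s <= t -> (F `<=` A)%fset ->
  jabs (A `\` F)%fset s t <= jtail F t - jtail F s.
Proof.
move=> s0 st FA; rewrite jtailB// lerBrDl -/(jabs F s t).
by rewrite /jabs -big_fsetUD//; exact: jabs_jtotB.
Qed.

Lemma jtail_le F s t : 0 <= s -> s <= t -> jtail F s <= jtail F t.
Proof.
move=> s0 st; rewrite -subr_ge0; apply: le_trans (jabs_jtail s0 st (fsubset_refl F)).
exact: jabs_ge0.
Qed.

Lemma jump_jtail F s t : 0 <= s -> s < t -> t \notin F ->
  `|jump k t| <= jtail F t - jtail F s.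
Proof.
move=> s0 st tF.
have := jabs_jtail s0 (ltW st) (fsubsetUr [fset t]%fset F); apply: le_trans.
rewrite /jabs (big_fsetUD _ _ _ (F := [fset t]%fset)).
  by rewrite big_mkcond big_seq_fset1 st lexx lerDl sumr_ge0.
apply/fsubsetP => r; rewrite in_fset1 => /eqP ->.
by rewrite in_fsetD tF in_fsetU in_fset1 eqxx.
Qed.

Lemma jtail_small T e : 0 <= T -> 0 < e ->
  exists F, forall s t, 0 <= s -> s <= t -> t <= T -> jtail F t - jtail F s <= e.
Proof.
move=> T0 e0; have [_ [F _ <-] FP] := sup_adherent e0 (jtot_sup T0).
exists F => s t s0 st tT.
have := jtail_le F (lexx 0) s0; have := jtail_le F (le_trans s0 st) tT.
have : jtail F 0 = 0.
  rewrite /jtail /jabs big1 => [|r /andP[/lt_le_trans h /h]]; last by rewrite ltxx.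
  rewrite subr0; apply/le_anti/andP; split; last exact: le_trans (jabs_ge0 fset0 0 0) (jabs_jtot fset0 (lexx 0)).
  rewrite /jtot; apply: ge_sup; first by case: (jtot_sup (lexx 0)).
  by move=> _ [A _ <-]; rewrite /jabs big1// => r /andP[/lt_le_trans h /h]; rewrite ltxx.
by move: FP; rewrite /jtail -/(jtot T); lra.
Qed.

(** By the convention at 0 there is no jump there, so the sums over [0, t] and over ]0, t] agree. *)
Let psum_jsum t A : summability.partial_sum (fun s => if 0 <= s <= t then jump k s else 0) A
  = jsum A 0 t.
Proof.
rewrite /summability.partial_sum /jsum -(big_seq_fsetE _ _ xpredT
  (fun s => if 0 <= s <= t then jump k s else 0)) /= [RHS]big_mkcond /=.
apply: eq_bigr => r _; have [->|r0] := eqVneq r 0.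
  by rewrite jump0 ltxx; case: ifP.
by rewrite lt_def r0.
Qed.

Lemma disc_part_cvg t : 0 <= t ->
  jsum A 0 t @[A --> summability.totally] --> disc_part k t.
Proof.
move=> t0; have FF := @summability.totally_filter R.
rewrite /disc_part /summability.sum; under eq_fun do rewrite -psum_jsum.
suff : cvg (jsum A 0 t @[A --> summability.totally]).
  by under eq_fun do rewrite -psum_jsum.
apply/cauchy_cvgP/cauchy_exP => e e0; have e20 : 0 < e / 2 by lra.
have [F FP] := jtail_small t0 e20; exists (jsum F 0 t); exists F => //= A FA.
rewrite -ball_normE /= /jsum (big_fsetUD _ _ _ FA) opprD addNKr normrN.
apply: le_lt_trans (jsum_le_jabs _ _ _) _.
apply: le_lt_trans (jabs_jtail (lexx 0) t0 FA) _.
by apply: le_lt_trans (FP _ _ (lexx 0) t0 (lexx t)) _; lra.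
Qed.

(** The form in which the discontinuous part is used: up to the tail of F, its increments are finite
    sums of jumps. The proof passes to the limit along the finite sets containing F. *)
Lemma disc_part_jsum F s t : 0 <= s -> s <= t ->
  `|disc_part k t - disc_part k s - jsum F s t| <= jtail F t - jtail F s.
Proof.
move=> s0 st; have t0 := le_trans s0 st; have FF := @summability.totally_filter R.
apply: (@cvgr_to_le _ summability.totally _ _
  (fun A => `|jsum A 0 t - jsum A 0 s - jsum F s t|)).
  apply: cvg_norm; apply: cvgB; last exact: cvg_cst.
  by apply: cvgB; exact: disc_part_cvg.
exists F => //= A FA; rewrite {1}/jsum (big_ocD _ _ s0 st) -/(jsum A 0 s).
rewrite [jsum A 0 s + _]addrC addrK (big_fsetUD _ _ _ FA) -/(jsum F s t).
rewrite [jsum F s t + _]addrC addrK.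
exact: le_trans (jsum_le_jabs _ _ _) (jabs_jtail s0 st FA).
Qed.

Lemma disc_part_jtot s t : 0 <= s -> s <= t ->
  `|disc_part k t - disc_part k s| <= jtot t - jtot s.
Proof.
move=> s0 st; have := disc_part_jsum fset0 s0 st.
rewrite jtailB// /jsum /jabs big_mkcond big_seq_fset0 big_mkcond big_seq_fset0.
by rewrite !subr0.
Qed.

Lemma disc_part_le_V s t : 0 <= s -> s <= t ->
  `|disc_part k t - disc_part k s| <= V s t.
Proof. by move=> s0 st; apply: le_trans (disc_part_jtot s0 st) (jtot_le_V s0 st). Qed.

Lemma Vr_disc_part s t : 0 <= s -> s <= t -> Vr s t (disc_part k) <= V s t.
Proof.
move=> s0 st; rewrite (_ : V s t = V 0 t - V 0 s); last first.
  by rewrite (VrD (BVfin t) (lexx 0) s0 st (lexx t)); ring.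
apply: (@Vr_le_psi _ _ _ _ _ (fun r => V 0 r)) => // u v su uv vt.
have u0 := le_trans s0 su; have := disc_part_le_V u0 uv.
by rewrite (VrD (BVfin v) (lexx 0) u0 uv (lexx v)); lra.
Qed.

Lemma cont_partB s t : cont_part k t - cont_part k s =
  (k t - k s) - (disc_part k t - disc_part k s).
Proof. by rewrite /cont_part !opprB addrACA [RHS]addrACA; congr (_ + _); rewrite addrC. Qed.

Lemma cont_part_le_V s t : 0 <= s -> s <= t ->
  `|cont_part k t - cont_part k s| <= 2 * V s t.
Proof.
move=> s0 st; have := disc_part_le_V s0 st.
have := Vr_ge (BVfin t) s0 st (lexx t).
rewrite cont_partB.
by have := ler_normB (k t - k s) (disc_part k t - disc_part k s); lra.
Qed.

Lemma Vr_cont_part s t : 0 <= s -> s <= t -> Vr s t (cont_part k) <= 2 * V s t.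
Proof.
move=> s0 st; rewrite (_ : V s t = V 0 t - V 0 s); last first.
  by rewrite (VrD (BVfin t) (lexx 0) s0 st (lexx t)); ring.
rewrite mulrBr; apply: (@Vr_le_psi _ _ _ _ _ (fun r => 2 * V 0 r)) => // u v su uv vt.
have u0 := le_trans s0 su; have := cont_part_le_V u0 uv.
by rewrite (VrD (BVfin v) (lexx 0) u0 uv (lexx v)); lra.
Qed.

Lemma BV_disc_part : BV_loc (disc_part k).
Proof.
move=> T T0; apply: le_lt_trans (ltry (V 0 T - V 0 0)).
apply: (@Var_le_psi _ _ _ _ _ (fun r => V 0 r)) => u v u0 uv vT.
have := disc_part_le_V u0 uv.
by rewrite (VrD (BVfin v) (lexx 0) u0 uv (lexx v)); lra.
Qed.

Lemma BV_cont_part : BV_loc (cont_part k).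
Proof.
move=> T T0; apply: le_lt_trans (ltry (2 * V 0 T - 2 * V 0 0)).
apply: (@Var_le_psi _ _ _ _ _ (fun r => 2 * V 0 r)) => u v u0 uv vT.
have := cont_part_le_V u0 uv.
by rewrite (VrD (BVfin v) (lexx 0) u0 uv (lexx v)); lra.
Qed.

Lemma V_right s e : 0 <= s -> 0 < e -> exists2 d, 0 < d &
  forall t, s <= t -> t < s + d -> V s t <= e.
Proof.
move=> s0 e0; have s1 : s < s + 1 by lra.
have [d d0 dP] := Vr_right (BVfin (s + 1)) s0 s1 (fun e => cadlag_right kc s0) e0.
exists (Num.min d 1); first by rewrite lt_min d0 ltr01.
have d1 : Num.min d 1 <= d by rewrite ge_min lexx.
have d2 : Num.min d 1 <= 1 by rewrite ge_min lexx orbT.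
by move=> t st td; apply: dP => //; lra.
Qed.

Lemma cont_part_right s e : 0 <= s -> 0 < e -> exists2 d, 0 < d &
  forall t, s <= t -> t < s + d -> `|cont_part k t - cont_part k s| <= e.
Proof.
move=> s0 e0; have e20 : 0 < e / 2 by lra.
have [d d0 dP] := V_right s0 e20; exists d => // t st /(dP _ st).
by have := cont_part_le_V s0 st; lra.
Qed.

(** Together the two implications say that a point of l at distance less than d from t is t
    itself. *)
Lemma seq_gap (l : seq R) t : exists2 d, 0 < d &
  forall r, r \in l -> (t - d < r -> t <= r) /\ (r < t + d -> r <= t).
Proof.
elim: l => [|r l [d d0 dP]]; first by exists 1.
have [d' d'0 d'P] : exists2 d', 0 < d' & (t - d' < r -> t <= r) /\ (r < t + d' -> r <= t).
  by have [rt|tr|->] := ltgtP r t; [exists (t - r)|exists (r - t)|exists 1] => //;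
    try split; lra.
have m1 : Num.min d d' <= d by rewrite ge_min lexx.
have m2 : Num.min d d' <= d' by rewrite ge_min lexx orbT.
exists (Num.min d d'); first by rewrite lt_min d0.
move=> u; rewrite inE => /predU1P[->|/dP[h1 h2]].
  by case: d'P => h1 h2; split=> h; [apply: h1|apply: h2]; lra.
by split=> h; [apply: h1|apply: h2]; lra.
Qed.

(** If t is in F, the finite jump sum over ]s, t] reduces to the jump at t once s is past the
    earlier points of F; if not, the jump at t belongs to the small tail. In both cases it cancels
    against k_t - k_{t-}. *)
Lemma cont_part_left t e : 0 < t -> 0 < e -> exists2 d, 0 < d &
  forall s, 0 <= s -> t - d < s -> s < t -> `|cont_part k t - cont_part k s| <= e.
Proof.
move=> t0 e0; have e30 : 0 < e / 3 by lra.
have [d1 d10 h1] := cadlag_left kc t0 e30.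
have [F FP] := jtail_small (ltW t0) e30.
have [d2 d20 h2] := seq_gap F t.
have m1 : Num.min d1 d2 <= d1 by rewrite ge_min lexx.
have m2 : Num.min d1 d2 <= d2 by rewrite ge_min lexx orbT.
exists (Num.min d1 d2); first by rewrite lt_min d10.
move=> s s0 ds st; rewrite cont_partB.
have tailP := FP s t s0 (ltW st) (lexx t).
have jF : `|jump k t - jsum F s t| <= e / 3.
  have sumE : jsum F s t = \sum_(r <- F | r == t) jump k r.
    rewrite /jsum big_seq_cond [RHS]big_seq_cond; apply: eq_bigl => r.
    case: (boolP (r \in F)) => //= /h2[h _]; apply/idP/eqP => [/andP[sr rt]|->].
      by apply/le_anti; rewrite rt h//; lra.
    by rewrite st lexx.
  rewrite sumE; case: (boolP (t \in F)) => tF.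
    rewrite -big_filter filter_pred1_uniq ?fset_uniq// big_seq1 subrr normr0.
    exact: ltW.
  rewrite big_seq_cond big1 => [|r /andP[rF /eqP rt]]; last by rewrite -rt rF in tF.
  by rewrite subr0; apply: le_trans (jump_jtail s0 st tF) tailP.
have ks := h1 s; have {}ks : `|k s - left_lim k t| <= e / 3 by apply: ks => //; lra.
have dk := le_trans (disc_part_jsum F s0 (ltW st)) tailP.
have -> : k t - k s - (disc_part k t - disc_part k s) =
    - (k s - left_lim k t) + (jump k t - jsum F s t)
     - (disc_part k t - disc_part k s - jsum F s t).
  rewrite /jump; move: (disc_part k t - _) (jsum F s t) (left_lim k t) => a b c.
  rewrite !opprB !addrA subrK; congr (_ - a).
  by rewrite [RHS]addrAC (addrAC c) subrr sub0r addrC.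
by apply: le_trans (ler_normB _ _) _; have := ler_normD (- (k s - left_lim k t))
  (jump k t - jsum F s t); rewrite normrN; lra.
Qed.

End Jumps.

(** * Lebesgue-Stieltjes integrals *)

Section Piecewise.
Context {R : realType}.

Lemma measurable_piecewise (c : R) d (T : measurableType d) (G : int -> R -> T) :
  0 < c -> (forall z, measurable_fun (setT : set (measurableTypeR R)) (G z)) ->
  measurable_fun (setT : set (measurableTypeR R)) (fun r => G (Num.floor (r * c)) r).
Proof.
move=> c0 mG _ Y mY; rewrite setTI.
have -> : (fun r => G (Num.floor (r * c)) r) @^-1` Y =
    \bigcup_(z : int) (`[z%:~R / c, (z + 1)%:~R / c[%classic `&` (G z @^-1` Y)).
  apply/seteqP; split=> r /=.
    move=> Yr; exists (Num.floor (r * c)) => //; split => //=.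
    by rewrite in_itv /= ler_pdivrMr// ltr_pdivlMr// floor_itv.
  move=> [z _ [+ Yz]]; rewrite /= in_itv /= ler_pdivrMr// ltr_pdivlMr//.
  by move=> /floor_def ->.
apply: countable_bigcupT_measurable => // z; apply: measurableI.
  exact: measurable_itv.
by rewrite -[X in measurable X]setTI; exact: mG.
Qed.

End Piecewise.

Section CadlagMeasurable.
Context {R : realType} {H : completeNormedModType R} (dot : {dot H for idfun}).
Hypothesis Hnorm : hilbert_norm dot.
Implicit Types (x h : R -> H) (s t : R).

(** By right continuity x_r is the limit of its values at the next points of the grids of mesh 1 /
    (n + 1), which lie strictly to the right of r. For a fixed grid the function is a countable
    patchwork of measurable scalar functions. *)
Lemma measurable_cadlag_dot x h al s t : cadlag x -> 0 <= s ->
  (forall e, measurable_fun (setT : set (measurableTypeR R)) (fun r => dot (h r) e)) ->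
  measurable_fun (`]s, t] : set (measurableTypeR R)) (fun r => dot (x r - al) (h r)).
Proof.
move=> xc s0 mh.
pose g n r := dot (x ((Num.floor (r * n.+1%:R) + 1)%:~R / n.+1%:R) - al) (h r).
apply: (@measurable_realfun.measurable_fun_cvg _ _ _ _ g) => [n|r].
  apply: (@measurable_funS _ _ _ _ setT) => //.
  apply: (@measurable_piecewise _ n.+1%:R _ _
    (fun z r => dot (x ((z + 1)%:~R / n.+1%:R) - al) (h r))); first by rewrite ltr0n.
  by move=> z; under eq_fun do rewrite dotC; exact: mh.
rewrite /= in_itv /= => /andP[sr _]; have r0 : 0 <= r by exact: le_trans (ltW sr).
apply/cvgrPdist_le => e e0.
have h1 : 0 < `|h r| + 1 by rewrite ltr_wpDl.
have [d d0 dP] := cadlag_right xc r0 (divr_gt0 e0 h1).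
have /cvgrPdist_lt/(_ _ d0)[N _ NP] := @cvg_harmonic R.
exists N => //= n /NP; rewrite /= sub0r normrN /harmonic ger0_norm ?invr_ge0// => nd.
rewrite distrC /g; set q := _ / _.
have n0 : 0 < n.+1%:R :> R by rewrite ltr0n.
have /andP[f1 f2] := floor_itv (r * n.+1%:R).
have rq : r < q by rewrite /q ltr_pdivlMr.
have qr : q < r + d.
  apply: (@le_lt_trans _ _ (r + n.+1%:R^-1)); last by rewrite ltrD2l.
  rewrite /q ler_pdivrMr// mulrDl mulVf ?gt_eqF// intrD lerD2r//.
have -> : dot (x q - al) (h r) - dot (x r - al) (h r) = dot (x q - x r) (h r).
  by rewrite !dotE; ring.
apply: le_trans (normr_dot_le Hnorm _ _) _.
have := dP _ (ltW rq) qr; rewrite ler_pdivlMr// => h2.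
by have := normr_ge0 (x q - x r); nra.
Qed.

End CadlagMeasurable.

Section LSmeasure.
Context {R : realType} (V : cumulative R R).
Local Notation mu := (lebesgue_stieltjes_measure V).
Implicit Types (f : R -> R) (s t u lo hi B : R).

Lemma LS_itv s t : s <= t -> mu `]s, t] = (V t - V s)%:E.
Proof.
move=> st; rewrite /lebesgue_stieltjes_measure /measure_extension.
rewrite measurable_mu_extE/=; last exact: is_ocitv.
by rewrite wlength_itv_bnd.
Qed.

Lemma integrable_LS f s t B : s <= t ->
  measurable_fun (`]s, t] : set (measurableTypeR R)) f ->
  (forall r, s < r -> r <= t -> `|f r| <= B) ->
  mu.-integrable `]s, t] (EFin \o f).
Proof.
move=> st mf fB; apply: measurable_bounded_integrable => //.
  by rewrite [X in (X < _)%E](LS_itv st) ltry.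
exists B; split; first exact: num_real.
move=> M BM r /=; rewrite in_itv /= => /andP[sr rt].
exact: le_trans (fB _ sr rt) (ltW BM).
Qed.

Lemma LS_add f s t u : s <= t -> t <= u -> mu.-integrable `]s, u] (EFin \o f) ->
  (\int[mu]_(r in `]s, u]) f r)%R =
  (\int[mu]_(r in `]s, t]) f r)%R + (\int[mu]_(r in `]t, u]) f r)%R.
Proof.
move=> st tu fi; have E : `]s, u]%classic = `]s, t] `|` `]t, u] :> set R.
  by rewrite (@itv_bndbnd_setU _ _ (BRight s) (BRight t) (BRight u)).
rewrite {1}E Rintegral_setU -?E//.
apply/disj_setPS => r /= []; rewrite !in_itv /= => /andP[_ rt] /andP[tr _].
by have := le_lt_trans rt tr; rewrite ltxx.
Qed.

Lemma LS_le f s t hi : s <= t -> mu.-integrable `]s, t] (EFin \o f) ->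
  (forall r, s < r -> r <= t -> f r <= hi) ->
  (\int[mu]_(r in `]s, t]) f r)%R <= hi * (V t - V s).
Proof.
move=> st fi fhi; have -> : hi * (V t - V s) = (\int[mu]_(r in `]s, t]) hi)%R.
  by rewrite Rintegral_cst// [X in fine X](LS_itv st).
apply: le_Rintegral => //.
  apply: (@integrable_LS _ _ _ `|hi|) => //; exact: measurable_cst.
by move=> r /=; rewrite in_itv /= => /andP[]; exact: fhi.
Qed.

Lemma LS_ge f s t lo : s <= t -> mu.-integrable `]s, t] (EFin \o f) ->
  (forall r, s < r -> r <= t -> lo <= f r) ->
  lo * (V t - V s) <= (\int[mu]_(r in `]s, t]) f r)%R.
Proof.
move=> st fi flo; have -> : lo * (V t - V s) = (\int[mu]_(r in `]s, t]) lo)%R.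
  by rewrite Rintegral_cst// [X in fine X](LS_itv st).
apply: le_Rintegral => //.
  apply: (@integrable_LS _ _ _ `|lo|) => //; exact: measurable_cst.
by move=> r /=; rewrite in_itv /= => /andP[]; exact: flo.
Qed.

Lemma LS_norm_le f s t B : s <= t -> mu.-integrable `]s, t] (EFin \o f) ->
  (forall r, s < r -> r <= t -> `|f r| <= B) ->
  `|(\int[mu]_(r in `]s, t]) f r)%R| <= B * (V t - V s).
Proof.
move=> st fi fB; rewrite ler_norml -mulNr; apply/andP; split.
  by apply: LS_ge => // r sr rt; have := fB _ sr rt; rewrite ler_norml => /andP[].
by apply: LS_le => // r sr rt; have := fB _ sr rt; rewrite ler_norml => /andP[].
Qed.

End LSmeasure.

Section Differential.
Context {R : realType} {H : completeNormedModType R} (dot : {dot H for idfun}).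
Hypothesis Hnorm : hilbert_norm dot.
Implicit Types (x l : R -> H) (s t u v D e : R) (al be z : H).

Definition Lint x al be s t : R :=
  (\int[lebesgue_measure]_(r in `]s, t]) dot (x r - al) be)%R.

(** Lebesgue measure is the Lebesgue-Stieltjes measure of [idfun], so the lemmas on the latter apply
    to [Lint]. *)
Lemma integrable_Lint x al be s t : cadlag x -> 0 <= s -> s <= t ->
  (lebesgue_stieltjes_measure (idfun : cumulative R R)).-integrable `]s, t]
    (EFin \o (fun r => dot (x r - al) be)).
Proof.
move=> xc s0 st; have [B B0 BP] := cadlag_bounded t xc.
apply: (@integrable_LS _ _ _ _ _ ((B + `|al|) * `|be|)) => //.
  by apply: (measurable_cadlag_dot Hnorm _ (h := fun=> be)) => // e; exact: measurable_cst.
move=> r sr rt; apply: le_trans (normr_dot_le Hnorm _ _) _; rewrite ler_wpM2r//.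
apply: le_trans (ler_normB _ _) _; rewrite lerD2r; apply: BP => //.
exact: le_trans (ltW sr).
Qed.

Lemma Lint_add x al be s t u : cadlag x -> 0 <= s -> s <= t -> t <= u ->
  Lint x al be s u = Lint x al be s t + Lint x al be t u.
Proof.
move=> xc s0 st tu; apply: (LS_add (V := idfun)) => //.
by apply: integrable_Lint => //; exact: le_trans tu.
Qed.

Lemma Lint_xx x al be s : Lint x al be s s = 0.
Proof. by rewrite /Lint set_itvoc0 Rintegral_set0. Qed.

Lemma Lint_norm x al be s t D : cadlag x -> 0 <= s -> s <= t ->
  (forall r, s < r -> r <= t -> `|x r - al| <= D) ->
  `|Lint x al be s t| <= D * `|be| * (t - s).
Proof.
move=> xc s0 st xD; apply: (LS_norm_le (V := idfun)) => //.
  exact: integrable_Lint.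
move=> r sr rt; apply: le_trans (normr_dot_le Hnorm _ _) _; rewrite ler_wpM2r//.
exact: xD.
Qed.

(** Since x may jump at t, the hypothesis leaves t out. The estimate holds on ]s, v] for v < t, and
    [M] bounds the contribution of the remaining piece per unit of time. *)
Lemma Lint_cst x al be s t z e : cadlag x -> 0 <= s -> s <= t ->
  (forall r, s <= r -> r < t -> `|x r - z| <= e) ->
  `|Lint x al be s t - (t - s) * dot (z - al) be| <= e * `|be| * (t - s).
Proof.
move=> xc s0; rewrite le_eqVlt => /predU1P[<-|st xe].
  by move=> _; rewrite Lint_xx subrr mul0r mulr0 subr0 normr0.
have [B B0 BP] := cadlag_bounded t xc.
set q := dot (z - al) be.
have closed v : s <= v -> v < t ->
    `|Lint x al be s v - (v - s) * q| <= e * `|be| * (v - s).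
  move=> sv vt; rewrite mulrC.
  have qint : (lebesgue_stieltjes_measure (idfun : cumulative R R)).-integrable
      `]s, v] (EFin \o (fun=> q)).
    by apply: (@integrable_LS _ _ _ _ _ (`|q|)) => //; exact: measurable_cst.
  have -> : q * (v - s) = (\int[lebesgue_measure]_(r in `]s, v]) q)%R.
    by rewrite Rintegral_cst// [X in fine X](LS_itv idfun sv).
  rewrite /Lint -RintegralB//; last exact: integrable_Lint.
  apply: (LS_norm_le (V := idfun)) => //.
    have /= := integrableB _ (integrable_Lint al be xc s0 sv) qint.
    by apply; exact: measurable_itv.
  move=> r sr rv; rewrite /q.
  have -> : dot (x r - al) be - dot (z - al) be = dot (x r - z) be.
    by rewrite !dotE; ring.
  apply: le_trans (normr_dot_le Hnorm _ _) _; rewrite ler_wpM2r//.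
  by apply: xe; [exact: ltW|exact: le_lt_trans vt].
pose M := (B + `|al|) * `|be| + `|q| + `|e| * `|be|.
have M0 : 0 <= M.
  by rewrite addr_ge0// ?mulr_ge0// addr_ge0// mulr_ge0// addr_ge0.
apply/ler_addgt0Pr => eta eta0.
have M1 : 0 < M + 1 by lra.
have [v [sv vt vM]] : exists v, [/\ s <= v, v < t & (t - v) * (M + 1) <= eta].
  have eM : 0 < eta / (M + 1) by exact: divr_gt0.
  have [h|h] := leP s (t - eta / (M + 1)).
    exists (t - eta / (M + 1)); split; [exact: h|lra|].
    by rewrite opprB addrC subrK divfK ?gt_eqF.
  exists s; split => //; rewrite -ler_pdivlMr//; lra.
have xv : `|Lint x al be v t| <= (B + `|al|) * `|be| * (t - v).
  apply: Lint_norm => //; [exact: le_trans sv|exact: ltW|].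
  move=> r vr rt; apply: le_trans (ler_normB _ _) _; rewrite lerD2r.
  by apply: BP => //; rewrite (le_trans s0)// (le_trans sv)// ltW.
rewrite (Lint_add al be xc s0 sv (ltW vt)).
have -> : Lint x al be s v + Lint x al be v t - (t - s) * q =
  (Lint x al be s v - (v - s) * q) + (Lint x al be v t - (t - v) * q) by ring.
apply: le_trans (ler_normD _ _) _.
apply: le_trans (lerD (closed _ sv vt) (ler_normB _ _)) _.
rewrite [ `|(t - v) * q| ]normrM (ger0_norm (x := t - v)); last by rewrite subr_ge0 ltW.
have : `|e| * `|be| * (t - v) >= - (e * `|be| * (t - v)).
  rewrite -mulNr -mulNr; apply: ler_wpM2r; first by rewrite subr_ge0 ltW.
  by apply: ler_wpM2r => //; rewrite lerNl; have := ler_norm (- e); rewrite normrN; lra.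
have : 0 <= t - v by rewrite subr_ge0 ltW.
by move: xv vM; rewrite /M; set a := `|_|; set b := _ * `|be|; set c := `|q|;
  set d := `|e| * _; set f := e * _; nra.
Qed.

(** Freezing x at its value at u turns the Stieltjes integral into <x_u - al, l_v - l_u>; as |h| <=
    1, the error is at most e times the variation of l. *)
Lemma differential_local (A : H -> set H) x l al be u v e :
  differential_in dot A x l -> cadlag x -> BV_loc l -> A al be -> 0 <= u -> u <= v ->
  (forall r, u < r -> r <= v -> `|x r - x u| <= e) ->
  Lint x al be u v <= dot (x u - al) (l v - l u) + e * Vr u v l.
Proof.
move=> dl xc lbv Aab u0 uv xe.
have uv' : 0 <= u <= v by rewrite u0.
have [I [V [h [[hV h1 mh hd] fi IE]]] IL] := dl u v al be uv' Aab.
have -> : Vr u v l = V v - V u by rewrite /Vr hV.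
have {IL} : Lint x al be u v <= I by rewrite -subr_ge0.
move/le_trans; apply; rewrite IE dotC hd//.
have gi : (lebesgue_stieltjes_measure V).-integrable `]u, v]
    (EFin \o (fun r => dot (h r) (x u - al))).
  apply: (@integrable_LS _ _ _ _ _ (`|x u - al|)) => //.
    by apply: (@measurable_funS _ _ _ _ setT) => //; exact: mh.
  move=> r _ _; apply: le_trans (normr_dot_le Hnorm _ _) _.
  by have := h1 r; have := normr_ge0 (x u - al); nra.
rewrite -lerBlDl -RintegralB//.
apply: le_trans (ler_norm _) _; apply: LS_norm_le => //.
  have /= := integrableB _ fi gi; apply; exact: measurable_itv.
move=> r ur rv; rewrite (dotC dot (h r)).
have -> : dot (x r - al) (h r) - dot (x u - al) (h r) = dot (x r - x u) (h r).
  by rewrite !dotE; ring.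
apply: le_trans (normr_dot_le Hnorm _ _) _.
by have := xe _ ur rv; have := h1 r; have := normr_ge0 (x r - x u);
  have := normr_ge0 (h r); nra.
Qed.

End Differential.

(** * Energy inequality *)

Section LeftLimits.
Context {R : realType} {H : completeNormedModType R} (dot : {dot H for idfun}).
Hypothesis Hnorm : hilbert_norm dot.
Implicit Types (x y : R -> H) (r s t u v : R).

Lemma cvg_dotr (T : Type) (F : set_system T) (FF : Filter F) (f : T -> H) a b :
  f v @[v --> F] --> a -> dot b (f v) @[v --> F] --> dot b a.
Proof.
move=> /cvgrPdist_le fa; apply/cvgrPdist_le => e e0.
have b0 : 0 < `|b| + 1 by rewrite ltr_wpDl.
have := fa _ (divr_gt0 e0 b0); apply: filterS => v.
rewrite ler_pdivlMr// => h; rewrite -(dotNr dot b (f v)) -dotDr.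
apply: le_trans (normr_dot_le Hnorm _ _) _.
by have := normr_ge0 (a - f v); nra.
Qed.

Lemma cvg_norm2 (T : Type) (F : set_system T) (FF : Filter F) (f : T -> H) a :
  f v @[v --> F] --> a -> `|f v| ^+ 2 @[v --> F] --> `|a| ^+ 2.
Proof.
move=> fa; rewrite expr2; under eq_fun do rewrite expr2.
by apply: cvgM; exact: cvg_norm.
Qed.

Lemma left_lim_cvg x t : cadlag x -> 0 < t -> x r @[r --> t^'-] --> left_lim x t.
Proof. by move=> [_ xl] t0; rewrite /left_lim t0; exact: xl. Qed.

Lemma left_ge (f : R -> R) s t c l : s < t -> f v @[v --> t^'-] --> l ->
  (forall v, s < v -> v < t -> c <= f v) -> c <= l.
Proof.
move=> st fl h; apply: (@cvgr_to_ge _ _ _ _ f) fl _; near=> v.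
by apply: h; near: v; [exact: nbhs_left_gt|exact: nbhs_left_lt].
Unshelve. all: by end_near. Qed.

Lemma left_limD x y z t : (forall r, 0 <= r -> x r + y r = z r) ->
  cadlag x -> cadlag y -> 0 <= t -> left_lim z t = left_lim x t + left_lim y t.
Proof.
move=> xyz xc yc; rewrite le_eqVlt => /predU1P[<-|t0].
  by rewrite /left_lim ltxx xyz.
apply: left_limE => // e e0; have e20 : 0 < e / 2 by lra.
have [d1 d10 h1] := cadlag_left xc t0 e20.
have [d2 d20 h2] := cadlag_left yc t0 e20.
exists (Num.min t (Num.min d1 d2)); first by rewrite !lt_min t0 d10.
move=> r dr rt.
have m0 : Num.min t (Num.min d1 d2) <= t by rewrite ge_min lexx.
have m1 : Num.min t (Num.min d1 d2) <= d1 by rewrite !ge_min lexx !orbT.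
have m2 : Num.min t (Num.min d1 d2) <= d2 by rewrite !ge_min lexx !orbT.
rewrite -xyz; last lra.
have -> : x r + y r - (left_lim x t + left_lim y t) =
  (x r - left_lim x t) + (y r - left_lim y t) by rewrite opprD addrACA.
apply: le_trans (ler_normD _ _) _.
have := h1 r; have := h2 r => a b; have : `|x r - left_lim x t| <= e / 2 by apply: b; lra.
have : `|y r - left_lim y t| <= e / 2 by apply: a; lra.
lra.
Qed.

Lemma cadlagD x y z : (forall r, 0 <= r -> x r + y r = z r) ->
  cadlag x -> cadlag y -> cadlag z.
Proof.
move=> xyz xc yc; apply: cadlag_intro => [t e t0 e0|t t0].
  have e20 : 0 < e / 2 by lra.
  have [d1 d10 h1] := cadlag_right xc t0 e20.
  have [d2 d20 h2] := cadlag_right yc t0 e20.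
  exists (Num.min d1 d2); first by rewrite lt_min d10.
  have m1 : Num.min d1 d2 <= d1 by rewrite ge_min lexx.
  have m2 : Num.min d1 d2 <= d2 by rewrite ge_min lexx orbT.
  move=> r tr rd; rewrite -!xyz//; last exact: le_trans tr.
  rewrite opprD addrACA; apply: le_trans (ler_normD _ _) _.
  have := h1 r tr; have := h2 r tr => a b.
  have : `|x r - x t| <= e / 2 by apply: b; lra.
  have : `|y r - y t| <= e / 2 by apply: a; lra.
  lra.
exists (left_lim x t + left_lim y t) => e e0; have e20 : 0 < e / 2 by lra.
have [d1 d10 h1] := cadlag_left xc t0 e20.
have [d2 d20 h2] := cadlag_left yc t0 e20.
exists (Num.min t (Num.min d1 d2)); first by rewrite !lt_min t0 d10.
move=> r dr rt.
have m0 : Num.min t (Num.min d1 d2) <= t by rewrite ge_min lexx.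
have m1 : Num.min t (Num.min d1 d2) <= d1 by rewrite !ge_min lexx !orbT.
have m2 : Num.min t (Num.min d1 d2) <= d2 by rewrite !ge_min lexx !orbT.
rewrite -xyz; last lra.
rewrite opprD addrACA; apply: le_trans (ler_normD _ _) _.
have := h1 r; have := h2 r => a b; have : `|x r - left_lim x t| <= e / 2 by apply: b; lra.
have : `|y r - left_lim y t| <= e / 2 by apply: a; lra.
lra.
Qed.

Lemma jump_le x u v r e : cadlag x -> 0 <= u -> u < r -> r <= v ->
  (forall s t, u <= s -> s <= v -> u <= t -> t <= v -> `|x s - x t| <= e) ->
  `|jump x r| <= e.
Proof.
move=> xc u0 ur rv xe; have r0 := le_lt_trans u0 ur.
apply/ler_addgt0Pr => eta eta0.
have [d d0 dP] := cadlag_left xc r0 eta0.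
have [w [uw dw wr]] : exists w, [/\ u <= w, r - d < w & w < r].
  have [h|h] := leP u (r - d / 2); first by exists (r - d / 2); split; lra.
  by exists u; split; lra.
have -> : jump x r = (x r - x w) + (x w - left_lim x r) by rewrite addrA subrK.
apply: le_trans (ler_normD _ _) _; apply: lerD; last exact: dP.
by apply: xe => //; [exact: ltW|exact: le_trans (ltW wr) rv].
Qed.

End LeftLimits.

Section Energy.
Context {R : realType} {H : completeNormedModType R} (dot : {dot H for idfun}).
Hypothesis Hnorm : hilbert_norm dot.
Variables (A : H -> set H) (Pi : H -> H) (m x k : R -> H).
Hypothesis PiP : gen_projection A Pi.
Hypothesis xkSP : SP dot A Pi m x k.
Implicit Types (r s t u v c e : R) (al be mb z : H).
Local Notation L al be s t := (Lint dot x al be s t).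
Local Notation V s t := (Vr s t k).

Lemma SP_cadlag_x : cadlag x. Proof. by have [[h _] _ _ _ _] := xkSP; exact: h. Qed.
Lemma SP_cadlag_k : cadlag k. Proof. by have [[_ h] _ _ _ _] := xkSP; exact: h. Qed.
Lemma SP_bv : BV_loc k. Proof. by have [_ _ [h _] _ _] := xkSP; exact: h. Qed.
Lemma SP_k0 : k 0 = 0. Proof. by have [_ _ [_ h] _ _] := xkSP; exact: h. Qed.
Lemma SP_xk t : 0 <= t -> x t + k t = m t. Proof. by have [_ _ _ h _] := xkSP; exact: h. Qed.
Lemma SP_dom t : 0 <= t -> closure (domain A) (x t). Proof. by have [_ h _ _ _] := xkSP; exact: h. Qed.


Let xc := SP_cadlag_x.
Let kc := SP_cadlag_k.
Let kbv := SP_bv.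

(** The identity x + k = m passes to left limits, so x_{t-} plus the jump of m is m_t - k_{t-}. *)
Lemma SP_Pi t : 0 <= t -> x t = Pi (m t - left_lim k t).
Proof.
move=> t0; case: xkSP => _ _ _ _ [_ /(_ _ t0) ->]; congr Pi.
rewrite /jump (left_limD SP_xk xc kc t0).
by apply: (eq_dot Hnorm) => ?; rewrite !dotE; ring.
Qed.

Lemma Pi_test y z : closure (domain A) z -> `|Pi y - z| <= `|y - z|.
Proof.
case: PiP => _ Pid Pilip zA; have := Pilip y z.
by rewrite (Pid z)// inE.
Qed.

(** Pi fixes z and is nonexpansive, so |x_t - z| is at most the norm of x_t - z plus the jump of k;
    expanding the square gives the favourable sign of the jumps. *)
Lemma SP_jump t z : 0 <= t -> closure (domain A) z ->
  0 <= dot (x t - z) (jump k t) + 2^-1 * `|jump k t| ^+ 2.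
Proof.
move=> t0 zA; have := Pi_test (m t - left_lim k t) zA; rewrite -SP_Pi//.
have -> : m t - left_lim k t - z = (x t - z) + jump k t.
  by rewrite -SP_xk// /jump; apply: (eq_dot Hnorm) => ?; rewrite !dotE; ring.
rewrite -(@ler_pXn2r _ 2) ?nnegrE// (norm2D Hnorm (x t - z)); lra.
Qed.

(** [SP_jump] is summed over a finite set of jump times: replacing x_r by x_u costs e per unit of
    jump, the half square at most e / 2. The jumps outside the set form an arbitrarily small
    tail. *)
Lemma disc_lower al u v e : domain A al -> 0 <= u -> u <= v ->
  (forall s t, u <= s -> s <= v -> u <= t -> t <= v -> `|k s - k t| <= e) ->
  (forall r, u < r -> r <= v -> `|x r - x u| <= e) ->
  - (2 * e * V u v) <= dot (x u - al) (disc_part k v - disc_part k u).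
Proof.
move=> Aal u0 uv ke xe.
have e0 : 0 <= e by have := ke u u (lexx _) uv (lexx _) uv; rewrite subrr normr0.
have V0 : 0 <= V u v := Vr_ge0 (BVfin kbv v) u0 uv (lexx v).
apply/ler_addgt0Pr => eta eta0.
have x0 : 0 < `|x u - al| + 1 by rewrite ltr_wpDl.
have [F /(_ _ _ u0 uv (lexx v)) FP] := jtail_small kc kbv (le_trans u0 uv) (divr_gt0 eta0 x0).
have := le_trans (disc_part_jsum kc kbv F u0 uv) FP; set dk := disc_part k v - _.
rewrite ler_pdivlMr// => h.
have -> : dk = jsum k F u v + (dk - jsum k F u v) by rewrite addrC subrK.
rewrite dotDr.
have jF : - (2 * e * jabs k F u v) <= dot (x u - al) (jsum k F u v).
  rewrite /jsum /jabs mulr_sumr -sumrN linear_sumr/=.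
  apply: ler_sum => r /andP[ur rv].
  have je := jump_le kc u0 ur rv ke.
  have r0 : 0 <= r by rewrite (le_trans u0)// ltW.
  have := SP_jump r0 (subset_closure Aal); have := xe _ ur rv => xr.
  have -> : x r - al = (x u - al) + (x r - x u) by rewrite [RHS]addrC subrKA.
  rewrite dotDl; have := dot_le Hnorm (x r - x u) (jump k r).
  by have := normr_ge0 (jump k r); nra.
have jV : jabs k F u v <= V u v by exact: jumps_le_V.
have := dot_ge Hnorm (x u - al) (dk - jsum k F u v).
have := normr_ge0 (dk - jsum k F u v).
by nra.
Qed.

(** In mb - al = (mb - m_u) + (x_u - al) + k_u the last term produces the difference of squares. The
    5 e rounds up 2 e from the variation of k^c, 2 e from [disc_lower] and e / 2 from |k_v - k_u|^2
    / 2. *)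
Lemma energy_small al be mb u v c e : A al be -> 0 <= u -> u <= v ->
  `|m u - mb| <= c ->
  (forall s t, u <= s -> s <= v -> u <= t -> t <= v -> `|k s - k t| <= e) ->
  (forall r, u < r -> r <= v -> `|x r - x u| <= e) ->
  L al be u v <= dot (mb - al) (k v - k u) - (`|k v| ^+ 2 - `|k u| ^+ 2) / 2
    + (c + 5 * e) * V u v.
Proof.
move=> Aab u0 uv mc ke xe.
have V0 : 0 <= V u v := Vr_ge0 (BVfin kbv v) u0 uv (lexx v).
have e0 : 0 <= e by have := ke u u (lexx _) uv (lexx _) uv; rewrite subrr normr0.
have dl : differential_in dot A x (cont_part k) by case: xkSP => _ _ _ _ [].
have := differential_local Hnorm dl xc (BV_cont_part kc kbv) Aab u0 uv xe.
have VcV : e * Vr u v (cont_part k) <= e * (2 * V u v).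
  by rewrite ler_wpM2l//; exact: Vr_cont_part.
rewrite (cont_partB k) (dotDr dot _ (k v - k u)) dotNr.
have Aal : domain A al by exists be.
have := disc_lower Aal u0 uv ke xe.
have kV := Vr_ge (BVfin kbv v) u0 uv (lexx v).
have kk : `|k v - k u| <= e by apply: ke.
have := dot_ge Hnorm (mb - m u) (k v - k u).
have mV : `|mb - m u| * `|k v - k u| <= c * V u v.
  by rewrite distrC ler_pM.
have eV : `|k v - k u| ^+ 2 <= e * V u v by rewrite expr2 ler_pM.
have -> : mb - al = (mb - m u) + (x u - al) + k u.
  by rewrite -SP_xk// (addrC (x u)) opprD; apply: (eq_dot Hnorm) => ?; rewrite !dotE; ring.
rewrite (dotDl dot _ (k u)) (dotDl dot (mb - m u)).
have : `|k v| ^+ 2 = `|k u| ^+ 2 + 2 * dot (k u) (k v - k u) + `|k v - k u| ^+ 2.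
  by rewrite -(norm2D Hnorm) [k u + _]addrC subrK.
have : 0 <= e * V u v by exact: mulr_ge0.
lra.
Qed.

(** Limit v -> r from the left. The jump of k at r stays outside, so its size can be subtracted from
    the variation; this gain later pays for the jump itself. *)
Lemma energy_left al be mb u r c' : A al be -> 0 <= u -> u < r ->
  (forall v, u <= v -> v < r -> L al be u v <=
     dot (mb - al) (k v - k u) - (`|k v| ^+ 2 - `|k u| ^+ 2) / 2 + c' * V u v) ->
  0 <= c' ->
  L al be u r <= dot (mb - al) (left_lim k r - k u)
    - (`|left_lim k r| ^+ 2 - `|k u| ^+ 2) / 2 + c' * (V u r - `|jump k r|).
Proof.
move=> Aab u0 ur h c0; have r0 := le_lt_trans u0 ur.
have [B B0 BP] := cadlag_bounded r xc.
pose M := (B + `|al|) * `|be|.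
pose f v := M * (r - v) + (dot (mb - al) (k v - k u)
    - (`|k v| ^+ 2 - `|k u| ^+ 2) / 2 + c' * (V u r - `|k r - k v|)).
rewrite -[leRHS]add0r -{1}(mulr0 M) -(subrr r).
apply: (@left_ge _ f u r) => //.
  have kl := left_lim_cvg kc r0.
  apply: cvgD.
    apply: cvgM; first exact: cvg_cst.
    apply: cvgB; first exact: cvg_cst.
    by apply: cvg_at_left_filter; exact: cvg_id.
  apply: cvgD; last first.
    apply: cvgM; first exact: cvg_cst.
    apply: cvgB; first exact: cvg_cst.
    by apply: cvg_norm; apply: cvgB => //; exact: cvg_cst.
  apply: cvgB.
    by apply: (cvg_dotr Hnorm); apply: cvgB => //; exact: cvg_cst.
  apply: cvgM; last exact: cvg_cst.
  by apply: cvgB; [exact: cvg_norm2|exact: cvg_cst].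
move=> v uv vr; have v0 := le_trans u0 (ltW uv).
rewrite (Lint_add Hnorm al be xc u0 (ltW uv) (ltW vr)) addrC; apply: lerD.
  apply: le_trans (ler_norm _) _; apply: (Lint_norm Hnorm) => //; first exact: ltW.
  move=> w vw wr; apply: le_trans (ler_normB _ _) _; rewrite lerD2r.
  by apply: BP => //; exact: le_trans (ltW vw).
apply: le_trans (h _ (ltW uv) vr) _; rewrite lerD2l; apply: ler_wpM2l => //.
rewrite (VrD (BVfin kbv r) u0 (ltW uv) (ltW vr) (lexx r)).
have := Vr_ge (BVfin kbv r) v0 (ltW vr) (lexx r); lra.
Qed.

Lemma energy al be mb s t c : A al be -> 0 <= s -> s <= t ->
  (forall r, s <= r -> r <= t -> `|m r - mb| <= c) ->
  L al be s t <= dot (mb - al) (k t - k s) - (`|k t| ^+ 2 - `|k s| ^+ 2) / 2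
    + c * V s t.
Proof.
move=> Aab s0 st mc.
have c0 : 0 <= c by apply: le_trans (mc s (lexx s) st).
have Vst : 0 <= V s t := Vr_ge0 (BVfin kbv t) s0 st (lexx t).
apply/ler_addgt0Pr => eta eta0.
have V1 : 0 < V s t + 1 by lra.
pose e := eta / (V s t + 1) / 5.
have e0 : 0 < e by rewrite divr_gt0// divr_gt0.
pose P u v := L al be u v <= dot (mb - al) (k v - k u)
  - (`|k v| ^+ 2 - `|k u| ^+ 2) / 2 + (c + 5 * e) * V u v.
suff : P s t.
  have : 5 * e * V s t <= eta.
    have -> : 5 * e = eta / (V s t + 1) by rewrite /e; field; rewrite gt_eqF.
    rewrite -mulrA ler_piMr ?(ltW eta0)//.
    by rewrite mulrC ler_pdivrMr// mul1r lerDl.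
  by rewrite /P; lra.
have Ptrans u v w : s <= u -> u <= v -> v <= w -> P u v -> P v w -> P u w.
  move=> su uv vw; have u0 := le_trans s0 su; rewrite /P.
  rewrite (Lint_add Hnorm al be xc u0 uv vw) (VrD (BVfin kbv w) u0 uv vw (lexx w)).
  by rewrite !dotDr !dotNr; lra.
apply: (@cousin _ P _ _ st); first by move=> u v w su uv vw _; exact: Ptrans su uv vw.
move=> r sr rt; have r0 := le_trans s0 sr.
have [d1 d10 [x1 x2]] := cadlag_osc xc r0 e0.
have [d2 d20 [k1 k2]] := cadlag_osc kc r0 e0.
have m1 : Num.min d1 d2 <= d1 by rewrite ge_min lexx.
have m2 : Num.min d1 d2 <= d2 by rewrite ge_min lexx orbT.
exists (Num.min d1 d2); first by rewrite lt_min d10.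
split=> [v rv vd vt|u su du ur].
  apply: energy_small => //; first exact: mc.
    by move=> a b ra av rb bv; apply: k1 => //; lra.
  by move=> a ra av; apply: x1 => //; lra.
move: ur; rewrite le_eqVlt => /predU1P[<-|ur].
  by rewrite /P Lint_xx !subrr dot0r mul0r (Vr_xx (BVfin kbv u) (le_trans s0 su) (lexx u)) mulr0 subr0 addr0.
have u0 := le_trans s0 su.
have h v : u <= v -> v < r -> P u v.
  move=> uv vr; apply: energy_small => //.
  - by apply: mc => //; rewrite (le_trans uv)// (le_trans (ltW vr)).
  - by move=> a b ua av ub bv; apply: k2; lra.
  - by move=> a ua av; apply: x2; lra.
have c50 : 0 <= c + 5 * e by lra.
apply: le_trans (energy_left Aab u0 ur h c50) _.
have Aal : domain A al by exists be.
(* Left of r the inequality is known up to the left limit of k. [SP_jump] adds the jump j, and the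
   error c |j| is covered by the variation gained in [energy_left]. *)
have := SP_jump r0 (subset_closure Aal).
set j := jump k r; have mj : - (c * `|j|) <= dot (mb - m r) j.
  apply: le_trans (dot_ge Hnorm _ _); rewrite lerN2 ler_wpM2r// distrC.
  exact: mc.
rewrite (_ : left_lim k r = k r - j); last by rewrite /j /jump opprB addrC subrK.
rewrite (norm2B Hnorm (k r) j) (_ : k r - j - k u = (k r - k u) - j); last by rewrite addrAC.
rewrite (_ : x r - al = (mb - al) - (mb - m r) - k r); last first.
  by rewrite -SP_xk//; apply: (eq_dot Hnorm) => ?; rewrite !dotE; ring.
rewrite (dotDr dot (mb - al) (k r - k u)) dotNr.
rewrite (dotDl dot _ (- k r)) (dotDl dot (mb - al)) !(dotNl dot _ j).
have : 0 <= e * `|j| by rewrite mulr_ge0// ltW.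
lra.
Qed.

(** For blocks whose right end carries a large jump of m: the inequality stops at the left limit of
    k. *)
Lemma energy_open al be mb s t c : A al be -> 0 <= s -> s < t ->
  (forall r, s <= r -> r < t -> `|m r - mb| <= c) ->
  L al be s t <= dot (mb - al) (left_lim k t - k s)
    - (`|left_lim k t| ^+ 2 - `|k s| ^+ 2) / 2 + c * (V s t - `|jump k t|).
Proof.
move=> Aab s0 st mc; apply: energy_left => //.
  move=> v sv vt; apply: energy => // r sr rv; apply: mc => //.
  exact: le_lt_trans vt.
by apply: le_trans (mc s (lexx s) st).
Qed.

End Energy.

(** * A priori bound *)

Section BallTest.
Context {R : realType} {H : completeNormedModType R} (dot : {dot H for idfun}).
Hypothesis Hnorm : hilbert_norm dot.
Variables (A : H -> set H) (a : H) (r0 mu : R).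
Hypothesis r0_gt0 : 0 < r0.
Hypothesis ballA : closed_ball a r0 `<=` closure (domain A).
Hypothesis ball_mu : forall u w, closed_ball a r0 u -> A u w -> `|w| <= mu.

(* Testing in the direction of d at the boundary of the ball. *)
Lemma ball_test y d p :
  (forall al be, `|al - a| <= r0 -> A al be -> 0 <= dot (y - al) d + p) ->
  r0 * `|d| <= dot (y - a) d + p.
Proof.
(* For d = 0 the inverse is 0 by convention, so e = 0 and the steps below remain valid. *)
move=> h; pose e := `|d|^-1 *: d.
have ed : dot e d = `|d|.
  rewrite dotZl -Hnorm; have [->|d0] := eqVneq `|d| 0; first by rewrite expr2 !mulr0.
  by rewrite expr2 mulKf.
have e1 : `|e| <= 1.
  rewrite normrZ ger0_norm ?invr_ge0//; have [->|d0] := eqVneq `|d| 0.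
    by rewrite mulr0.
  by rewrite mulVf.
(* The ball is contained in the closure of the domain only: the test point is moved inside by eta,
   so that a point of the domain eta-close to it still lies in the ball. *)
have step eta : 0 < eta -> eta <= r0 ->
    r0 * `|d| <= dot (y - a) d + p + 2 * eta * `|d|.
  move=> eta0 etar.
  have er : `|(r0 - eta) *: e| <= r0 - eta.
    by rewrite normrZ ger0_norm ?subr_ge0// ler_piMr// subr_ge0.
  have /ballA/closure_normP/(_ _ eta0)[al [be Aab] qal] :
      closed_ball a r0 (a + (r0 - eta) *: e).
    by apply/closed_ballP => //; rewrite addrC addKr; lra.
  have aal : `|al - a| <= r0.
    have -> : al - a = (r0 - eta) *: e - (a + (r0 - eta) *: e - al).
      by apply: (eq_dot Hnorm) => ?; rewrite !dotE; ring.
    by apply: le_trans (ler_normB _ _) _; lra.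
  have := h al be aal Aab.
  have -> : y - al = (y - a) - (r0 - eta) *: e + (a + (r0 - eta) *: e - al).
    by apply: (eq_dot Hnorm) => ?; rewrite !dotE; ring.
  rewrite dotDl (dotDl dot (y - a)) dotNl dotZl ed.
  have := dot_le Hnorm (a + (r0 - eta) *: e - al) d; have := normr_ge0 d.
  by move: qal; set q := `|_ - al|; nra.
apply/ler_addgt0Pr => eps eps0.
have d1 : 0 < `|d| + 1 by rewrite ltr_wpDl.
pose eta := Num.min r0 (eps / 2 / (`|d| + 1)).
have eta0 : 0 < eta by rewrite lt_min r0_gt0 !divr_gt0.
apply: le_trans (step eta eta0 _) _; first by rewrite ge_min lexx.
rewrite lerD2l; have : eta <= eps / 2 / (`|d| + 1) by rewrite ge_min lexx orbT.
by rewrite ler_pdivlMr//; nra.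
Qed.

Lemma ball_mu_ge0 : 0 <= mu.
Proof.
have /ballA/closure_normP/(_ _ r0_gt0)[al [be Aab]] : closed_ball a r0 a.
  by apply/closed_ballP => //; rewrite subrr normr0 ltW.
rewrite distrC => aal; apply: le_trans (normr_ge0 be) _; apply: ball_mu Aab.
by apply/closed_ballP => //; exact: ltW.
Qed.

Variables (Pi : H -> H) (m x k : R -> H).
Hypothesis PiP : gen_projection A Pi.
Hypothesis xkSP : SP dot A Pi m x k.
Implicit Types (r s t u v c e : R) (al be mb z : H).
Local Notation V s t := (Vr s t k).
Let xc := SP_cadlag_x xkSP.
Let kc := SP_cadlag_k xkSP.
Let kbv := SP_bv xkSP.

Let Lint_lower al be s t D : A al be -> `|al - a| <= r0 -> 0 <= s -> s <= t ->
  (forall r, s < r -> r <= t -> `|x r - a| <= D) ->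
  - (mu * (D + r0) * (t - s)) <= Lint dot x al be s t.
Proof.
move=> Aab aal s0 st xD.
have h : `|Lint dot x al be s t| <= (D + r0) * `|be| * (t - s).
  apply: (Lint_norm Hnorm) => // r sr rt.
  have -> : x r - al = (x r - a) - (al - a) by rewrite opprB addrA subrK.
  by apply: le_trans (ler_normB _ _) _; apply: lerD => //; exact: xD.
have bmu : `|be| <= mu by apply: ball_mu Aab; apply/closed_ballP.
have [st'|] := ltP s t; last first.
  move=> ts; have -> : t = s by apply/le_anti/andP.
  by rewrite Lint_xx subrr mulr0 oppr0.
have D0 : 0 <= D by apply: le_trans (xD t st' (lexx t)).
have : (D + r0) * `|be| * (t - s) <= (D + r0) * mu * (t - s).
  rewrite ler_wpM2r ?subr_ge0// ler_wpM2l// addr_ge0// ltW//.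
by move: h; rewrite ler_norml => /andP[+ _]; lra.
Qed.

(** [ball_test], applied to the energy inequality on every subinterval, bounds |k_v - k_u| by an
    increment of the control function psi. The variation in the error term is then absorbed on the
    left, which turns r0 into r0 - c. *)
Lemma variation_block s t mb c D : 0 <= s -> s < t ->
  (forall r, s <= r -> r < t -> `|m r - mb| <= c) ->
  (forall r, s <= r -> r <= t -> `|x r - a| <= D) ->
  (forall v, s <= v -> v < t -> (r0 - c) * V s v <=
     dot (mb - a) (k v - k s) - (`|k v| ^+ 2 - `|k s| ^+ 2) / 2
     + mu * (D + r0) * (v - s)) /\
  (r0 - c) * V s t <=
     dot (mb - a) (k t - k s) - (`|k t| ^+ 2 - `|k s| ^+ 2) / 2
     + dot (m t - mb) (jump k t) + mu * (D + r0) * (t - s).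
Proof.
move=> s0 st mc xD.
pose b := dot (m t - mb) (jump k t).
(* The last summand is switched on at v = t only: there m may be far from mb, and the jump of k
   contributes [b]. *)
pose psi v := r0^-1 * (dot (mb - a) (k v) - `|k v| ^+ 2 / 2 + c * V 0 v
  + mu * (D + r0) * v + (if v == t then b else 0)).
have inc u v : s <= u -> u <= v -> v <= t -> `|k v - k u| <= psi v - psi u.
  move=> su; rewrite le_eqVlt => /predU1P[<- _|uv vt]; first by rewrite !subrr normr0.
  have u0 := le_trans s0 su; have ut := lt_le_trans uv vt.
  rewrite /psi -mulrBr -(ler_pM2l r0_gt0) (mulVKf (lt0r_neq0 r0_gt0)).
  have uD r : u < r -> r <= v -> `|x r - a| <= D.
    by move=> ur rv; apply: xD; [exact: le_trans (ltW ur)|exact: le_trans vt].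
  rewrite (lt_eqF ut) addr0 (VrD (BVfin kbv v) (lexx 0) u0 (ltW uv) (lexx v)).
  move: vt uD; rewrite le_eqVlt => /predU1P[->|vt] uD.
    rewrite eqxx; apply: le_trans (ball_test (y := mb) (p := - (`|k t| ^+ 2 - `|k u| ^+ 2) / 2
      + c * V u t + b + mu * (D + r0) * (t - u)) _) _; last by rewrite dotDr dotNr; lra.
    move=> al be aal Aab.
    have mcu r : u <= r -> r < t -> `|m r - mb| <= c.
      by move=> ur rt; apply: mc => //; exact: le_trans ur.
    have := energy_open Hnorm PiP xkSP Aab u0 ut mcu.
    have := Lint_lower Aab aal u0 (ltW ut) uD.
    have t0 := le_trans u0 (ltW ut).
    have Aal : closure (domain A) al by apply: subset_closure; exists be.
    have := SP_jump Hnorm PiP xkSP t0 Aal.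
    rewrite /b; set j := jump k t; rewrite (_ : left_lim k t = k t - j); last first.
      by rewrite /j /jump opprB addrC subrK.
    rewrite (norm2B Hnorm (k t) j) (_ : x t - al = (m t - mb) + (mb - al) - k t); last first.
      by rewrite -(SP_xk xkSP)//; apply: (eq_dot Hnorm) => ?; rewrite !dotE; ring.
    have jV := normr_ge0 j.
    have c0 : 0 <= c by apply: le_trans (mc s (lexx s) st).
    have := mulr_ge0 c0 jV.
    by rewrite !(dotDr dot (mb - al)) !dotNr !(dotDl dot _ (- k t)) !(dotDl dot (m t - mb))
      !(dotNl dot (k t)); lra.
  rewrite (lt_eqF vt) addr0.
  apply: le_trans (ball_test (y := mb) (p := - (`|k v| ^+ 2 - `|k u| ^+ 2) / 2
    + c * V u v + mu * (D + r0) * (v - u)) _) _; last by rewrite dotDr dotNr; lra.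
  move=> al be aal Aab.
  have mcu r : u <= r -> r <= v -> `|m r - mb| <= c.
    by move=> ur rv; apply: mc; [exact: le_trans ur|exact: le_lt_trans vt].
  have := energy Hnorm PiP xkSP Aab u0 (ltW uv) mcu.
  by have := Lint_lower Aab aal u0 (ltW uv) uD; lra.
split=> [v sv vt|].
  have vt' := ltW vt.
  have := Vr_le_psi sv (fun u w su uw wv => inc u w su uw (le_trans wv vt')).
  rewrite /psi -mulrBr ler_pdivlMl//.
  rewrite (lt_eqF vt) (lt_eqF st) (VrD (BVfin kbv v) (lexx 0) s0 sv (lexx v)) dotDr dotNr.
  by lra.
have := Vr_le_psi (ltW st) inc.
rewrite /psi -mulrBr ler_pdivlMl// eqxx (lt_eqF st).
rewrite (VrD (BVfin kbv t) (lexx 0) s0 (ltW st) (lexx t)) dotDr dotNr /b.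
by lra.
Qed.

(** With c = r0 / 2 and K = sup |k|, each block costs 2 B K for its interior and 4 B K for the jump
    at its end. Summation gives |k|^2 / 2 + (r0 / 2) V <= p K + q; the right side being linear in K,
    this forces K <= 2 p + 2 q + 1. *)
Lemma apriori n T Mb : 0 <= T -> blocks (osc_le m (r0 / 2)) 0 T n ->
  (forall t, 0 <= t -> t <= T -> `|m t| <= Mb) ->
  let B := Mb + `|a| + r0 in
  let p := 6 * n%:R * B + mu * T in
  let q := mu * T * B in
  let K := 2 * p + 2 * q + 1 in
  (forall t, 0 <= t -> t <= T -> `|k t| <= K) /\ V 0 T <= 2 / r0 * (p * K + q).
Proof.
move=> T0 bl mM B p q K0.
have Mb0 : 0 <= Mb by apply: le_trans (mM 0 (lexx 0) T0).
have mu0 := ball_mu_ge0.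
have B0 : 0 <= B by rewrite /B !addr_ge0// ltW.
have muT : 0 <= mu * T by exact: mulr_ge0.
have p0 : 0 <= p by rewrite /p addr_ge0// !mulr_ge0.
have q0 : 0 <= q by rewrite /q mulr_ge0.
pose S := [set r | exists2 t, 0 <= t <= T & r = `|k t|].
have supS : has_sup S.
  split; first by exists `|k 0|, 0 => //; rewrite lexx.
  exists (V 0 T) => _ [t /andP[t0 tT] ->].
  have := Vr_ge (BVfin kbv T) (lexx 0) t0 tT; rewrite (SP_k0 xkSP) subr0 => /le_trans; apply.
  exact: (Vr_le (BVfin kbv T)).
pose K := sup S.
have kK t : 0 <= t -> t <= T -> `|k t| <= K.
  by move=> t0 tT; apply: ub_le_sup; [case: supS|exists t => //; rewrite t0].
have K_ge0 : 0 <= K by apply: le_trans (kK 0 (lexx 0) T0).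
pose D := Mb + K + `|a|.
pose F t := `|k t| ^+ 2 / 2 + r0 / 2 * V 0 t - mu * (D + r0) * t.
pose Q := 6 * B * K.
have Q0 : 0 <= Q by rewrite /Q !mulr_ge0.
have ma t : 0 <= t -> t <= T -> `|m t - a| <= B.
  move=> t0 tT; apply: le_trans (ler_normB _ _) _.
  by have := mM t t0 tT; rewrite /B; have := ltW r0_gt0; lra.
have xD t : 0 <= t -> t <= T -> `|x t - a| <= D.
  move=> t0 tT; rewrite (_ : x t = m t - k t); last by rewrite -(SP_xk xkSP)// addrK.
  apply: le_trans (ler_normB _ _) _; rewrite /D lerD2r.
  by apply: le_trans (ler_normB _ _) _; apply: lerD; [exact: mM|exact: kK].
have kd u v : 0 <= u -> u <= T -> 0 <= v -> v <= T -> `|k v - k u| <= 2 * K.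
  move=> u0 uT v0 vT; apply: le_trans (ler_normB _ _) _.
  by have := kK u u0 uT; have := kK v v0 vT; lra.
have FQ s n' : blocks (osc_le m (r0 / 2)) s T n' -> 0 <= s ->
    forall t, s <= t -> t <= T -> F t <= F s + n'%:R * Q.
  move E : T => T' bl'; elim: bl' E => {s T' n'} [t ET s0 v tv vT|s t u n' st ost tun IH ET s0 v sv vT].
    have -> : v = t by apply/le_anti/andP.
    by rewrite mul0r addr0.
  have tT : t <= T by rewrite ET; exact: blocks_le tun.
  have t0 := le_trans s0 (ltW st).
  have xDst r : s <= r -> r <= t -> `|x r - a| <= D.
    by move=> sr rt; apply: xD; [exact: le_trans sr|exact: le_trans tT].
  have [h1 h2] := variation_block s0 st ost xDst.
  have sT := le_trans (ltW st) tT.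
  have bound w : s <= w -> w <= t -> dot (m s - a) (k w - k s) <= 2 * B * K.
    move=> sw wt; apply: le_trans (dot_le Hnorm _ _) _.
    rewrite -mulrA [in leRHS]mulrCA; apply: ler_pM => //; first exact: ma.
    by apply: kd => //; [exact: le_trans sw|exact: le_trans tT].
  have jb : dot (m t - m s) (jump k t) <= 4 * B * K.
    apply: le_trans (dot_le Hnorm _ _) _.
    rewrite (_ : 4 * B * K = (2 * B) * (2 * K)); last by ring.
    apply: ler_pM => //.
      apply: le_trans (ler_normB _ _) _.
      have := mM t t0 tT; have := mM s s0 sT; have := normr_ge0 a.
      by rewrite /B; have := ltW r0_gt0; lra.
    apply: (@jump_le _ _ k 0 t) => //; first exact: le_lt_trans st.
    by move=> r w r1 r2 w1 w2; apply: kd => //; [exact: le_trans tT|exact: le_trans tT].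
  have Fst w : s <= w -> w <= t -> F w <= F s + Q.
    move=> sw; rewrite le_eqVlt => /predU1P[->|wt].
      have := h2; rewrite /F (VrD (BVfin kbv t) (lexx 0) s0 (ltW st) (lexx t)).
      by have := bound _ (ltW st) (lexx t); move: jb; rewrite /Q; lra.
    have := h1 w sw wt; rewrite /F (VrD (BVfin kbv w) (lexx 0) s0 sw (lexx w)).
    have := bound _ sw (ltW wt); rewrite /Q.
    have BK : 0 <= B * K by exact: mulr_ge0.
    by lra.
  have [vt|tv] := leP v t.
    apply: le_trans (Fst v sv vt) _; rewrite lerD2l -natr1 mulrDl mul1r lerDr.
    by rewrite mulr_ge0.
  apply: le_trans (IH ET t0 v (ltW tv) vT) _.
  have := Fst t (ltW st) (lexx t); rewrite -natr1 mulrDl mul1r; lra.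
have F0 : F 0 = 0.
  by rewrite /F (SP_k0 xkSP) normr0 (Vr_xx (BVfin kbv T))// expr0n /= !mulr0 mul0r !addr0 subr0.
have main t : 0 <= t -> t <= T -> `|k t| ^+ 2 / 2 + r0 / 2 * V 0 t <= p * K + q.
  move=> t0 tT; have := FQ 0 n bl (lexx 0) t t0 tT; rewrite F0 add0r /F.
  have : mu * (D + r0) * t <= mu * (D + r0) * T.
    by rewrite ler_wpM2l// mulr_ge0// !addr_ge0// ltW.
  rewrite /p /q /Q (_ : D + r0 = B + K); last by rewrite /D /B; ring.
  by lra.
have KK0 : K <= K0.
  have [K1|K1] := leP K 1; first by rewrite /K0; lra.
  (* The supremum need not be attained: a time with |k t| > K - 1/2 suffices, the loss being covered
     by the 1 in [K0]. *)
  have h2 : 0 < (2^-1 : R) by rewrite invr_gt0.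
  have [_ [t /andP[t0 tT] ->] tK] := sup_adherent h2 supS.
  have := main t t0 tT.
  have : 0 <= r0 / 2 * V 0 t.
    by rewrite mulr_ge0 ?divr_ge0 ?(ltW r0_gt0)// (Vr_ge0 (BVfin kbv T)).
  have : (K - 2^-1) ^+ 2 <= `|k t| ^+ 2.
    by rewrite ler_pXn2r ?nnegrE// ?(ltW tK)//; lra.
  rewrite -/K in tK *; move=> h3 h4 h5.
  have : K * (K - 1) <= K * (2 * p + 2 * q) by nra.
  by rewrite ler_pM2l ?(lt_trans ltr01)// /K0; lra.
split; first by move=> t t0 tT; exact: le_trans (kK t t0 tT) KK0.
have := main T T0 (lexx T); have : 0 <= `|k T| ^+ 2 by exact: sqr_ge0.
have : p * K <= p * K0 by rewrite ler_wpM2l.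
move=> h1 h2 h3; rewrite -ler_pdivrMl ?divr_gt0// invf_div; lra.
Qed.

End BallTest.

(** * Comparison with an implicit Euler scheme *)

Section TimeChange.
Context {R : realType}.
Implicit Types (lam : R -> R) (r s t : R).

(** The order-theoretic form of a time change in which the estimates are written;
    [rescaling_time_change] recovers continuity from monotonicity and surjectivity. *)
Definition rescaling lam : Prop := [/\ lam 0 = 0,
  forall s t, 0 <= s -> s < t -> lam s < lam t &
  forall r, 0 <= r -> exists2 t, 0 <= t & lam t = r].

Lemma time_change_rescaling lam : time_change lam -> rescaling lam.
Proof.
move=> [[lam0 _ lamsurj] lamlt _].
have lt s t : 0 <= s -> s < t -> lam s < lam t.
  move=> s0 st; have t0 := le_trans s0 (ltW st).
  by apply: lamlt => //; rewrite in_itv /= ?s0 ?t0.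
have surj r : 0 <= r -> exists2 t, 0 <= t & lam t = r.
  move=> r0; have [|t] := lamsurj r; first by rewrite /= in_itv /= r0.
  by rewrite /= in_itv /= andbT => t0 E; exists t.
split => //; have [t t0 E] := surj 0 (lexx 0).
have [t0E|t_gt0] := eqVneq t 0; first by rewrite -[X in lam X]t0E.
have := lt 0 t (lexx 0); rewrite lt_def t_gt0 t0 => /(_ isT).
have /= := lam0 0; rewrite !in_itv /= !andbT => /(_ (lexx 0)) h.
by rewrite E ltNge h.
Qed.

Lemma rescaling_id : rescaling idfun.
Proof. by split => // r r0; exists r. Qed.

Variable lam : R -> R.
Hypothesis lamP : rescaling lam.

Lemma rescaling0 : lam 0 = 0. Proof. by case: lamP. Qed.

Lemma rescaling_lt s t : 0 <= s -> s < t -> lam s < lam t.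
Proof. by case: lamP => _ h _; exact: h. Qed.

Lemma rescaling_le s t : 0 <= s -> s <= t -> lam s <= lam t.
Proof.
by move=> s0; rewrite le_eqVlt => /predU1P[->//|st]; rewrite ltW// rescaling_lt.
Qed.

Lemma rescaling_ge0 t : 0 <= t -> 0 <= lam t.
Proof. by move=> t0; rewrite -rescaling0 rescaling_le. Qed.

Lemma rescaling_lt_inv s t : 0 <= s -> 0 <= t -> lam s < lam t -> s < t.
Proof.
by move=> s0 t0; rewrite !ltNge; apply: contraNN; exact: rescaling_le.
Qed.

Lemma rescaling_le_inv s t : 0 <= s -> 0 <= t -> lam s <= lam t -> s <= t.
Proof.
by move=> s0 t0; rewrite !leNgt; apply: contraNN; exact: rescaling_lt.
Qed.

Lemma rescaling_surj r : 0 <= r -> exists2 t, 0 <= t & lam t = r.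
Proof. by case: lamP => _ _; exact. Qed.

End TimeChange.

Section BlockIndex.
Context {R : realType} {E : normedModType R}.
Variable m : R -> E.

(** The centers are the values of m at the left ends of the blocks, and index n belongs to the final
    point T. Monotonicity of b limits the number of changes of center to n. *)
Lemma block_index e s T n Mb : blocks (osc_le m e) s T n -> 0 <= e ->
  (forall t, s <= t -> t <= T -> `|m t| <= Mb) ->
  exists (b : R -> nat) (cen : nat -> E),
  [/\ forall t, s <= t -> t <= T -> (b t <= n)%N /\ `|m t - cen (b t)| <= e,
      forall t t', s <= t -> t <= t' -> t' <= T -> (b t <= b t')%N &
      forall i, `|cen i| <= Mb].
Proof.
move=> bl e0; elim: bl => {s T n} [t mM|s t T n st ost tT IH mM].
  exists (fun=> 0), (fun=> m t); split => // [r tr rt|_]; last exact: mM.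
  have -> : r = t by apply/le_anti/andP.
  by rewrite subrr normr0.
have [r tr rT|b [cen [bP bmon cenM]]] := IH.
  by apply: mM => //; exact: le_trans (ltW st) tr.
exists (fun r => if r < t then 0 else (b r).+1),
  (fun i => if i is j.+1 then cen j else m s); split.
- move=> r sr rT; have [rt|tr] := ltP r t; first by split => //; exact: ost.
  by have [h1 h2] := bP r tr rT.
- move=> r r' sr rr' r'T; have [rt|tr] := ltP r t => //.
  by have [r't|tr'] := ltP r' t; [have := lt_le_trans r't tr; rewrite ltNge rr'|exact: bmon].
- by case=> [|i]; [apply: mM => //; exact: le_trans (ltW st) (blocks_le tT)|exact: cenM].
Qed.

End BlockIndex.

Section Scheme.
Context {R : realType} {H : completeNormedModType R} (dot : {dot H for idfun}).
Hypothesis Hnorm : hilbert_norm dot.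
Variables (A : H -> set H) (Pi : H -> H).
Hypothesis Amax : maximal_monotone dot A.
Hypothesis PiP : gen_projection A Pi.
Variables (m : R -> H) (eta eta' : R).
Hypothesis m0A : closure (domain A) (m 0).
Implicit Types (r s t T W h theta : R) (u v l be w : H).

(* States (t, u, l, W) of a scheme which alternates implicit Euler steps for
   u' \in - A u with applications of Pi; the driver u + l stays eta-close to
   m, and W is the variation of l. *)
Inductive chain : R -> H -> H -> R -> Prop :=
| chain0 : chain 0 (m 0) 0 0
| chainS t u l W t' v be m' : chain t u l W -> t < t' -> A v be ->
    u = v + (t' - t) *: be -> `|(t' - t) *: be| <= eta' ->
    (forall r, t <= r -> r < t' -> `|m r - (u + l)| <= eta) ->
    `|m t' - m'| <= eta ->
    let lv := l + (t' - t) *: be in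
    let u' := Pi (m' - lv) in
    chain t' u' (m' - u')
      (W + `|(t' - t) *: be| + `|m' - u' - lv|).

Lemma chain_time_ge0 t u l W : chain t u l W -> 0 <= t.
Proof. by elim=> // *; apply: le_trans (ltW _); eassumption. Qed.

Lemma chain_W t u l W : chain t u l W -> `|l| <= W.
Proof.
elim=> {t u l W} [|t u l W t' v be m' _ lW _ _ _ _ _ _ lv u']; first by rewrite normr0.
have E : m' - u' = l + (t' - t) *: be + (m' - u' - lv) by rewrite [RHS]addrC subrK.
rewrite [X in `|X| <= _]E; apply: le_trans (ler_normD _ _) _; rewrite lerD//.
by apply: le_trans (ler_normD _ _) _; rewrite lerD.
Qed.

Lemma chain_dom t u l W : chain t u l W -> closure (domain A) u.
Proof.
elim=> {t u l W} // t u l W t' v be m' _ _ _ _ _ _ _ _ lv u'.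
by case: PiP => h _ _; apply: h; exists (m' - lv).
Qed.

Section Bound.
Variables (a : H) (r0 mu T : R) (N : nat) (b : R -> nat) (cen : nat -> H) (M1 : R).
Hypothesis r0_gt0 : 0 < r0.
Hypothesis ballA : closed_ball a r0 `<=` closure (domain A).
Hypothesis ball_mu : forall u w, closed_ball a r0 u -> A u w -> `|w| <= mu.
Hypothesis bP : forall t, 0 <= t -> t <= T -> (b t <= N)%N /\ `|m t - cen (b t)| <= r0 / 4.
Hypothesis bmon : forall t t', 0 <= t -> t <= t' -> t' <= T -> (b t <= b t')%N.
Hypothesis cenM : forall i, `|cen i - a| <= M1.
Hypothesis etar : eta <= r0 / 4.
Hypothesis eta1 : eta' <= 1.

Let D0 := M1 + 2 * r0 + 2.
(** A Lyapunov function for the scheme: the energy |l|^2 / 2 - <cen_i - a, l> plus r0 / 2 times the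
    variation, shifted by 2 M1^2 to be coercive. *)
Let potential i l W := `|l| ^+ 2 / 2 - dot (cen i - a) l + r0 / 2 * W + 2 * M1 ^+ 2.

Let M1_ge0 : 0 <= M1. Proof. exact: le_trans (cenM 0). Qed.

Let potential_ge i l W : 0 <= W ->
  `|l| ^+ 2 / 4 + r0 / 2 * W + M1 ^+ 2 <= potential i l W.
Proof.
move=> W0; rewrite /potential; have := dot_le Hnorm (cen i - a) l.
have : `|cen i - a| * `|l| <= M1 * `|l| by rewrite ler_wpM2r.
have := sqr_ge0 (`|l| / 2 - M1); lra.
Qed.

(** Discrete analogue of [apriori]: a Gronwall factor exp (4 mu h) per Euler step and a factor 6 per
    change of center, while Pi never raises the potential. The bound involves neither the accuracies
    nor the number of steps. *)
Lemma chain_bound t u l W : chain t u l W -> t <= T ->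
  r0 / 2 * W <= 6 ^+ N * expR (4 * mu * T) * (2 * M1 ^+ 2 + D0).
Proof.
have mu0 := ball_mu_ge0 r0_gt0 ballA ball_mu.
have D00 : 0 <= D0 by rewrite /D0; have := ltW r0_gt0; have := M1_ge0; lra.
suff H1 : chain t u l W -> t <= T -> potential (b t) l W + D0 <=
    6 ^+ (b t) * expR (4 * mu * t) * (2 * M1 ^+ 2 + D0).
  move=> ch tT; have t0 := chain_time_ge0 ch.
  have W0 : 0 <= W by apply: le_trans (chain_W ch).
  have := potential_ge (b t) l W0; have := H1 ch tT.
  have : 6 ^+ b t * expR (4 * mu * t) * (2 * M1 ^+ 2 + D0) <=
      6 ^+ N * expR (4 * mu * T) * (2 * M1 ^+ 2 + D0).
    apply: ler_wpM2r; first by rewrite addr_ge0// mulr_ge0// sqr_ge0.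
    apply: ler_pM; rewrite ?expR_ge0 ?exprn_ge0//.
      by rewrite ler_weXn2l// ?ler1n//; case: (bP t0 tT).
    by rewrite ler_expR ler_wpM2l// mulr_ge0.
  by have := sqr_ge0 `|l|; have := sqr_ge0 M1; lra.
elim=> {t u l W} [_|t u l W t' v be m' ch IH tt' Avb uE beta mt mt' lv u' t'T].
  rewrite /potential normr0 dot0r mulr0 expr0n /= mul0r subrr !add0r mulr0 expR0 mulr1.
  by apply: ler_peMl; [rewrite addr_ge0// mulr_ge0// sqr_ge0|rewrite exprn_ege1// ler1n].
have tT := le_trans (ltW tt') t'T; have t0 := chain_time_ge0 ch.
have W0 : 0 <= W by apply: le_trans (chain_W ch).
have t'0 := le_trans t0 (ltW tt').
set h := t' - t in uE beta lv u' *.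
have h0 : 0 < h by rewrite subr_gt0.
set w := h *: be in uE beta lv u' *.
have mj : `|u + l - cen (b t)| <= r0 / 2.
  have [_ mc] := bP t0 tT; have := mt t (lexx t) tt'; rewrite distrC => hm.
  have -> : u + l - cen (b t) = (u + l - m t) + (m t - cen (b t)) by rewrite addrA subrK.
  by apply: le_trans (ler_normD _ _) _; have := etar; lra.
have m'c : `|m' - cen (b t')| <= r0 / 2.
  have [_ mc] := bP t'0 t'T; rewrite distrC in mt'.
  have -> : m' - cen (b t') = (m' - m t') + (m t' - cen (b t')) by rewrite addrA subrK.
  by apply: le_trans (ler_normD _ _) _; have := etar; lra.
have euler : potential (b t) lv (W + `|w|) + D0 <=
    (potential (b t) l W + D0) * expR (4 * mu * h).
  have test : r0 * `|w| <= dot (v - a) w + mu * h * (`|v - a| + r0).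
    apply: (ball_test Hnorm r0_gt0 ballA) => al al' aal Aal.
    have := mono Amax Avb Aal; rewrite dotDr dotNr => mon.
    have al'mu : `|al'| <= mu by apply: ball_mu Aal; apply/closed_ballP.
    have val : `|v - al| <= `|v - a| + r0.
      have -> : v - al = (v - a) - (al - a) by rewrite opprB addrA subrK.
      by apply: le_trans (ler_normB _ _) _; rewrite lerD2l.
    have : - (mu * (`|v - a| + r0)) <= dot (v - al) al'.
      apply: le_trans (dot_ge Hnorm _ _); rewrite lerN2 mulrC; exact: ler_pM.
    rewrite /w dotZr; nra.
  have va : `|v - a| <= M1 + r0 + 1 + `|l|.
    have -> : v - a = (u + l - cen (b t)) + (cen (b t) - a) - lv.
      by rewrite /lv uE; apply: (eq_dot Hnorm) => ?; rewrite !dotE; ring.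
    apply: le_trans (ler_normB _ _) _.
    have := ler_normD (u + l - cen (b t)) (cen (b t) - a); have := cenM (b t).
    have := ler_normD l w; rewrite -/lv; have := ltW r0_gt0; have := eta1; lra.
  have lE : `|l| <= 1 + `|l| ^+ 2 by have := sqr_ge0 (`|l| - 1); have := normr_ge0 l; nra.
  have P0 := potential_ge (b t) l W0.
  have M1s := sqr_ge0 M1; have M10 := M1_ge0; have rW : 0 <= r0 / 2 * W by rewrite mulr_ge0// divr_ge0// ltW.
  have vaE : `|v - a| + r0 <= 4 * (potential (b t) l W + D0) by rewrite /D0; have := ltW r0_gt0; lra.
  have stepE : potential (b t) lv (W + `|w|) <= potential (b t) l W + mu * h * (`|v - a| + r0).
    have vE : v - a = (cen (b t) - a) + (u + l - cen (b t)) - lv.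
      by rewrite /lv uE; apply: (eq_dot Hnorm) => ?; rewrite !dotE; ring.
    move: test; rewrite vE dotDl dotNl dotDl.
    have := dot_le Hnorm (u + l - cen (b t)) w.
    have : `|u + l - cen (b t)| * `|w| <= r0 / 2 * `|w| by rewrite ler_wpM2r.
    rewrite /potential /lv (norm2D Hnorm l w) (dotDl dot l) -(Hnorm w) !(dotDr dot (cen (b t) - a)) -vE.
    by have := sqr_ge0 `|w|; lra.
  have e1 : 1 + 4 * mu * h <= expR (4 * mu * h) by exact: expR_ge1Dx.
  have PD0 : 0 <= potential (b t) l W + D0 by have := sqr_ge0 `|l|; lra.
  have : (potential (b t) l W + D0) * (1 + 4 * mu * h) <=
      (potential (b t) l W + D0) * expR (4 * mu * h) by rewrite ler_wpM2l.
  apply: le_trans.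
  have : mu * h * (`|v - a| + r0) <= mu * h * (4 * (potential (b t) l W + D0)).
    by rewrite ler_wpM2l// mulr_ge0// ltW.
  lra.
have Ww : 0 <= W + `|w| by rewrite addr_ge0.
(* A change of center costs at most 2 M1 |lv|, which Young's inequality bounds by 4 times the
   potential. *)
have switch : potential (b t') lv (W + `|w|) + D0 <=
    6 ^+ (b t' - b t) * (potential (b t) lv (W + `|w|) + D0).
  have Pv := potential_ge (b t) lv Ww.
  have rW : 0 <= r0 / 2 * (W + `|w|) by rewrite mulr_ge0// divr_ge0// ltW.
  have := bmon t0 (ltW tt') t'T; rewrite leq_eqVlt => /predU1P[->|bb].
    by rewrite subnn expr0 mul1r.
  apply: (@le_trans _ _ (6 * (potential (b t) lv (W + `|w|) + D0))).
    rewrite {1}/potential; have := dot_ge Hnorm (cen (b t') - cen (b t)) lv.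
    have : `|cen (b t') - cen (b t)| * `|lv| <= 2 * M1 * `|lv|.
      rewrite ler_wpM2r//; rewrite (_ : cen (b t') - cen (b t) =
        (cen (b t') - a) - (cen (b t) - a)); last by rewrite opprB addrA subrK.
      by apply: le_trans (ler_normB _ _) _; have := cenM (b t); have := cenM (b t'); lra.
    rewrite (_ : cen (b t') - a = (cen (b t) - a) + (cen (b t') - cen (b t))); last first.
      by rewrite [RHS]addrC addrA subrK.
    rewrite (dotDl dot (cen (b t) - a)); move: Pv; rewrite /potential.
    have := sqr_ge0 (`|lv| / 2 - 2 * M1).
    by have := sqr_ge0 `|lv|; have := sqr_ge0 M1; lra.
  apply: ler_wpM2r; first by have := sqr_ge0 `|lv|; have := sqr_ge0 M1; lra.
  by rewrite -[X in X <= _]expr1 ler_weXn2l ?subn_gt0// ler1n.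
(* The jump inequality for Pi, tested over the ball, gives r0 |d| <= <u' - a, d> + |d|^2 / 2. As m'
   is r0 / 2-close to the new center, r0 / 2 |d| is left for the variation. *)
have proj : potential (b t') (m' - u') (W + `|w| + `|m' - u' - lv|) <=
    potential (b t') lv (W + `|w|).
  set d := m' - u' - lv.
  have -> : m' - u' = lv + d by rewrite /d [RHS]addrC subrK.
  have test : r0 * `|d| <= dot (u' - a) d + 2^-1 * `|d| ^+ 2.
    apply: (ball_test Hnorm r0_gt0 ballA) => al al' _ Aal.
    have Aal' : closure (domain A) al by apply: subset_closure; exists al'.
    have := Pi_test PiP (m' - lv) Aal'; rewrite -/u'.
    have -> : m' - lv - al = (u' - al) + d.
      by rewrite /d; apply: (eq_dot Hnorm) => ?; rewrite !dotE; ring.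
    rewrite -(@ler_pXn2r _ 2) ?nnegrE// (norm2D Hnorm (u' - al)); lra.
  move: test; rewrite (_ : u' - a = (cen (b t') - a) + (m' - cen (b t')) - lv - d); last first.
    by rewrite /d; apply: (eq_dot Hnorm) => ?; rewrite !dotE; ring.
  have : dot (m' - cen (b t')) d <= r0 / 2 * `|d|.
    by apply: le_trans (dot_le Hnorm _ _) _; rewrite ler_wpM2r.
  clearbody d; rewrite /potential; move: (cen (b t') - a) (m' - cen (b t')) => p q.
  by rewrite (norm2D Hnorm lv d) !dotE -(Hnorm d); lra.
apply: le_trans (_ : _ <= potential (b t') lv (W + `|w|) + D0) _; first by rewrite lerD2r.
apply: le_trans switch _.
apply: le_trans (_ : _ <= 6 ^+ (b t' - b t) *
  ((6 ^+ b t * expR (4 * mu * t) * (2 * M1 ^+ 2 + D0)) * expR (4 * mu * h))) _.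
  rewrite ler_wpM2l ?exprn_ge0//; apply: le_trans euler _.
  by rewrite ler_wpM2r ?expR_ge0//; exact: IH.
have -> : 4 * mu * t' = 4 * mu * t + 4 * mu * h by rewrite /h; ring.
rewrite expRD -[in X in _ <= X](subnK (bmon t0 (ltW tt') t'T)) exprD.
move: (6 ^+ (b t' - b t)) (6 ^+ b t) => X Y.
by rewrite le_eqVlt; apply/orP; left; apply/eqP; ring.
Qed.

End Bound.

End Scheme.

Section Comparison.
Context {R : realType} {H : completeNormedModType R} (dot : {dot H for idfun}).
Hypothesis Hnorm : hilbert_norm dot.
Variables (A : H -> set H) (Pi : H -> H).
Hypothesis Amax : maximal_monotone dot A.
Hypothesis PiP : gen_projection A Pi.
Variables (m : R -> H) (eta eta' T B Bx : R).
Hypotheses (eta_ge0 : 0 <= eta) (eta'_ge0 : 0 <= eta').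
Implicit Types (r s t W h theta e : R) (u v l be w : H).

(** The parameter theta is kept apart from eta: it is chosen after the scheme, whose slopes |be|
    multiply it. *)
Definition near_solution theta (m' x' k' : R -> H) (lam : R -> R) : Prop :=
  [/\ SP dot A Pi m' x' k', rescaling lam,
      forall t, 0 <= t -> t <= T -> `|m' (lam t) - m t| <= eta,
      forall t, 0 <= t -> t <= T -> `|lam t - t| <= theta &
      Vr 0 (lam T) k' <= B /\ forall r, 0 <= r -> r <= lam T -> `|x' r| <= Bx].

Lemma near_solutionW theta theta' m' x' k' lam : theta <= theta' ->
  near_solution theta m' x' k' lam -> near_solution theta' m' x' k' lam.
Proof.
move=> tt [h1 h2 h3 h4 h5]; split => // t t0 tT.
exact: le_trans (h4 t t0 tT) tt.
Qed.

Section Step.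
Variables (theta t t' : R) (u v l be : H).
Variables (m' x' k' : R -> H) (lam : R -> R).
Hypothesis sol : near_solution theta m' x' k' lam.
Hypotheses (t0 : 0 <= t) (tt' : t < t') (t'T : t' <= T) (Avb : A v be).
Hypothesis uE : u = v + (t' - t) *: be.
Hypothesis beta : `|(t' - t) *: be| <= eta'.
Hypothesis mt : forall r, t <= r -> r < t' -> `|m r - (u + l)| <= eta.
Local Notation lv := (l + (t' - t) *: be).
Local Notation w := `|(t' - t) *: be|.
Local Notation D := (Bx + `|v|).
Local Notation V s t := (Vr s t k').

Let spP : SP dot A Pi m' x' k'. Proof. by case: sol. Qed.
Let lamP : rescaling lam. Proof. by case: sol. Qed.
Let t'0 : 0 <= t'. Proof. exact: le_trans (ltW tt'). Qed.
Let T0 : 0 <= T. Proof. exact: le_trans t'T. Qed.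
Let tT : t <= T. Proof. exact: le_trans (ltW tt') t'T. Qed.
Let s0 : 0 <= lam t. Proof. exact: rescaling_ge0. Qed.
Let ss' : lam t < lam t'. Proof. exact: rescaling_lt. Qed.
Let s'T : lam t' <= lam T. Proof. exact: rescaling_le. Qed.

Let driver r : lam t <= r -> r < lam t' -> `|m' r - (u + l)| <= 2 * eta.
Proof.
move=> sr rs'; have r0 := le_trans s0 sr.
have [q q0 qE] := rescaling_surj lamP r0.
have tq : t <= q by apply: (rescaling_le_inv lamP) => //; rewrite qE.
have qt' : q < t' by apply: (rescaling_lt_inv lamP) => //; rewrite qE.
have [_ _ mm _ _] := sol; have := mm q q0 (le_trans (ltW qt') t'T); rewrite qE => h.
have -> : m' r - (u + l) = (m' r - m q) + (m q - (u + l)) by rewrite addrA subrK.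
by apply: le_trans (ler_normD _ _) _; have := mt tq qt'; lra.
Qed.

Let xv r : 0 <= r -> r <= lam T -> `|x' r - v| <= D.
Proof.
move=> r0 rT; apply: le_trans (ler_normB _ _) _; rewrite lerD2r.
by case: sol => _ _ _ _ [_]; exact.
Qed.

Let hh : `|(t' - t) - (lam t' - lam t)| <= 2 * theta.
Proof.
have [_ _ _ ll _] := sol; have := ll t t0 tT; have := ll t' t'0 t'T.
have -> : t' - t - (lam t' - lam t) = (lam t - t) - (lam t' - t') by ring.
by move=> h1 h2; apply: le_trans (ler_normB _ _) _; lra.
Qed.

Let wE : w = (t' - t) * `|be|.
Proof. by rewrite normrZ ger0_norm// subr_ge0 ltW. Qed.

Let gap : lv - k' (lam t) = (x' (lam t) - v) + ((u + l) - m' (lam t)).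
Proof.
by rewrite -(SP_xk spP)// [in RHS]uE; apply: (eq_dot Hnorm) => ?; rewrite !dotE; ring.
Qed.

(** Exact expansion of the squares, except that minus half the squared Euler increment is
    dropped. *)
Let cross K : (`|K - lv| ^+ 2 - `|k' (lam t) - l| ^+ 2) / 2 <=
   (`|K| ^+ 2 - `|k' (lam t)| ^+ 2) / 2 - dot lv (K - k' (lam t))
   + (t' - t) * dot be (lv - k' (lam t)).
Proof.
set h := t' - t; set k0 := k' (lam t).
rewrite !(norm2B Hnorm) (norm2D Hnorm l) -(dotZl dot h be).
have -> : K = (K - k0) + k0 by rewrite subrK.
move: (K - k0) => d; rewrite addrK !(dotDl dot) !(dotDr dot) !dotNr -(Hnorm (h *: be)).
rewrite (dotC dot (h *: be) l) (dotC dot (h *: be) d) (dotC dot l d).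
rewrite (dotC dot (h *: be) k0); have := sqr_ge0 `|h *: be|.
by lra.
Qed.

(** The energy inequality of the solution is tested with the pair (v, be) of the scheme and the
    center u + l. As u + l - v = [lv], its boundary terms match those of [cross]; the time integral,
    frozen at [lam t], cancels (t' - t) <x' - v, be> up to the change of clock. *)
Lemma euler_compare :
  (`|left_lim k' (lam t') - lv| ^+ 2 - `|k' (lam t) - l| ^+ 2) / 2 <=
  2 * eta * w + (4 * eta + V (lam t) (lam t')) * (w + 2 * theta * `|be|)
  + 2 * theta * `|be| * D
  + 2 * eta * (V (lam t) (lam t') - `|jump k' (lam t')|).
Proof.
have D0 : 0 <= D by apply: le_trans (xv s0 (le_trans (ltW ss') s'T)).
have nrg := energy_open Hnorm PiP spP Avb s0 ss' driver.
have kbv := BVfin (SP_bv spP).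
have osc r : lam t <= r -> r < lam t' -> `|x' r - x' (lam t)| <=
    4 * eta + V (lam t) (lam t').
  move=> sr rs'; have r0 := le_trans s0 sr.
  have -> : x' r - x' (lam t) =
      (m' r - (u + l)) - (m' (lam t) - (u + l)) - (k' r - k' (lam t)).
    by rewrite -!(SP_xk spP)//; apply: (eq_dot Hnorm) => ?; rewrite !dotE; ring.
  apply: le_trans (ler_normB _ _) _; apply: lerD.
    apply: le_trans (ler_normB _ _) _.
    by have := driver sr rs'; have := driver (lexx _) ss'; lra.
  apply: le_trans (Vr_ge (kbv r) s0 sr (lexx r)) _.
  exact: (Vr_le (kbv (lam t')) s0 (lexx _) sr (ltW rs') (lexx _)).
have := Lint_cst Hnorm v be (SP_cadlag_x spP) s0 (ltW ss') osc.
rewrite ler_norml => /andP[Llo _].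
have c1 := cross (left_lim k' (lam t')).
move: c1; rewrite gap (dotDr dot be) !(dotC dot be).
move: nrg; have -> : u + l - v = lv.
  by rewrite uE; apply: (eq_dot Hnorm) => ?; rewrite !dotE; ring.
set Lt := Lint _ _ _ _ _ _ in Llo *; set X := dot (x' (lam t) - v) be in Llo *.
set Y := dot (u + l - m' (lam t)) be.
have XD : `|X| <= D * `|be|.
  by apply: le_trans (normr_dot_le Hnorm _ _) _; rewrite ler_wpM2r// xv// (le_trans (ltW ss')).
have YD : (t' - t) * Y <= 2 * eta * w.
  rewrite wE mulrCA; apply: ler_wpM2l; first by rewrite subr_ge0 ltW.
  apply: le_trans (dot_le Hnorm _ _) _; rewrite ler_wpM2r//.
  by rewrite distrC; exact: driver.
have hX : (t' - t - (lam t' - lam t)) * X <= 2 * theta * `|be| * D.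
  apply: le_trans (ler_norm _) _; rewrite normrM -[leRHS]mulrA [ `|be| * D ]mulrC.
  by apply: ler_pM => //; exact: hh.
have V0 : 0 <= V (lam t) (lam t') by rewrite (Vr_ge0 (kbv (lam t')))// ltW.
have wl : `|be| * (lam t' - lam t) <= w + 2 * theta * `|be|.
  have := hh; rewrite ler_norml => /andP[h1 _]; have := normr_ge0 be.
  by rewrite wE; nra.
have : (4 * eta + V (lam t) (lam t')) * `|be| * (lam t' - lam t) <=
    (4 * eta + V (lam t) (lam t')) * (w + 2 * theta * `|be|).
  by rewrite -mulrA ler_wpM2l// addr_ge0// mulr_ge0//; exact: eta_ge0.
move: Llo YD hX; lra.
Qed.

(** Nonexpansiveness of Pi at m' - k'_- and p - lv. In the expanded squares |M|^2 cancels, so the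
    error is eta times the sizes of the two jumps, and such errors add up to a multiple of the
    variations. *)
Lemma jump_compare p : `|m t' - p| <= eta ->
  `|k' (lam t') - (p - Pi (p - lv))| ^+ 2 <= `|left_lim k' (lam t') - lv| ^+ 2
    + 4 * eta * (`|jump k' (lam t')| + `|p - Pi (p - lv) - lv|).
Proof.
move=> mp; set u' := Pi (p - lv); set s' := lam t'; set K := left_lim k' s'.
have s'0 : 0 <= s' by exact: le_trans (ltW ss').
pose M := m' s' - p.
have M2 : `|M| <= 2 * eta.
  have [_ _ mm _ _] := sol; have := mm t' t'0 t'T; rewrite -/s' => h.
  have -> : M = (m' s' - m t') + (m t' - p) by rewrite addrA subrK.
  by apply: le_trans (ler_normD _ _) _; lra.
have : `|x' s' - u'| <= `|M - (K - lv)|.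
  rewrite (SP_Pi Hnorm spP)//; case: PiP => _ _ PiL; apply: le_trans (PiL _ _) _.
  by rewrite le_eqVlt; apply/orP; left; apply/eqP; congr `|_|;
    apply: (eq_dot Hnorm) => ?; rewrite /M /K !dotE; ring.
have -> : x' s' - u' = M - (k' s' - (p - u')).
  by rewrite /M -(SP_xk spP)//; apply: (eq_dot Hnorm) => ?; rewrite !dotE; ring.
rewrite -(@ler_pXn2r _ 2) ?nnegrE// !(norm2B Hnorm M) => h.
have : dot M (k' s' - (p - u') - (K - lv)) <= 2 * eta * (`|jump k' s'| + `|p - u' - lv|).
  apply: le_trans (dot_le Hnorm _ _) _; apply: ler_pM => //.
  have -> : k' s' - (p - u') - (K - lv) = jump k' s' - (p - u' - lv).
    by rewrite /jump -/K; apply: (eq_dot Hnorm) => ?; rewrite !dotE; ring.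
  exact: ler_normB.
by rewrite (dotDr dot M) (dotNr dot M); lra.
Qed.

(** Between two nodes of the scheme a cruder estimate suffices: its error is added once to that of
    the preceding node and does not accumulate. *)
Lemma partial_compare r : t <= r -> r < t' ->
  `|k' (lam r) - lv| ^+ 2 <= `|k' (lam t) - l| ^+ 2
    + 2 * (2 * eta + 2 * D) * eta' + 4 * theta * `|be| * D + 4 * eta * B.
Proof.
move=> tr rt'; have r0 := le_trans t0 tr.
have D0 : 0 <= D by apply: le_trans (xv s0 (le_trans (ltW ss') s'T)).
have sr : lam t <= lam r by exact: rescaling_le.
have rs' : lam r < lam t' by exact: rescaling_lt.
have kbv := BVfin (SP_bv spP).
have dr q : lam t <= q -> q <= lam r -> `|m' q - (u + l)| <= 2 * eta.
  by move=> tq qr; apply: driver => //; exact: le_lt_trans rs'.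
have nrg := energy Hnorm PiP spP Avb s0 sr dr.
have VB : V (lam t) (lam r) <= B.
  case: sol => _ _ _ _ [+ _]; apply: le_trans.
  by apply: (Vr_le (kbv (lam T))) => //; exact: le_trans (ltW rs') s'T.
have LD : `|Lint dot x' v be (lam t) (lam r)| <= D * `|be| * (lam r - lam t).
  apply: (Lint_norm Hnorm) => //; first exact: SP_cadlag_x spP.
  move=> q sq qr; apply: xv; first exact: le_trans (ltW sq).
  exact: le_trans qr (le_trans (ltW rs') s'T).
have c1 := cross (k' (lam r)); move: c1 nrg; rewrite gap (dotDr dot be) !(dotC dot be).
have -> : u + l - v = lv.
  by rewrite uE; apply: (eq_dot Hnorm) => ?; rewrite !dotE; ring.
set X := dot (x' (lam t) - v) be; set Y := dot (u + l - m' (lam t)) be.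
have XD : (t' - t) * X <= D * w.
  rewrite wE mulrCA; apply: ler_wpM2l; first by rewrite subr_ge0 ltW.
  apply: le_trans (dot_le Hnorm _ _) _; rewrite ler_wpM2r// xv//.
  exact: le_trans (ltW ss') s'T.
have YD : (t' - t) * Y <= 2 * eta * w.
  rewrite wE mulrCA; apply: ler_wpM2l; first by rewrite subr_ge0 ltW.
  apply: le_trans (dot_le Hnorm _ _) _; rewrite ler_wpM2r//.
  by rewrite distrC; exact: driver.
have wl : `|be| * (lam r - lam t) <= w + 2 * theta * `|be|.
  have := hh; rewrite ler_norml => /andP[h1 _]; have := normr_ge0 be.
  by rewrite wE; nra.
have : D * `|be| * (lam r - lam t) <= D * (w + 2 * theta * `|be|).
  by rewrite -mulrA ler_wpM2l.
have Dw : D * w <= D * eta' by rewrite ler_wpM2l//; exact: beta.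
have ew : eta * w <= eta * eta' by rewrite ler_wpM2l//; exact: beta.
have eB : eta * V (lam t) (lam r) <= eta * B by rewrite ler_wpM2l//; exact: eta_ge0.
move: LD; rewrite ler_norml => /andP[LD _].
move: XD YD wl Dw ew eB LD; lra.
Qed.

End Step.

End Comparison.

Section ChainCompare.
Context {R : realType} {H : completeNormedModType R} (dot : {dot H for idfun}).
Hypothesis Hnorm : hilbert_norm dot.
Variables (A : H -> set H) (Pi : H -> H).
Hypothesis PiP : gen_projection A Pi.
Variables (m : R -> H) (eta eta' T B Bx Mb Wm : R).
Hypotheses (eta_ge0 : 0 <= eta) (eta'_ge0 : 0 <= eta') (B_ge0 : 0 <= B) (Bx_ge0 : 0 <= Bx).
Hypothesis mM : forall t : R, 0 <= t -> t <= T -> `|m t| <= Mb.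
Hypothesis chainW : forall t u l W, chain A Pi m eta eta' t u l W -> t <= T -> W <= Wm.
Implicit Types (r s t W h theta e : R) (u v l be w : H).

Let Dm := Bx + Mb + eta + Wm.
Let err := 12 * eta * Wm + (2 * eta' + 8 * eta) * B + 4 * (eta + Dm) * eta'.

(** In twice [euler_compare] the gain 4 eta |jump| cancels the cost of the jump in [jump_compare].
    What remains are increments of 12 eta W and of (2 eta' + 4 eta) V, plus e / 2 for the change of
    clock. The point w depends on the scheme alone, so it serves all solutions. *)
Lemma chain_compare t u l W : chain A Pi m eta eta' t u l W -> t <= T ->
  forall e, 0 < e -> exists2 theta : R, 0 < theta &
  (forall m' x' k' lam, near_solution dot A Pi m eta T B Bx theta m' x' k' lam ->
     `|k' (lam t) - l| ^+ 2 <= 12 * eta * W + (2 * eta' + 4 * eta) * Vr 0 (lam t) k' + e) /\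
  (forall r, 0 <= r -> r <= t -> exists w, forall m' x' k' lam,
     near_solution dot A Pi m eta T B Bx theta m' x' k' lam ->
     `|k' (lam r) - w| ^+ 2 <= err + e).
Proof.
have sol_V theta m' x' k' lam s r : near_solution dot A Pi m eta T B Bx theta m' x' k' lam ->
    0 <= s -> s <= r -> r <= T -> 0 <= Vr (lam s) (lam r) k' <= B.
  move=> [sp lamP _ _ [VB _]] s0 sr rT; have r0 := le_trans s0 sr.
  have kbv := BVfin (SP_bv sp) (lam T).
  have ls : 0 <= lam s by exact: rescaling_ge0.
  have lsr : lam s <= lam r by exact: rescaling_le.
  have lrT : lam r <= lam T by exact: rescaling_le.
  rewrite (Vr_ge0 kbv)//=; apply: le_trans VB.
  exact: (Vr_le kbv).
have eB := mulr_ge0 eta_ge0 B_ge0; have e'B := mulr_ge0 eta'_ge0 B_ge0.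
elim=> {t u l W} [T0 e e0|t u l W t' v be m' ch IH tt' Avb uE beta mt mt' lv u' t'T e e0].
  have Mb0 : 0 <= Mb by apply: le_trans (mM (lexx 0) T0).
  have Wm0 : 0 <= Wm by apply: le_trans (chainW (chain0 _ _ _ _ _) T0).
  have Dm0 : 0 <= Dm by rewrite /Dm !addr_ge0.
  have err0 : 0 <= err by rewrite /err !addr_ge0// ?mulr_ge0// ?addr_ge0// ?mulr_ge0.
  have z m' x' k' lam : near_solution dot A Pi m eta T B Bx 1 m' x' k' lam ->
      k' (lam 0) = 0 /\ 0 <= Vr 0 (lam 0) k'.
    move=> sol; have [sp lamP _ _ _] := sol.
    have := sol_V _ _ _ _ _ 0 0 sol (lexx 0) (lexx 0) T0.
    by rewrite (rescaling0 lamP) (SP_k0 sp) => /andP[].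
  exists 1 => //; split.
    move=> m' x' k' lam /z[-> V0]; rewrite subrr normr0 mulr0 add0r expr0n /=.
    by rewrite addr_ge0 ?(ltW e0)// mulr_ge0// addr_ge0// mulr_ge0.
  move=> r r0 r0'; have -> : r = 0 by apply/le_anti/andP.
  exists 0 => m' x' k' lam /z[-> _]; rewrite subrr normr0 expr0n /=.
  by rewrite addr_ge0// ltW.
have tT := le_trans (ltW tt') t'T; have t0 := chain_time_ge0 ch.
have t'0 := le_trans t0 (ltW tt').
have e20 : 0 < e / 2 by lra.
have [theta1 theta10 [cmp cov]] := IH tT (e / 2) e20.
have chS : chain A Pi m eta eta' t' u' (m' - u')
  (W + `|(t' - t) *: be| + `|m' - u' - lv|) by apply: chainS ch tt' Avb uE beta mt mt'.
have WW := chainW chS t'T.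
have W0 : 0 <= W by apply: le_trans (chain_W ch).
have Mb0 : 0 <= Mb by apply: le_trans (mM t0 tT).
have Wm0 : 0 <= Wm by apply: le_trans WW; rewrite !addr_ge0.
have vD : Bx + `|v| <= Dm.
  have -> : v = (m t) - (m t - (u + l)) - (l + (t' - t) *: be).
    by rewrite uE; apply: (eq_dot Hnorm) => ?; rewrite !dotE; ring.
  have := ler_normB (m t - (m t - (u + l))) (l + (t' - t) *: be).
  have := ler_normB (m t) (m t - (u + l)); have := ler_normD l ((t' - t) *: be).
  have := mM t0 tT; have := mt t (lexx t) tt'; have := chain_W ch.
  by have := normr_ge0 (m' - u' - lv); rewrite /Dm; lra.
(* The factor of theta in twice [euler_compare], with the variation bounded by B; it also dominates
   the one in [partial_compare]. *)
pose G := `|be| * (4 * (4 * eta + B) + 4 * (Bx + `|v|)).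
have G0 : 0 <= G by rewrite /G mulr_ge0// !addr_ge0// ?mulr_ge0// ?addr_ge0// mulr_ge0.
have G1 : 0 < G + 1 by rewrite ltr_wpDl.
pose theta := Num.min theta1 (e / 2 / (G + 1)).
have theta_le1 : theta <= theta1 by rewrite ge_min lexx.
have thetaG : theta * (G + 1) <= e / 2.
  by rewrite -ler_pdivlMr// ge_min lexx orbT.
have theta0 : 0 < theta by rewrite lt_min theta10 divr_gt0.
have thG : theta * G <= e / 2 by apply: le_trans thetaG; rewrite ler_wpM2l// ?lerDl// ltW.
have full m1 x1 k1 lam : near_solution dot A Pi m eta T B Bx theta m1 x1 k1 lam ->
    `|k1 (lam t') - (m' - u')| ^+ 2 <=
    12 * eta * (W + `|(t' - t) *: be| + `|m' - u' - lv|)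
    + (2 * eta' + 4 * eta) * Vr 0 (lam t') k1 + e.
  move=> sol; have sol1 := near_solutionW theta_le1 sol.
  have [sp lamP _ _ _] := sol.
  have ec := euler_compare Hnorm PiP eta_ge0 sol t0 tt' t'T Avb uE mt.
  have jc := jump_compare Hnorm PiP l be sol t0 tt' t'T mt'.
  have c0 := cmp _ _ _ _ sol1.
  have ls0 : 0 <= lam t by exact: rescaling_ge0.
  have lss : lam t <= lam t' by exact: (rescaling_le lamP t0 (ltW tt')).
  rewrite (VrD (BVfin (SP_bv sp) (lam t')) (lexx 0) ls0 lss (lexx _)).
  have /andP[V0 VB] := sol_V _ _ _ _ _ _ _ sol t0 (ltW tt') t'T.
  move: jc; rewrite -/lv -/u' => jc; move: ec jc c0 thG V0 VB; rewrite -/lv /G.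
  set V1 := Vr (lam t) _ _; set V2 := Vr 0 _ _; set w := `|(t' - t) *: be|.
  set J := `|jump _ _|; set d := `|m' - u' - lv| => ec jc c0 thG' V0 VB.
  have Vw : V1 * w <= V1 * eta' by rewrite ler_wpM2l.
  have thV : theta * `|be| * V1 <= theta * `|be| * B.
    by rewrite ler_wpM2l// mulr_ge0// ltW.
  have edp : 0 <= eta * d by exact: mulr_ge0 eta_ge0 (normr_ge0 _).
  by lra.
exists theta => //; split; first by move=> m1 x1 k1 lam sol; exact: full sol.
move=> r r0 rt'; have [rt|tr] := leP r t.
  have [w wP] := cov r r0 rt; exists w => m1 x1 k1 lam sol.
  by apply: le_trans (wP _ _ _ _ (near_solutionW theta_le1 sol)) _; rewrite lerD2l; lra.
move: rt'; rewrite le_eqVlt => /predU1P[->|rt'].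
  exists (m' - u') => m1 x1 k1 lam sol; apply: le_trans (full _ _ _ _ sol) _.
  have := sol_V _ _ _ _ _ 0 t' sol (lexx 0) t'0 t'T.
  have [_ lamP _ _ _] := sol; rewrite (rescaling0 lamP) => /andP[V0 VB].
  have h1 := ler_wpM2l eta_ge0 WW; have h2 := ler_wpM2l eta_ge0 VB.
  have h3 := ler_wpM2l eta'_ge0 VB.
  have Dm0 : 0 <= Dm by rewrite /Dm !addr_ge0.
  have := mulr_ge0 eta_ge0 eta'_ge0; have := mulr_ge0 Dm0 eta'_ge0.
  by rewrite /err; lra.
exists lv => m1 x1 k1 lam sol; have sol1 := near_solutionW theta_le1 sol.
have pc := partial_compare Hnorm PiP eta_ge0 sol t0 tt' t'T Avb uE beta mt (ltW tr) rt'.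
have c0 := cmp _ _ _ _ sol1.
have := sol_V _ _ _ _ _ 0 t sol (lexx 0) t0 tT.
have [_ lamP _ _ _] := sol; rewrite (rescaling0 lamP) => /andP[V0 VB].
have WmW : W <= Wm by exact: chainW ch tT.
have h1 := ler_wpM2l eta_ge0 WmW; have h2 := ler_wpM2l eta_ge0 VB.
have h3 := ler_wpM2l eta'_ge0 VB; have h4 := ler_wpM2l eta'_ge0 vD.
have h5 : 0 <= theta * (`|be| * (4 * (4 * eta + B))).
  by rewrite mulr_ge0 ?(ltW theta0)// mulr_ge0// mulr_ge0// addr_ge0// mulr_ge0.
move: pc c0 thG; rewrite -/lv /G /err; lra.
Qed.

End ChainCompare.

Section ChainExists.
Context {R : realType} {H : completeNormedModType R} (dot : {dot H for idfun}).
Hypothesis Hnorm : hilbert_norm dot.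
Variables (A : H -> set H) (Pi : H -> H).
Hypothesis Amax : maximal_monotone dot A.
Hypothesis PiP : gen_projection A Pi.
Variables (m : R -> H) (eta eta' : R).
Hypotheses (eta_gt0 : 0 < eta) (eta'_gt0 : 0 < eta').
Hypothesis m0A : closure (domain A) (m 0).
Implicit Types (r s t W h e T : R) (u v l be w : H).

Local Notation chain := (chain A Pi m eta eta').

(** Inside the block the driver is frozen at m_s: intermediate states lie in the domain, where Pi is
    the identity, so Pi can act only in the last step, whose driver is m_t. The step h is adapted to
    the first increment, and [resolvent_decr] controls the others. *)
Lemma chain_block s t u l W : s < t -> osc_le m eta s t -> chain s u l W ->
  u + l = m s -> exists u' l' W', chain t u' l' W' /\ u' + l' = m t.
Proof.
move=> st ost ch ulm.
have uA := chain_dom PiP m0A ch.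
have [h0 h00 hP] := resolvent_cvg Hnorm Amax uA eta'_gt0.
have ts0 : 0 < t - s by rewrite subr_gt0.
pose N := Num.truncn ((t - s) / h0).
have N1 : 0 < N.+1%:R :> R by rewrite ltr0n.
pose h := (t - s) / N.+1%:R.
have hh0 : h <= h0.
  by rewrite /h ler_pdivrMr// mulrC -ler_pdivrMr//; exact: ltW (truncnS_gt _).
have h_gt0 : 0 < h by exact: divr_gt0.
have step j : (j <= N)%N -> exists u l W, [/\ chain (s + j%:R * h) u l W, u + l = m s &
    forall v be, A v be -> u = v + h *: be -> `|h *: be| <= eta'].
  elim: j => [_|j IH jN].
    exists u, l, W; rewrite mul0r addr0; split => // v be Avb uE.
    by have := hP h v be h_gt0 hh0 Avb uE; rewrite uE addrC addKr.
  have [u1 [l1 [W1 [ch1 ul1 be1]]]] := IH (ltnW jN).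
  have [v [be [Avb uE]]] := resolvent Hnorm Amax u1 h_gt0.
  have dt : s + j.+1%:R * h - (s + j%:R * h) = h by rewrite -natr1; ring.
  have Nh : N.+1%:R * h = t - s by rewrite /h mulrCA mulfV ?mulr1// gt_eqF.
  have jt : s + j.+1%:R * h < t.
    rewrite -ltrBrDl -Nh ltr_pM2r// ltr_nat//.
  have j0 : 0 <= j%:R * h by rewrite mulr_ge0// ltW.
  have jj : s + j%:R * h < s + j.+1%:R * h by rewrite -subr_gt0 dt.
  have PivE : Pi (m s - (l1 + h *: be)) = v.
    have -> : m s - (l1 + h *: be) = v.
      by rewrite -ul1 uE; apply: (eq_dot Hnorm) => ?; rewrite !dotE; ring.
    by case: PiP => _ PiI _; apply: PiI; rewrite inE; apply: subset_closure; exists be.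
  have := @chainS _ _ A Pi m eta eta' _ u1 l1 W1 (s + j.+1%:R * h) v be (m s) ch1 jj Avb.
  cbv zeta; rewrite dt PivE => /(_ uE (be1 _ _ Avb uE)) ch2.
  have {}ch2 := ch2 _ _; eexists; eexists; eexists; split; first apply: ch2.
  - move=> r sr rt; rewrite ul1; apply: ost; first by lra.
    exact: lt_trans rt jt.
  - by rewrite distrC -normrN opprB; apply: ost => //; lra.
  - by rewrite addrC subrK.
  move=> v2 be2 Avb2 vE; have := resolvent_decr Hnorm Amax h_gt0 Avb Avb2 vE => bb.
  apply: le_trans (be1 _ _ Avb uE).
  by rewrite !normrZ ler_wpM2l.
have [u1 [l1 [W1 [ch1 ul1 be1]]]] := step N (leqnn N).
have [v [be [Avb uE]]] := resolvent Hnorm Amax u1 h_gt0.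
have Nh : N.+1%:R * h = t - s by rewrite /h mulrCA mulfV ?mulr1// gt_eqF.
have dt : t - (s + N%:R * h) = h by rewrite opprD addrA -Nh -natr1; ring.
have jt : s + N%:R * h < t by rewrite -subr_gt0 dt.
have N0 : 0 <= N%:R * h by rewrite mulr_ge0// ltW.
have := @chainS _ _ A Pi m eta eta' _ u1 l1 W1 t v be (m t) ch1 jt Avb.
cbv zeta; rewrite dt => /(_ uE (be1 _ _ Avb uE)) ch2.
eexists; eexists; eexists; split; first apply: ch2.
- by move=> r sr rt; rewrite ul1; apply: ost => //; lra.
- by rewrite subrr normr0 ltW.
- by rewrite addrC subrK.
Qed.

Lemma chain_exists T : cadlag m -> 0 <= T -> exists u l W, chain T u l W.
Proof.
move=> mc T0; have [n bl] := cadlag_blocks mc T0 eta_gt0.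
suff H1 s t n' : blocks (osc_le m eta) s t n' ->
    (exists u l W, chain s u l W /\ u + l = m s) ->
    exists u l W, chain t u l W /\ u + l = m t.
  have [|u [l [W [ch _]]]] := H1 _ _ _ bl; last by exists u, l, W.
  by exists (m 0), 0, 0; split; [exact: chain0|rewrite addr0].
elim=> {s t n'} // s t u n' st ost _ IH [u1 [l1 [W1 [ch1 ul1]]]].
exact: IH (chain_block st ost ch1 ul1).
Qed.

End ChainExists.

(** * Convergence along time changes *)

Section Rescaled.
Context {R : realType} {H : completeNormedModType R}.
Implicit Types (y : R -> H) (lam : R -> R) (r s t T e d : R).

Lemma cadlag_rescaling y lam : cadlag y -> rescaling lam ->
  cadlag (y \o lam) /\ forall t, 0 <= t -> left_lim (y \o lam) t = left_lim y (lam t).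
Proof.
move=> yc lamP.
have lft t e : 0 < t -> 0 < e -> exists2 d, 0 < d & forall r, t - d < r -> r < t ->
    `|y (lam r) - left_lim y (lam t)| <= e.
  move=> t0 e0; have lt0 : 0 < lam t by rewrite -(rescaling0 lamP) (rescaling_lt lamP).
  have [d d0 dP] := cadlag_left yc lt0 e0.
  pose s := Num.max 0 (lam t - d).
  have s0 : 0 <= s by rewrite le_max lexx.
  have st : s < lam t by rewrite gt_max lt0; lra.
  have [q q0 qE] := rescaling_surj lamP s0.
  have qt : q < t by apply: (rescaling_lt_inv lamP) => //; [exact: ltW|rewrite qE].
  exists (t - q); first by rewrite subr_gt0.
  move=> r; rewrite opprB addrC subrK => qr rt.
  have := rescaling_lt lamP q0 qr; rewrite qE => sr.
  apply: dP; last by apply: (rescaling_lt lamP) => //; exact: le_trans (ltW qr).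
  by apply: le_lt_trans sr; rewrite le_max lexx orbT.
split.
  apply: cadlag_intro => [t e t0 e0|t t0]; last by exists (left_lim y (lam t)) => e; exact: lft.
  have [d d0 dP] := cadlag_right yc (rescaling_ge0 lamP t0) e0.
  have s0 : 0 <= lam t + d by rewrite addr_ge0 ?(rescaling_ge0 lamP)// ltW.
  have [q q0 qE] := rescaling_surj lamP s0.
  have tq : t < q by apply: (rescaling_lt_inv lamP) => //; rewrite qE; lra.
  exists (q - t); first by rewrite subr_gt0.
  move=> r tr; rewrite addrC subrK => rq; apply: dP; first exact: (rescaling_le lamP).
  by rewrite -qE; apply: (rescaling_lt lamP) => //; exact: le_trans tr.
move=> t; rewrite le_eqVlt => /predU1P[<-|t0].
  by rewrite (rescaling0 lamP) /left_lim ltxx /= (rescaling0 lamP).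
by apply: left_limE => // e; exact: lft.
Qed.

Lemma cadlag_uniform y :
  (forall T e, 0 < e -> exists2 z, cadlag z & forall t, 0 <= t -> t <= T -> `|z t - y t| <= e) ->
  cadlag y.
Proof.
move=> h.
have tri (p q r s : H) e : `|p - r| <= e -> `|q - s| <= e -> `|p - q| <= e -> `|r - s| <= 3 * e.
  move=> h1 h2 h3; have := ler_distD p r s; have := ler_distD q p s.
  by rewrite (distrC r p); lra.
split=> t t0.
  apply/cvgrPdist_le => e e0; have e30 : 0 < e / 3 by lra.
  have [z zc zy] := h (t + 1) _ e30; have [d d0 dP] := cadlag_right zc t0 e30.
  exists (Num.min d 1); first by rewrite /= lt_min d0 ltr01.
  move=> r /=; rewrite lt_min => /andP[rd r1] tr; rewrite distrC.
  rewrite (_ : e = 3 * (e / 3)); last by field.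
  have tr0 : t - r < 0 by rewrite subr_lt0.
  rewrite (ltr0_norm tr0) in rd r1.
  apply: (tri (z r) (z t)); [apply: zy; lra|apply: zy; lra|].
  by apply: dP; [exact: ltW|lra].
apply/cauchy_cvgP/cauchy_exP => e e0; have e40 : 0 < e / 4 by lra.
have [z zc zy] := h t _ e40; have [d d0 [_ dP]] := cadlag_osc zc (ltW t0) e40.
pose q := Num.max (t / 2) (t - d / 2).
have q0 : 0 <= q by rewrite le_max divr_ge0// ltW.
have qt : q < t by rewrite gt_max; apply/andP; split; lra.
have qd : t - d < q by rewrite lt_max; apply/orP; right; lra.
exists (y q); exists (t - q); first by rewrite /= subr_gt0.
move=> r /=; rewrite /= => rq rt; rewrite -ball_normE /=.
move: rq; rewrite gtr0_norm ?subr_gt0// => rq.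
apply: (@le_lt_trans _ _ (3 * (e / 4))); last by lra.
apply: (tri (z q) (z r)); [apply: zy; lra|apply: zy; lra|].
by apply: dP; lra.
Qed.

Lemma psum_unif y z p a e : 0 <= e -> (forall t, t \in a :: p -> `|z t - y t| <= e) ->
  psum y a p <= psum z a p + 2 * e * (size p)%:R.
Proof.
move=> e0; elim: p a => [|c p IH] a h /=; first by rewrite mulr0 addr0.
have h1 := IH c (fun t tp => h t (mem_behead (s := a :: c :: p) tp)).
have za := h a (mem_head _ _); have zc : `|z c - y c| <= e by apply: h; rewrite !inE eqxx orbT.
have := ler_distD (z c) (y c) (y a); have := ler_distD (z a) (z c) (y a).
rewrite (distrC (y c) (z c)) => h2 h3.
have E : (size p).+1%:R = (size p)%:R + 1 :> R by rewrite natr1.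
by rewrite E; lra.
Qed.

Lemma blocks_rescaling (m m' : R -> H) lam e d T s t n :
  blocks (osc_le m e) s t n -> rescaling lam ->
  (forall r, 0 <= r -> r <= T -> `|m' (lam r) - m r| <= d) -> 0 <= s -> t <= T ->
  blocks (osc_le m' (e + 2 * d)) (lam s) (lam t) n.
Proof.
move=> + lamP mm; elim=> {s t n} [t|s t u n st ost tu IH] s0 uT; first exact: blocks_nil.
have t0 := le_trans s0 (ltW st); have tT := le_trans (blocks_le tu) uT.
apply: blocks_cons (IH t0 uT); first exact: (rescaling_lt lamP).
have ls0 := rescaling_ge0 lamP s0.
move=> r sr rt; have r0 := le_trans ls0 sr.
have [q q0 qE] := rescaling_surj lamP r0.
have sq : s <= q by apply: (rescaling_le_inv lamP) => //; rewrite qE.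
have qt : q < t by apply: (rescaling_lt_inv lamP) => //; rewrite qE.
have := mm q q0 (le_trans (ltW qt) tT); rewrite qE => h1.
have := mm s s0 (le_trans (ltW st) tT) => h2.
have := ost q sq qt => h3.
have := ler_distD (m q) (m' r) (m' (lam s)); have := ler_distD (m s) (m q) (m' (lam s)).
by rewrite (distrC (m s) (m' _)); lra.
Qed.

End Rescaled.

(** * Compactness and the limit pair *)

Section Limit.
Context {R : realType} {H : completeNormedModType R} (dot : {dot H for idfun}).
Hypothesis Hnorm : hilbert_norm dot.
Variables (A : H -> set H) (Pi : H -> H).
Hypothesis Amax : maximal_monotone dot A.
Hypothesis PiP : gen_projection A Pi.
Hypothesis Aint : (domain A)° !=set0.
Variable m : R -> H.
Hypotheses (mc : cadlag m) (m0A : closure (domain A) (m 0)).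
Variables (m_ x_ k_ : nat -> R -> H) (lam : nat -> R -> R).
Hypothesis sol : forall n, (0 < n)%N -> SP dot A Pi (m_ n) (x_ n) (k_ n).
Hypothesis lamP : forall n, rescaling (lam n).
Hypothesis lam_id : forall e : R, 0 < e -> exists N, forall n, (N <= n)%N ->
  forall t, 0 <= t -> `|lam n t - t| <= e.
Hypothesis m_cvg : forall T e : R, 0 < e -> exists N, forall n, (N <= n)%N ->
  forall t, 0 <= t -> t <= T -> `|m_ n (lam n t) - m t| <= e.
Implicit Types (r s t T e : R) (n p : nat).

Lemma interior_ball : exists a r0 mu, [/\ 0 < r0, closed_ball a r0 `<=` closure (domain A) &
  forall u w, closed_ball a r0 u -> A u w -> `|w| <= mu].
Proof.
have [a aA] := Aint; have [r [mu [r0 rD rmu]]] := locally_bounded Hnorm Amax aA.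
exists a, r, mu; split => // [u /closed_ballP|u w /closed_ballP]; first by move=> /(_ r0) /rD /subset_closure.
by move=> /(_ r0) /rmu; exact.
Qed.

(** [apriori] for each m_n on [0, lam n T], a subset of [0, T + 1]. Time changes carry the blocks of
    m to as many blocks of m_n, with oscillation at most r0 / 4 + 2 r0 / 8 = r0 / 2. *)
Lemma uniform_bounds T : 0 <= T -> exists B Bx N, [/\ 0 <= B, 0 <= Bx & forall n, (N <= n)%N ->
  [/\ (0 < n)%N, Vr 0 (lam n T) (k_ n) <= B & forall r, 0 <= r -> r <= lam n T -> `|x_ n r| <= Bx]].
Proof.
move=> T0; have [a [r0 [mu [r0_gt0 ballA ball_mu]]]] := interior_ball.
have mu0 := ball_mu_ge0 r0_gt0 ballA ball_mu.
have [Mb Mb0 mM] := cadlag_bounded T mc.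
have e0 : 0 < r0 / 4 by rewrite divr_gt0.
have [nb bl] := cadlag_blocks mc T0 e0.
have d0 : 0 < Num.min (r0 / 8) 1 by rewrite lt_min divr_gt0 ?ltr01.
have d1 : Num.min (r0 / 8) 1 <= r0 / 8 by rewrite ge_min lexx.
have d2 : Num.min (r0 / 8) 1 <= 1 by rewrite ge_min lexx orbT.
have [N1 mN] := m_cvg T d0; have [N2 lN] := lam_id ltr01.
pose Bm := Mb + 1 + `|a| + r0.
pose p := 6 * nb%:R * Bm + mu * (T + 1).
pose q := mu * (T + 1) * Bm.
pose K := 2 * p + 2 * q + 1.
have Bm0 : 0 <= Bm by rewrite /Bm !addr_ge0// ltW.
have p0 : 0 <= p by rewrite /p addr_ge0// mulr_ge0// ?mulr_ge0// addr_ge0.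
have q0 : 0 <= q by rewrite /q mulr_ge0// mulr_ge0// addr_ge0.
have K0 : 0 <= K by rewrite /K; lra.
exists (2 / r0 * (p * K + q)), (Mb + 1 + K), (maxn 1 (maxn N1 N2)); split.
- by rewrite mulr_ge0 ?divr_ge0 ?(ltW r0_gt0)// addr_ge0// mulr_ge0.
- by rewrite addr_ge0// addr_ge0.
move=> n; rewrite !geq_max => /andP[n0 /andP[nN1 nN2]].
have lT0 := rescaling_ge0 (lamP n) T0.
have lT1 : lam n T <= T + 1.
  by have := lN n nN2 T T0; rewrite ler_norml => /andP[_]; lra.
have mn r : 0 <= r -> r <= lam n T -> `|m_ n r| <= Mb + 1.
  move=> r_ge0 rT; have [s s0 sE] := rescaling_surj (lamP n) r_ge0.
  have sT : s <= T by apply: (rescaling_le_inv (lamP n)) => //; rewrite sE.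
  have := mN n nN1 s s0 sT; rewrite sE => h.
  have -> : m_ n r = m s + (m_ n r - m s) by rewrite [RHS]addrC subrK.
  by apply: le_trans (ler_normD _ _) _; have := mM s s0 sT; lra.
have bln : blocks (osc_le (m_ n) (r0 / 2)) 0 (lam n T) nb.
  have := blocks_rescaling bl (lamP n) (mN n nN1) (lexx 0) (lexx T).
  rewrite (rescaling0 (lamP n)).
  suff sub s t j : blocks (osc_le (m_ n) (r0 / 4 + 2 * Num.min (r0 / 8) 1)) s t j ->
      blocks (osc_le (m_ n) (r0 / 2)) s t j by exact: sub.
  elim=> {s t j} [t|s t u j st o _ IH]; first exact: blocks_nil.
  by apply: blocks_cons IH => // r sr rt; apply: le_trans (o r sr rt) _; lra.
have [kK VK] := apriori Hnorm r0_gt0 ballA ball_mu PiP (sol n0) lT0 bln mn.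
pose p' := 6 * nb%:R * Bm + mu * lam n T.
pose q' := mu * lam n T * Bm.
pose K' := 2 * p' + 2 * q' + 1.
have muT : mu * lam n T <= mu * (T + 1) by rewrite ler_wpM2l.
have p'0 : 0 <= p' by rewrite /p' addr_ge0// mulr_ge0// mulr_ge0.
have pp : p' <= p by rewrite /p' /p lerD2l.
have qq : q' <= q by rewrite /q' /q ler_wpM2r.
have q'0 : 0 <= q' by rewrite /q' mulr_ge0// mulr_ge0.
have KK : K' <= K by rewrite /K' /K; lra.
split => //.
  apply: le_trans VK _; rewrite ler_wpM2l ?divr_ge0 ?(ltW r0_gt0)//.
  by apply: lerD qq; apply: ler_pM => //; rewrite -/K' /K'; lra.
move=> r r_ge0 rT; rewrite (_ : x_ n r = m_ n r - k_ n r); last first.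
  by rewrite -(SP_xk (sol n0))// addrK.
apply: le_trans (ler_normB _ _) _; apply: lerD; first exact: mn.
exact: le_trans (kK r r_ge0 rT) KK.
Qed.

(** [G] collects the error of [chain_compare] for eta' = eta <= 1, so that eta G is at most half of
    (e / 2)^2; the other half is the slack for the change of clock. Both paths are then e / 2-close
    to one state of one scheme. *)
Lemma k_cauchy T e : 0 <= T -> 0 < e -> exists N, forall n p, (N <= n)%N -> (N <= p)%N ->
  forall t, 0 <= t -> t <= T -> `|k_ n (lam n t) - k_ p (lam p t)| <= e.
Proof.
move=> T0 e0; have [a [r0 [mu [r0_gt0 ballA ball_mu]]]] := interior_ball.
have mu0 := ball_mu_ge0 r0_gt0 ballA ball_mu.
have [Mb Mb0 mM] := cadlag_bounded T mc.
have e40 : 0 < r0 / 4 by rewrite divr_gt0.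
have [nb bl] := cadlag_blocks mc T0 e40.
have [b [cen [bP bmon cenM]]] := block_index bl (ltW e40) mM.
have [B [Bx [N0 [B0 Bx0 N0P]]]] := uniform_bounds T0.
pose M1 := Mb + `|a|.
have cenM1 i : `|cen i - a| <= M1.
  by apply: le_trans (ler_normB _ _) _; rewrite lerD2r.
pose Wm := 2 / r0 * (6 ^+ nb * expR (4 * mu * T) * (2 * M1 ^+ 2 + (M1 + 2 * r0 + 2))).
have M10 : 0 <= M1 by rewrite addr_ge0.
have Wm0 : 0 <= Wm.
  rewrite /Wm !mulr_ge0 ?invr_ge0 ?(ltW r0_gt0) ?expR_ge0 ?exprn_ge0//.
  by rewrite !addr_ge0 ?mulr_ge0 ?sqr_ge0// ltW.
pose G := 12 * Wm + 10 * B + 4 * (1 + (Bx + Mb + 1 + Wm)).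
have G0 : 0 < G by rewrite /G; lra.
pose eta := Num.min (Num.min 1 (r0 / 4)) ((e / 2) ^+ 2 / 2 / G).
have e2 : 0 < (e / 2) ^+ 2 / 2 by rewrite divr_gt0// exprn_gt0// divr_gt0.
have eta0 : 0 < eta by rewrite !lt_min ltr01 e40 divr_gt0.
have eta1 : eta <= 1 by rewrite !ge_min lexx.
have etar : eta <= r0 / 4 by rewrite !ge_min lexx orbT.
have etaG : eta * G <= (e / 2) ^+ 2 / 2.
  by rewrite -ler_pdivlMr// !ge_min lexx orbT.
have chW t u l W : chain A Pi m eta eta t u l W -> t <= T -> W <= Wm.
  move=> ch tT.
  have := chain_bound Hnorm Amax PiP r0_gt0 ballA ball_mu bP bmon cenM1 etar eta1 ch tT.
  by rewrite /Wm -ler_pdivlMl ?divr_gt0// invf_div.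
have [u [l [W ch]]] := chain_exists Hnorm Amax PiP eta0 eta0 m0A mc T0.
have [theta theta0 [_ cov]] := chain_compare Hnorm PiP (ltW eta0) (ltW eta0)
  B0 Bx0 mM chW ch (lexx T) e2.
have [N1 mN] := m_cvg T eta0; have [N2 lN] := lam_id theta0.
have near n : (maxn N0 (maxn N1 N2) <= n)%N ->
    near_solution dot A Pi m eta T B Bx theta (m_ n) (x_ n) (k_ n) (lam n).
  rewrite !geq_max => /andP[nN0 /andP[nN1 nN2]]; have [n0 VB xB] := N0P n nN0.
  split => //; [exact: sol|exact: mN|].
  by move=> t t0 _; exact: lN.
exists (maxn N0 (maxn N1 N2)) => n p /near sn /near sp t t0 tT.
have [w wP] := cov t t0 tT.
have half j : near_solution dot A Pi m eta T B Bx theta (m_ j) (x_ j) (k_ j) (lam j) ->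
    `|k_ j (lam j t) - w| <= e / 2.
  move=> /wP h; rewrite -(@ler_pXn2r _ 2) ?nnegrE ?divr_ge0 ?(ltW e0)//.
  apply: le_trans h _; have := mulr_ge0 (ltW eta0) Bx0; have := mulr_ge0 (ltW eta0) Wm0.
  have : eta * eta <= eta * 1 by rewrite ler_wpM2l// ltW.
  by move: etaG; rewrite /G; lra.
have := ler_distD w (k_ n (lam n t)) (k_ p (lam p t)); rewrite (distrC w).
by have := half n sn; have := half p sp; lra.
Qed.

Definition k_lim t : H := limn (fun n => k_ n (lam n t)).

Lemma k_lim_cvg T e : 0 <= T -> 0 < e -> exists N, forall n, (N <= n)%N ->
  forall t, 0 <= t -> t <= T -> `|k_ n (lam n t) - k_lim t| <= e.
Proof.
move=> T0 e0; have e20 : 0 < e / 2 by lra.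
have [N NP] := k_cauchy T0 e20; exists N => n Nn t t0 tT.
have cv : cvgn (fun n => k_ n (lam n t)).
  apply: cauchy_seq_cvg => e' e'0; have [N' N'P] := k_cauchy t0 e'0.
  by exists N' => p N'p; exact: N'P.
have /cvgrPdist_le/(_ _ e20)[N' _ N'P] : k_ n (lam n t) @[n --> \oo] --> k_lim t by exact: cv.
have /= := N'P (maxn N N') (leq_maxr _ _); have := NP n (maxn N N') Nn (leq_maxl _ _) t t0 tT.
have := ler_distD (k_ (maxn N N') (lam (maxn N N') t)) (k_ n (lam n t)) (k_lim t).
by rewrite (distrC (k_lim t)); lra.
Qed.

Definition x_lim t : H := m t - k_lim t.

Lemma x_lim_cvg T e : 0 <= T -> 0 < e -> exists N, forall n, (N <= n)%N ->
  forall t, 0 <= t -> t <= T -> `|x_ n (lam n t) - x_lim t| <= e.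
Proof.
move=> T0 e0; have e20 : 0 < e / 2 by lra.
have [N1 h1] := k_lim_cvg T0 e20; have [N2 h2] := m_cvg T e20.
exists (maxn 1 (maxn N1 N2)) => n; rewrite !geq_max => /andP[n0 /andP[nN1 nN2]] t t0 tT.
have lt0 := rescaling_ge0 (lamP n) t0.
have -> : x_ n (lam n t) - x_lim t =
    (m_ n (lam n t) - m t) - (k_ n (lam n t) - k_lim t).
  by rewrite /x_lim -(SP_xk (sol n0))//; apply: (eq_dot Hnorm) => ?; rewrite !dotE; ring.
apply: le_trans (ler_normB _ _) _.
by have := h1 n nN1 t t0 tT; have := h2 n nN2 t t0 tT; lra.
Qed.

Lemma k_lim_cadlag : cadlag k_lim.
Proof.
apply: cadlag_uniform => T e e0.
have [T0|T0] := leP 0 T; last first.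
  have [N _] := k_lim_cvg (lexx 0) e0; exists (fun=> 0); last by move=> t t0; lra.
  apply: cadlag_intro => [t d t0 d0|t t0]; first by exists 1 => // r _ _; rewrite subrr normr0 ltW.
  by exists 0 => d d0; exists 1 => // r _ _; rewrite subrr normr0 ltW.
have [N NP] := k_lim_cvg T0 e0; exists (k_ N.+1 \o lam N.+1); last exact: NP.
by have [] := cadlag_rescaling (SP_cadlag_k (sol (ltn0Sn N))) (lamP N.+1).
Qed.

Lemma x_lim_cadlag : cadlag x_lim.
Proof.
apply: (@cadlagD _ _ m (fun t => - k_lim t)) => //.
apply: cadlag_intro => [t e t0 e0|t t0].
  have [d d0 dP] := cadlag_right k_lim_cadlag t0 e0; exists d => // r tr rd.
  by rewrite -opprD normrN; exact: dP.
exists (- left_lim k_lim t) => e e0.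
have [d d0 dP] := cadlag_left k_lim_cadlag t0 e0; exists d => // r dr rt.
by rewrite -opprD normrN; exact: dP.
Qed.

Lemma k_lim_left T e : 0 <= T -> 0 < e -> exists N, forall n, (N <= n)%N ->
  forall t, 0 <= t -> t <= T -> `|left_lim (k_ n) (lam n t) - left_lim k_lim t| <= e.
Proof.
move=> T0 e0; have [N NP] := k_lim_cvg T0 e0.
exists (maxn 1 N) => n; rewrite geq_max => /andP[n0 nN] t t0 tT.
have [kc kl] := cadlag_rescaling (SP_cadlag_k (sol n0)) (lamP n).
rewrite -kl//; apply: (left_lim_near kc k_lim_cadlag t0) => d d0.
move: (t0); rewrite le_eqVlt => /predU1P[t0'|t_gt0].
  exists t; split => //; [lra|by rewrite -t0' ltxx|exact: NP].
exists (Num.max 0 (t - d / 2)); split.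
- by rewrite le_max lexx.
- by rewrite lt_max; apply/orP; right; lra.
- by rewrite ge_max t0; lra.
- by move=> _; rewrite gt_max t_gt0; lra.
- apply: NP => //; first by rewrite le_max lexx.
  by rewrite ge_max T0; lra.
Qed.

Lemma k_lim_bv : BV_loc k_lim.
Proof.
move=> T T0; have [B [Bx [N0 [B0 Bx0 N0P]]]] := uniform_bounds T0.
apply: le_lt_trans (ltry B); rewrite VarE; apply: ge_ereal_sup => _ [p pP <-].
rewrite lee_fin; apply/ler_addgt0Pr => e e0.
have p0 : 0 < 2 * ((size p)%:R + 1) :> R by rewrite mulr_gt0// ltr_wpDl.
have [N NP] := k_lim_cvg T0 (divr_gt0 e0 p0).
set e' := e / _ in NP; have e'0 : 0 < e' by rewrite divr_gt0.
pose n := maxn N0 N; have [n0 VB _] := N0P n (leq_maxl _ _).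
have kbv := BVfin (SP_bv (sol n0)).
have h2 : psum (k_ n \o lam n) 0 p <= B.
  apply: le_trans VB; rewrite -lee_fin; apply: le_trans (psum_le_Var _ pP) _.
  pose psi t := Vr 0 (lam n t) (k_ n).
  have psi0 : psi 0 = 0 by rewrite /psi (rescaling0 (lamP n)) (Vr_xx (kbv 0)).
  rewrite (_ : Vr _ _ _ = psi T - psi 0); last by rewrite psi0 subr0.
  apply: Var_le_psi => u v u0 uv vT.
  have lu0 := rescaling_ge0 (lamP n) u0; have luv := rescaling_le (lamP n) u0 uv.
  have := Vr_ge (kbv _) lu0 luv (lexx _).
  by rewrite /psi (VrD (kbv _) (lexx 0) lu0 luv (lexx _)) /=; lra.
have h1 : psum k_lim 0 p <= psum (k_ n \o lam n) 0 p + 2 * e' * (size p)%:R.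
  apply: psum_unif (ltW e'0) _ => t /(itv_partition_in pP)/andP[t0 tT].
  by apply: NP => //; exact: leq_maxr.
apply: le_trans h1 _; apply: lerD h2 _.
apply: (@le_trans _ _ (e' * (2 * ((size p)%:R + 1)))); first by nra.
by rewrite /e' divfK ?gt_eqF.
Qed.

(** The clauses of [SP] that pass to pointwise limits, including the projection relation, because
    left limits converge as well. The differential inclusion is treated separately. *)
Lemma k_lim_SP : [/\ cadlag x_lim /\ cadlag k_lim,
  forall t, 0 <= t -> closure (domain A) (x_lim t),
  BV_loc k_lim /\ k_lim 0 = 0,
  forall t, 0 <= t -> x_lim t + k_lim t = m t &
  forall t, 0 <= t -> x_lim t = Pi (left_lim x_lim t + jump m t)].
Proof.
split.
- by split; [exact: x_lim_cadlag|exact: k_lim_cadlag].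
- move=> t t0; apply/closure_normP => e e0.
  have e20 : 0 < e / 2 by lra.
  have [N NP] := x_lim_cvg t0 e20; have n1 := ltn0Sn N.
  have /closure_normP/(_ _ e20)[y yA xy] := SP_dom (sol n1) (rescaling_ge0 (lamP N.+1) t0).
  exists y => //; have := NP N.+1 (leqnSn N) t t0 (lexx t).
  have := ler_distD (x_ N.+1 (lam N.+1 t)) (x_lim t) y.
  by rewrite (distrC (x_lim t) (x_ _ _)); lra.
- split; first exact: k_lim_bv.
  apply/eqP; rewrite -normr_le0; apply/ler_addgt0Pr => e e0; rewrite add0r.
  have [N NP] := k_lim_cvg (lexx 0) e0.
  have := NP N.+1 (leqnSn N) 0 (lexx 0) (lexx 0).
  by rewrite (rescaling0 (lamP N.+1)) (SP_k0 (sol (ltn0Sn N))) sub0r normrN.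
- by move=> t t0; rewrite /x_lim subrK.
move=> t t0; have xk r : 0 <= r -> x_lim r + k_lim r = m r by rewrite /x_lim subrK.
have -> : left_lim x_lim t + jump m t = m t - left_lim k_lim t.
  rewrite /jump (left_limD xk x_lim_cadlag k_lim_cadlag t0).
  by apply: (eq_dot Hnorm) => ?; rewrite !dotE; ring.
apply/eqP; rewrite -subr_eq0 -normr_le0; apply/ler_addgt0Pr => e e0; rewrite add0r.
have e30 : 0 < e / 3 by lra.
have [N1 h1] := x_lim_cvg t0 e30; have [N2 h2] := k_lim_left t0 e30.
have [N3 h3] := m_cvg t e30.
pose n := (maxn N1 (maxn N2 N3)).+1; have n0 : (0 < n)%N by [].
have nN1 : (N1 <= n)%N by rewrite leqW// leq_maxl.
have nN2 : (N2 <= n)%N by rewrite leqW// !leq_max leqnn orbT.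
have nN3 : (N3 <= n)%N by rewrite leqW// !leq_max leqnn !orbT.
have := h1 n nN1 t t0 (lexx t); have := h2 n nN2 t t0 (lexx t).
have := h3 n nN3 t t0 (lexx t).
rewrite (SP_Pi Hnorm (sol n0) (rescaling_ge0 (lamP n) t0)).
set q := m_ n (lam n t) - left_lim _ _; set q' := m t - left_lim _ _ => a3 a2 a1.
have qq : `|q - q'| <= 2 * (e / 3).
  have -> : q - q' = (m_ n (lam n t) - m t) - (left_lim (k_ n) (lam n t) - left_lim k_lim t).
    by apply: (eq_dot Hnorm) => ?; rewrite /q /q' !dotE; ring.
  by apply: le_trans (ler_normB _ _) _; lra.
have [_ _ /(_ q q') PiL] := PiP.
have := ler_distD (Pi q) (x_lim t) (Pi q'); rewrite (distrC (x_lim t) (Pi q)); lra.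
Qed.

End Limit.

(** * Polar decomposition of a vector measure *)

Section Cells.
Context {R : realType}.
Implicit Types (r c : R) (n p i : nat) (z : int).

Lemma measurable_by_cells (cell : R -> int) d (T : measurableType d) (G : int -> R -> T) :
  (forall z, measurable (cell @^-1` [set z] : set (measurableTypeR R))) ->
  (forall z, measurable_fun (setT : set (measurableTypeR R)) (G z)) ->
  measurable_fun (setT : set (measurableTypeR R)) (fun r => G (cell r) r).
Proof.
move=> mcell mG _ Y mY; rewrite setTI.
have -> : (fun r => G (cell r) r) @^-1` Y =
    \bigcup_(z : int) (cell @^-1` [set z] `&` (G z @^-1` Y)).
  apply/seteqP; split=> r /=; first by exists (cell r).
  by move=> [z _ [/= ->]].
apply: countable_bigcupT_measurable => // z; apply: measurableI; first exact: mcell.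
by rewrite -[X in measurable X]setTI; exact: mG.
Qed.

(** Dyadic cells open on the left, obtained from [ceil], match the intervals ]s, t] of the Stieltjes
    integrals. *)
Definition cell n r : int := Num.ceil (r * 2 ^+ n).
Definition grid n i : R := i%:R / 2 ^+ n.

Let pow2_gt0 n : 0 < 2 ^+ n :> R. Proof. exact: exprn_gt0. Qed.

Lemma cellP n r z : cell n r = z <-> (z - 1)%:~R / 2 ^+ n < r <= z%:~R / 2 ^+ n.
Proof.
rewrite ltr_pdivrMr// ler_pdivlMr//; split=> [<-|]; first exact: ceil_itv.
exact: ceil_def.
Qed.

Lemma cell_gridP n i r : grid n i < r <= grid n i.+1 <-> cell n r = i.+1%:Z.
Proof. by rewrite cellP -addn1 PoszD addrK. Qed.

Lemma measurable_cell n z : measurable (cell n @^-1` [set z] : set (measurableTypeR R)).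
Proof.
have -> : cell n @^-1` [set z] = `](z - 1)%:~R / 2 ^+ n, z%:~R / 2 ^+ n]%classic.
  by apply/seteqP; split=> r /=; rewrite in_itv /= cellP.
exact: measurable_itv.
Qed.

Lemma gridS n i : grid n.+1 (i * 2) = grid n i.
Proof. by rewrite /grid exprS natrM; field; rewrite gt_eqF. Qed.

Lemma grid_le n i j : (i <= j)%N -> grid n i <= grid n j.
Proof. by move=> ij; rewrite /grid ler_pM2r ?invr_gt0// ler_nat. Qed.

Lemma grid_lt n i j : (i < j)%N -> grid n i < grid n j.
Proof. by move=> ij; rewrite /grid ltr_pM2r ?invr_gt0// ltr_nat. Qed.

Lemma grid_ge0 n i : 0 <= grid n i.
Proof. by rewrite /grid divr_ge0// ltW. Qed.

Lemma cell_refine n p i r : (n <= p)%N -> grid p i < r -> r <= grid p i.+1 ->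
  cell n r = cell n (grid p i.+1).
Proof.
move=> np; rewrite -(subnK np); elim: (p - n)%N i r => [|k IH] i r.
  rewrite add0n => ir ri.
  have -> : cell n r = i.+1%:Z by apply/cell_gridP; rewrite ir.
  by apply/esym/cell_gridP; rewrite lexx grid_lt.
rewrite addSn => ir ri; have e : i = ((i./2) * 2 + odd i)%N by rewrite muln2 addnC odd_double_half.
have ge1 : grid (k + n) i./2 <= grid (k + n).+1 i by rewrite -(gridS _ i./2); apply: grid_le; rewrite {2}e leq_addr.
have le1 : grid (k + n).+1 i.+1 <= grid (k + n) (i./2).+1.
  rewrite -(gridS _ (i./2).+1); apply: grid_le; rewrite {1}e; case: (odd i); rewrite ?addn1 ?addn0 mulSn; lia.
rewrite (IH (i./2) r); [|exact: le_lt_trans ge1 ir|exact: le_trans ri le1].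
rewrite (IH (i./2) (grid (k + n).+1 i.+1))//.
by apply: le_lt_trans ge1 _; rewrite grid_lt.
Qed.

Lemma big_nat_pairs (M : nmodType) (F : nat -> M) m :
  \sum_(0 <= i < m * 2) F i = \sum_(0 <= i < m) (F (i * 2)%N + F (i * 2).+1).
Proof.
elim: m => [|m IH]; first by rewrite mul0n !big_nil.
by rewrite mulSn !addSn add0n !big_nat_recr//= IH addrA.
Qed.

End Cells.

Section StepIntegral.
Context {R : realType} (V : cumulative R R).
Local Notation mu := (lebesgue_stieltjes_measure V).

Lemma LS_step (f : R -> R) p M B :
  measurable_fun (setT : set (measurableTypeR R)) f -> (forall r, `|f r| <= B) ->
  (forall i r, grid p i < r -> r <= grid p i.+1 -> f r = f (grid p i.+1)) ->
  (\int[mu]_(r in `](0 : R), grid p M]) f r)%R =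
  \sum_(0 <= i < M) f (grid p i.+1) * (V (grid p i.+1) - V (grid p i)).
Proof.
move=> mf fB fstep; have int s t : s <= t -> mu.-integrable `]s, t] (EFin \o f).
  move=> st; apply: (@integrable_LS _ _ _ _ _ B) => //.
  exact: (@measurable_funS _ _ _ _ setT).
elim: M => [|M IH].
  by rewrite big_nil /grid mul0r set_itvoc0 Rintegral_set0.
rewrite big_nat_recr//= -IH (LS_add (grid_ge0 _ _) (grid_le _ (leqnSn M)) (int _ _ (grid_ge0 _ _))).
congr (_ + _); have MM := @grid_le R p _ _ (leqnSn M).
rewrite -[X in _ * (X - _)]/(V _) -[RHS](_ : (\int[mu]_(r in `]grid p M, grid p M.+1]) f (grid p M.+1))%R = _).
  by apply: eq_Rintegral => r; rewrite inE /= in_itv /= => /andP[r1 r2]; exact: fstep.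
by rewrite Rintegral_cst// [X in fine X](LS_itv V MM).
Qed.

End StepIntegral.

Section Summable.
Context {R : realType}.

Lemma cvgn_summable (E : completeNormedModType R) (z : nat -> E) :
  (\sum_(0 <= j <oo) (`|z j.+1 - z j|)%:E < +oo)%E -> cvgn z.
Proof.
move=> fin; apply: cauchy_seq_cvg => e e0.
have ge0 j : true -> (0 <= (`|z j.+1 - z j|)%:E)%E by rewrite lee_fin.
have /fine_cvgP[_ /cvgrPdist_lt/(_ _ e0)[N1 _ N1P]] := nneseries_tail_cvg fin ge0.
have /fine_cvgP[[N2 _ N2P] _] := nneseries_tail_cvg fin ge0.
exists (maxn N1 N2) => n; set N := maxn _ _ => Nn.
have fn : (\sum_(N <= j <oo) (`|z j.+1 - z j|)%:E)%E \is a fin_num by apply: N2P => /=; exact: leq_maxr.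
have := N1P N (leq_maxl _ _); rewrite /= sub0r normrN => small.
have le : (\sum_(N <= j < n) `|z j.+1 - z j|) <= fine (\sum_(N <= j <oo) (`|z j.+1 - z j|)%:E)%E.
  rewrite -lee_fin fineK// -sumEFin; exact: (@nneseries_lim_ge R (fun j => (`|z j.+1 - z j|)%:E) xpredT N n).
rewrite distrC -(telescope_sumr z Nn); apply: le_trans (ler_norm_sum _ _ _) _.
by apply: le_trans le (le_trans (ler_norm _) (ltW small)).
Qed.

(** The integrals sum to at most C, so the sum of the functions is integrable, hence finite almost
    everywhere. *)
Lemma summable_ae (V : cumulative R R) (f : nat -> R -> R) C s t :
  (forall j r, 0 <= f j r) ->
  (forall j, measurable_fun (setT : set (measurableTypeR R)) (f j)) ->
  (forall j, (\int[lebesgue_stieltjes_measure V]_(r in `]s, t]) (f j r)%:E <= (C / (2 ^ j.+1)%:R)%:E)%E) ->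
  {ae lebesgue_stieltjes_measure V, forall r : measurableTypeR R, `]s, t]%classic r ->
     (\sum_(0 <= j <oo) (f j r)%:E < +oo)%E}.
Proof.
move=> f0 mf fC.
have C0 : 0 <= C.
  have := le_trans (integral_ge0 (lebesgue_stieltjes_measure V) (D := `]s, t]) (f := fun r => (f 0%N r)%:E) _) (fC 0%N).
  by rewrite lee_fin pmulr_lge0 ?invr_gt0 ?ltr0n//; apply=> r _; rewrite lee_fin.
pose g (r : measurableTypeR R) : \bar R := (\sum_(0 <= j <oo) (f j r)%:E)%E.
have mg : measurable_fun (`]s, t] : set (measurableTypeR R)) g.
  apply: ge0_emeasurable_sum => [k x _ _|k _]; first by rewrite lee_fin.
  by apply/measurable_EFinP; exact: (@measurable_funS _ _ _ _ setT).
have g0 r : (0 <= g r)%E by apply: nneseries_ge0 => n _ _; rewrite lee_fin.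
have gi : (lebesgue_stieltjes_measure V).-integrable `]s, t] g.
  apply/integrableP; split => //.
  under eq_integral => r _ do rewrite gee0_abs//.
  rewrite /g integral_nneseries => //; first last.
  - by move=> n r _; rewrite lee_fin.
  - by move=> n; apply/measurable_EFinP; exact: (@measurable_funS _ _ _ _ setT).
  apply: le_lt_trans (ltry C); apply: le_trans _ (epsilon_trick0 xpredT C0).
  by apply: lee_nneseries => [i _ _|n _]; [apply: integral_ge0 => r _; rewrite lee_fin|exact: fC].
have mI : measurable (`]s, t]%classic : set (measurableTypeR R)) by exact: measurable_itv.
have := integrable_ae mI gi.
by apply: filterS => r rP rst; have := rP rst; rewrite fin_numE => /andP[_]; rewrite -ltey.
Qed.

End Summable.

Section Polar.
Context {R : realType} {H : completeNormedModType R} (dot : {dot H for idfun}).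
Hypothesis Hnorm : hilbert_norm dot.
Variables (V : cumulative R R) (l : R -> H).
Hypothesis lV : forall s t : R, 0 <= s -> s <= t -> `|l t - l s| <= V t - V s.
Local Notation mu := (lebesgue_stieltjes_measure V).
Implicit Types (n p q i M N : nat) (r s t : R) (e : H).

Definition dl n i : H := l (grid n i.+1) - l (grid n i).
Definition dV n i : R := V (grid n i.+1) - V (grid n i).

(** Difference quotient of l against V on a dyadic cell, 0 to the left of 0. Where V has no
    increment the inverse is 0, and l has no increment either, so [dV_slope] holds in all cases. *)
Definition slope n (z : int) : H :=
  if z is Posz i.+1 then (dV n i)^-1 *: dl n i else 0.
Definition density n r : H := slope n (cell n r).

Lemma dl_le n i : `|dl n i| <= dV n i.
Proof. by apply: lV; [exact: grid_ge0|exact: grid_le]. Qed.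

Lemma dV_slope n i : dV n i *: slope n i.+1%:Z = dl n i.
Proof.
rewrite /= scalerA; have [d0|d0] := eqVneq (dV n i) 0; last by rewrite mulfV// scale1r.
have := dl_le n i; rewrite d0 normr_le0 => /eqP ->; exact: scaler0.
Qed.

Lemma slope_le1 n z : `|slope n z| <= 1.
Proof.
case: z => [[|i]|i] /=; rewrite ?normr0 ?ler01//.
have dV0 : 0 <= dV n i := le_trans (normr_ge0 _) (dl_le n i).
rewrite normrZ ger0_norm ?invr_ge0// mulrC.
have [d0|d0] := eqVneq (dV n i) 0; first by rewrite d0 invr0 mulr0 ler01.
by rewrite ler_pdivrMr ?mul1r ?dl_le// lt_def d0.
Qed.

Lemma density_le1 n r : `|density n r| <= 1. Proof. exact: slope_le1. Qed.

Lemma measurable_density_dot n (g : R -> H) :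
  (forall e, measurable_fun (setT : set (measurableTypeR R)) (fun r => dot e (g r))) ->
  measurable_fun (setT : set (measurableTypeR R)) (fun r => dot (density n r) (g r)).
Proof.
move=> mg; apply: (measurable_by_cells (cell := cell n) (G := fun z r => dot (slope n z) (g r))) => //.
exact: measurable_cell.
Qed.

Lemma measurable_dot_density n e :
  measurable_fun (setT : set (measurableTypeR R)) (fun r => dot e (density n r)).
Proof.
under eq_fun do rewrite dotC.
exact: (measurable_density_dot (g := fun=> e) n (fun e' => measurable_cst _)).
Qed.

Lemma density_refine n p i r : (n <= p)%N -> grid p i < r -> r <= grid p i.+1 ->
  density n r = density n (grid p i.+1).
Proof. by move=> np ir ri; rewrite /density (cell_refine np ir ri). Qed.

Lemma density_grid p i : density p (grid p i.+1) = slope p i.+1%:Z.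
Proof.
rewrite /density; congr (slope p _); apply/cell_gridP.
by rewrite lexx grid_lt.
Qed.

Lemma dot_density_le n (g : R -> H) r : `|g r| <= 1 -> `|dot (density n r) (g r)| <= 1.
Proof.
move=> g1; apply: le_trans (normr_dot_le Hnorm _ _) _.
by rewrite -[leRHS]mulr1 ler_pM// density_le1.
Qed.

Lemma integral_density e p M :
  (\int[mu]_(r in `](0 : R), grid p M]) dot (density p r) e)%R = dot (l (grid p M) - l 0) e.
Proof.
rewrite (@LS_step _ V _ p M `|e|) => [|_|r|i r ir ri].
- have g0 : grid p 0 = 0 :> R by rewrite /grid mul0r.
  rewrite (eq_bigr (fun i => dot (dl p i) e)) => [|i _].
    elim: M => [|M IH]; first by rewrite big_nil g0 subrr dot0l.
    rewrite big_nat_recr//= IH -dotDl /dl; congr (dot _ _).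
    by rewrite addrC addrA subrK.
  by rewrite density_grid -dV_slope [RHS]dotZl mulrC.
- exact: (measurable_density_dot (g := fun=> e) p (fun e' => measurable_cst _)).
- apply: le_trans (normr_dot_le Hnorm _ _) _; rewrite -[leRHS]mul1r ler_wpM2r//.
  exact: density_le1.
- by rewrite (density_refine (leqnn p) ir ri).
Qed.

(** Inner product in L^2 of ]0, N] with respect to dV of two levels of difference quotients. *)
Definition density_cross n q N : R :=
  (\int[mu]_(r in `](0 : R), N%:R]) dot (density n r) (density q r))%R.

Lemma gridM p N : grid p (N * 2 ^ p) = N%:R :> R.
Proof. by rewrite /grid natrM natrX mulfK// gt_eqF// exprn_gt0. Qed.

(** The martingale property: over a coarse cell the fine increments of l add up to the coarse one,
    so pairing with a coarse density does not see the refinement. *)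
Lemma density_crossE n p N : (n <= p)%N -> density_cross n p N = density_cross n n N.
Proof.
pose S q M := \sum_(0 <= i < M) dot (density n (grid q i.+1)) (dl q i).
have cS q : (n <= q)%N -> density_cross n q N = S q (N * 2 ^ q)%N.
  move=> nq; rewrite /density_cross -(gridM q) (@LS_step _ V _ q _ 1).
  - by apply: eq_bigr => i _; rewrite density_grid -dV_slope [RHS]dotZr mulrC.
  - exact: (measurable_density_dot n (measurable_dot_density q)).
  - by move=> r; apply: dot_density_le; exact: density_le1.
  - by move=> i r ir ri; rewrite (density_refine nq ir ri) (density_refine (leqnn q) ir ri).
have SS q M : (n <= q)%N -> S q.+1 (M * 2)%N = S q M.
  move=> nq; rewrite /S big_nat_pairs; apply: eq_bigr => i _.
  have g0 := gridS q i; have g2 := gridS q i.+1; rewrite mulSn addnC addn2 in g2.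
  have lt2 : grid q.+1 (i * 2) < grid q.+1 (i * 2).+1 :> R by exact: grid_lt.
  have le2 : grid q.+1 (i * 2).+1 <= grid q.+1 (i * 2).+2 :> R by exact: grid_le.
  rewrite (@density_refine n q i (grid q.+1 (i * 2).+1)) ?g2 -?g0//; last by rewrite -g2.
  rewrite -dotDr /dl !g2 g0; congr (dot _ _).
  by rewrite [LHS]addrC addrA subrK.
move=> np; rewrite !cS//; elim: p np => [|p IH]; first by rewrite leqn0 => /eqP ->.
rewrite leq_eqVlt => /predU1P[->//|np]; rewrite -IH// expnS mulnA [(N * 2)%N]mulnC -mulnA mulnC.
exact: SS.
Qed.

End Polar.

Section PolarLimit.
Context {R : realType} {H : completeNormedModType R} (dot : {dot H for idfun}).
Hypothesis Hnorm : hilbert_norm dot.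
Variables (V : cumulative R R) (l : R -> H).
Hypothesis lV : forall s t : R, 0 <= s -> s <= t -> `|l t - l s| <= V t - V s.
Local Notation mu := (lebesgue_stieltjes_measure V).
Local Notation dens := (density V l).
Local Notation cross := (density_cross dot V l).
Implicit Types (n p q i M N j : nat) (r s t : R) (e : H).

Lemma measurable_density2 (G : H -> H -> R) n q :
  measurable_fun (setT : set (measurableTypeR R)) (fun r => G (dens n r) (dens q r)).
Proof.
apply: (measurable_by_cells (cell := cell n) (G := fun z r => G (slope V l n z) (dens q r))).
  exact: measurable_cell.
move=> z; apply: (measurable_by_cells (cell := cell q) (G := fun z' r => G (slope V l n z) (slope V l q z'))).
  exact: measurable_cell.
by move=> z'; exact: measurable_cst.
Qed.

Lemma integrable_density2 (G : H -> H -> R) B n q s t : s <= t ->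
  (forall u v, `|u| <= 1 -> `|v| <= 1 -> `|G u v| <= B) ->
  mu.-integrable `]s, t] (EFin \o (fun r => G (dens n r) (dens q r))).
Proof.
move=> st GB; apply: (@integrable_LS _ _ _ _ _ B) => //.
  exact: (@measurable_funS _ _ _ _ setT _ _ (@measurableT _ _) (@subsetT _ _) (measurable_density2 G n q)).
by move=> r _ _; apply: GB; exact: (density_le1 lV).
Qed.

Lemma dot_le1 (u v : H) : `|u| <= 1 -> `|v| <= 1 -> `|dot u v| <= 1.
Proof.
move=> u1 v1; apply: le_trans (normr_dot_le Hnorm _ _) _.
by rewrite -[leRHS]mulr1 ler_pM.
Qed.

Lemma sqr_le4 (u v : H) : `|u| <= 1 -> `|v| <= 1 -> `| `|u - v| ^+ 2| <= 4.
Proof.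
move=> u1 v1; rewrite ger0_norm ?sqr_ge0//.
have := ler_normB u v; have := normr_ge0 (u - v); nra.
Qed.

(** Pythagoras for martingale differences. It makes the squared norms nondecreasing in the level;
    they are bounded because the densities have norm at most 1. *)
Lemma cross_diff n p N : (n <= p)%N ->
  (\int[mu]_(r in `](0 : R), N%:R]) (`|dens p r - dens n r| ^+ 2))%R = cross p p N - cross n n N.
Proof.
move=> np; have mI : measurable (`](0 : R), N%:R]%classic : set (measurableTypeR R)) by exact: measurable_itv.
have int n' p' : mu.-integrable `](0 : R), N%:R] (EFin \o (fun r => dot (dens n' r) (dens p' r))).
  by apply: (@integrable_density2 (fun u v => dot u v) 1) => //; exact: dot_le1.
transitivity (\int[mu]_(r in `](0 : R), N%:R])
    (dot (dens p r) (dens p r) - 2 * dot (dens n r) (dens p r) + dot (dens n r) (dens n r)))%R.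
  by apply: eq_Rintegral => r _; rewrite (norm2B Hnorm) !Hnorm (dotC dot (dens p r) (dens n r)).
have int2 : mu.-integrable `](0 : R), N%:R] (EFin \o (fun r => 2 * dot (dens n r) (dens p r))).
  apply: (@integrable_density2 (fun u v => 2 * dot u v) 2) => // u v u1 v1.
  by rewrite normrM ger0_norm// ler_piMr//; exact: dot_le1.
rewrite RintegralD//; last first.
  apply: (@integrable_density2 (fun v u => dot v v - 2 * dot u v) 3) => // v u u1 v1.
  have := dot_le1 u1 u1; have := dot_le1 v1 u1; rewrite !ler_norml => /andP[? ?] /andP[? ?]; lra.
rewrite RintegralB// RintegralZl//.
have := density_crossE Hnorm lV N np; rewrite /density_cross => ->; ring.
Qed.

Lemma cross_le N : {homo (fun n => cross n n N) : n p / (n <= p)%N >-> n <= p}.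
Proof.
move=> n p np; rewrite -subr_ge0 -cross_diff//.
by apply: Rintegral_ge0 => r _; exact: sqr_ge0.
Qed.

Lemma cross_cauchy N (e : R) : 0 < e -> exists n0, forall q p, (n0 <= q)%N -> (q <= p)%N ->
  cross p p N - cross q q N <= e.
Proof.
move=> e0; have cv : cvgn (fun n => cross n n N).
  apply: nondecreasing_is_cvgn; first exact: cross_le.
  exists (1 * (V N%:R - V 0)) => _ [n _ <-]; apply: LS_le => //.
    by apply: (@integrable_density2 (fun u v => dot u v) 1) => //; exact: dot_le1.
  move=> r _ _; apply: le_trans (ler_norm _) _.
  by apply: dot_le1; exact: (density_le1 lV).
have /cvgrPdist_le/(_ _ e0)[n0 _ n0P] : cross n n N @[n --> \oo] --> limn (fun n => cross n n N) by exact: cv.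
exists n0 => q p q0 _; have := n0P q q0; rewrite ler_norml => /andP[_].
have := nondecreasing_cvgn_le (cross_le N) cv p; lra.
Qed.

(** The rate 8^-j leaves room for the factor 2^j of [gap_int]. Partial sums of Cauchy thresholds
    make phi nondecreasing, at least j and beyond the j-th threshold; the horizon j grows so that
    one subsequence serves all N. *)
Lemma subsequence : exists phi : nat -> nat,
  [/\ forall j, (phi j <= phi j.+1)%N, forall j, (j <= phi j)%N &
      forall j, cross (phi j.+1) (phi j.+1) j - cross (phi j) (phi j) j <= 8^-1 ^+ j].
Proof.
have h j : exists n0, forall q p, (n0 <= q)%N -> (q <= p)%N -> cross p p j - cross q q j <= 8^-1 ^+ j.
  by apply: cross_cauchy; rewrite exprn_gt0// invr_gt0.
have [n0 n0P] := choice h.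
have le j : (\sum_(i < j.+1) (n0 i).+1 <= \sum_(i < j.+2) (n0 i).+1)%N.
  by rewrite [leqRHS]big_ord_recr leq_addr.
exists (fun j => \sum_(i < j.+1) (n0 i).+1)%N; split => // j.
  by elim: j => [//|j IH]; rewrite big_ord_recr /= -[leqLHS]addn1 leq_add.
by apply: n0P => //; rewrite big_ord_recr; exact: leq_trans (leqnSn _) (leq_addl _ _).
Qed.

End PolarLimit.

Section PolarExists.
Context {R : realType} {H : completeNormedModType R} (dot : {dot H for idfun}).
Hypothesis Hnorm : hilbert_norm dot.
Variables (V : cumulative R R) (l : R -> H).
Hypothesis lV : forall s t : R, 0 <= s -> s <= t -> `|l t - l s| <= V t - V s.
Local Notation mu := (lebesgue_stieltjes_measure V).
Local Notation dens := (density V l).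
Local Notation cross := (density_cross dot V l).
Implicit Types (n p q i M N j : nat) (r s t : R) (e : H).

Variable phi : nat -> nat.
Hypothesis phi_le : forall j, (phi j <= phi j.+1)%N.
Hypothesis phi_ge : forall j, (j <= phi j)%N.
Hypothesis phi_cross : forall j,
  cross (phi j.+1) (phi j.+1) j - cross (phi j) (phi j) j <= 8^-1 ^+ j.

Let gap j r : R := `|dens (phi j.+1) r - dens (phi j) r|.

Let gap_le2 j r : gap j r <= 2.
Proof.
apply: le_trans (ler_normB _ _) _.
by have := density_le1 lV (phi j) r; have := density_le1 lV (phi j.+1) r; lra.
Qed.

Let measurable_gap j : measurable_fun (setT : set (measurableTypeR R)) (gap j).
Proof. exact: (measurable_density2 V l (fun u v => `|u - v|)). Qed.

Let integrable_gap j N : mu.-integrable `](0 : R), N%:R] (EFin \o gap j).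
Proof.
apply: (@integrable_LS _ _ _ _ _ 2) => //.
  exact: (@measurable_funS _ _ _ _ setT).
by move=> r _ _; rewrite normr_id; exact: gap_le2.
Qed.

Let gap_sqr_int j N : (N <= j)%N ->
  (\int[mu]_(r in `](0 : R), N%:R]) (gap j r ^+ 2))%R <= 8^-1 ^+ j.
Proof.
move=> Nj; apply: le_trans (phi_cross j); rewrite -(cross_diff Hnorm lV j (phi_le j)).
have Nj' : N%:R <= j%:R :> R by rewrite ler_nat.
have int s t : s <= t -> mu.-integrable `]s, t] (EFin \o (fun r => gap j r ^+ 2)).
  move=> st; exact: (integrable_density2 lV (phi j.+1) (phi j) st (@sqr_le4 R H)).
rewrite [leRHS](LS_add (ler0n _ _) Nj' (int _ _ (ler0n _ _))) lerDl.
by apply: Rintegral_ge0 => r _; exact: sqr_ge0.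
Qed.

Let quarter_le_half : 2 * 8^-1 <= 2^-1 :> R.
Proof. lra. Qed.

(** For j >= N, the inequality g <= 2^-j + 2^j g^2 turns the L^2 bound 8^-j into a summable L^1
    bound. The finitely many j < N use g <= 2, whence the term with 2^N in the constant. *)
Let gap_int N : exists C, forall j,
  (\int[mu]_(r in `](0 : R)%R, N%:R]) (gap j r)%:E <= (C / (2 ^ j.+1)%:R)%:E)%E.
Proof.
have [dd ddE] : exists dd, dd = V N%:R - V 0 by exists (V N%:R - V 0).
have dd0 : 0 <= dd by rewrite ddE; apply: le_trans (lV (lexx 0) (ler0n _ N)).
exists (2 * (dd * 2 ^+ N) + 2 * (dd + 1)) => j.
have ig := integrable_gap j N.
rewrite -[leLHS]fineK; last exact: (integrable_fin_num _ ig).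
rewrite lee_fin -[leLHS]/(Rintegral _ _ _) natrX.
have p0 : 0 < 2 ^+ j.+1 :> R by rewrite exprn_gt0.
have N1 : 1 <= 2 ^+ N :> R by rewrite exprn_ege1// ler1n.
have [jN|Nj] := ltnP j N.
  rewrite ler_pdivlMr//.
  have le2 : (\int[mu]_(r in `](0 : R), N%:R]) gap j r)%R <= 2 * dd.
    by rewrite ddE; apply: LS_le => // r _ _; exact: gap_le2.
  have pw : 2 ^+ j.+1 <= 2 ^+ N :> R by rewrite ler_eXn2l// ltr1n.
  have h1 := ler_wpM2r (ltW p0) le2; have h2 : dd * 2 ^+ j.+1 <= dd * 2 ^+ N by rewrite ler_wpM2l.
  lra.
have q0 : 0 < 2 ^- j :> R by rewrite invr_gt0 exprn_gt0.
have p'0 : 0 < 2 ^+ j :> R by rewrite exprn_gt0.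
have ig2 : mu.-integrable `](0 : R), N%:R] (EFin \o (fun r => gap j r ^+ 2)).
  exact: (integrable_density2 lV (phi j.+1) (phi j) (ler0n _ _) (@sqr_le4 R H)).
have mI : measurable (`](0 : R), N%:R]%classic : set (measurableTypeR R)) by exact: measurable_itv.
have igc : mu.-integrable `](0 : R), N%:R] (EFin \o (fun r => 2 ^- j)).
  by apply: (@integrable_LS _ _ _ _ _ `|2 ^- j|) => //; exact: measurable_cst.
have igm : mu.-integrable `](0 : R), N%:R] (EFin \o (fun r => 2 ^+ j * gap j r ^+ 2)).
  apply: (integrable_density2 lV (G := fun u v => 2 ^+ j * `|u - v| ^+ 2) (B := 2 ^+ j * 4) (phi j.+1) (phi j) (ler0n _ _)) => u v u1 v1.
  by rewrite normrM (ger0_norm (ltW p'0)) ler_pM2l//; exact: sqr_le4.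
have : (\int[mu]_(r in `](0 : R), N%:R]) gap j r)%R <=
    (\int[mu]_(r in `](0 : R), N%:R]) (2 ^- j + 2 ^+ j * gap j r ^+ 2))%R.
  apply: le_Rintegral => //.
    apply: (integrable_density2 lV (G := fun u v => 2 ^- j + 2 ^+ j * `|u - v| ^+ 2) (B := 2 ^- j + 2 ^+ j * 4) (phi j.+1) (phi j) (ler0n _ _)) => u v u1 v1.
    have := sqr_le4 u1 v1; rewrite ger0_norm ?sqr_ge0// => h.
    have h0 : 0 <= 2 ^+ j * `|u - v| ^+ 2 by exact: mulr_ge0 (ltW p'0) (sqr_ge0 _).
    rewrite ger0_norm; last exact: addr_ge0 (ltW q0) h0.
    by rewrite lerD2l ler_pM2l.
  move=> r _; have := sqr_ge0 (2 ^+ j * gap j r - 1).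
  have qp : 2 ^- j * 2 ^+ j = 1 :> R by rewrite mulVf// gt_eqF.
  have g0 : 0 <= gap j r := normr_ge0 _.
  move=> h; have := ler_wpM2l (ltW q0) h; rewrite mulr0.
  set a := 2 ^- j in qp *; set b := 2 ^+ j in qp *; set g := gap j r in g0 *.
  have -> : a * (b * g - 1) ^+ 2 = (a * b) * b * g ^+ 2 - 2 * (a * b) * g + a by ring.
  rewrite qp; lra.
rewrite RintegralD// RintegralZl// Rintegral_cst// [X in _ * fine X](LS_itv V (ler0n _ _)) /= -ddE => h.
have h2 := ler_wpM2l (ltW p'0) (gap_sqr_int Nj).
have h3 : 2 ^+ j * 8^-1 ^+ j <= 2 ^- j :> R.
  by rewrite -exprMn -exprVn lerXn2r ?nnegrE ?quarter_le_half ?mulr_ge0 ?invr_ge0.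
apply: le_trans h _; rewrite exprS invfM mulrA.
have : 0 <= dd * 2 ^+ N * 2 ^- j by rewrite !mulr_ge0// ltW// (lt_le_trans ltr01).
set a := 2 ^- j in h3 *; set S := (\int[mu]_(_ in _) _)%R in h2 *; nra.
Qed.

Let total r := (\sum_(0 <= j <oo) (gap j r)%:E)%E.
(** The value 0 is taken where the increments are not summable, a measurable set that is null in
    every ]0, N]; norm bound and measurability then hold everywhere. *)
Definition polar_density r : H := if (total r < +oo)%E then limn (fun j => dens (phi j) r) else 0.

Let polar_cvg r : (total r < +oo)%E -> dens (phi j) r @[j --> \oo] --> polar_density r.
Proof. by move=> fin; rewrite /polar_density fin; exact: (cvgn_summable (z := fun j => dens (phi j) r)). Qed.

Let dot_polar_cvg r e : (total r < +oo)%E ->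
  dot (dens (phi j) r) e @[j --> \oo] --> dot (polar_density r) e.
Proof.
move=> fin; have -> : (fun j => dot (dens (phi j) r) e) = (fun j => dot e (dens (phi j) r)).
  by apply/funext => j; rewrite dotC.
by rewrite dotC; exact: (cvg_dotr Hnorm _ (polar_cvg fin)).
Qed.

Let polar_ae N : {ae mu, forall r : measurableTypeR R, `](0 : R), N%:R]%classic r -> (total r < +oo)%E}.
Proof.
have [C gC] := gap_int N; apply: summable_ae gC => // j r; exact: normr_ge0.
Qed.

Lemma polar_density_le1 r : `|polar_density r| <= 1.
Proof.
rewrite /polar_density; case: ifPn => [fin|_]; last by rewrite normr0.
have := polar_cvg fin; rewrite /polar_density fin => cv.
have cn : `|dens (phi j) r| @[j --> \oo] --> `|limn (fun j => dens (phi j) r)| by exact: cvg_norm cv.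
rewrite -(cvg_lim (@Rhausdorff R) cn).
apply: limr_le; first by apply/cvg_ex; eexists; exact: cn.
by near=> j; exact: (density_le1 lV).
Unshelve. all: by end_near. Qed.

Lemma measurable_polar_density e :
  measurable_fun (setT : set (measurableTypeR R)) (fun r => dot (polar_density r) e).
Proof.
apply: (@measurable_realfun.measurable_fun_cvg _ _ _ _
    (fun j r => if (total r < +oo)%E then dot (dens (phi j) r) e else 0)) => [j|r _].
  apply: measurable_fun_ifT.
  - apply: measurable_fun_lte => //; apply: ge0_emeasurable_sum => [k x _ _|k _].
      by rewrite lee_fin; exact: normr_ge0.
    by apply/measurable_EFinP; exact: measurable_gap.
  - exact: (measurable_density2 V l (fun u _ => dot u e) (phi j) (phi j)).
  - exact: measurable_cst.
have [fin|/negbTE fin] := boolP (total r < +oo)%E; first exact: dot_polar_cvg.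
by rewrite /polar_density ifN ?fin// dot0l; exact: cvg_cst.
Qed.

(** Dominated convergence along phi. The identity is exact at grid points only: t is compared with
    the next grid point, and both errors are at most |e| times the increment of V in between, small
    by right continuity. *)
Lemma integral_polar_density e t : 0 <= t ->
  (forall eps : R, 0 < eps -> exists2 d : R, 0 < d & V (t + d) - V t <= eps) ->
  mu.-integrable `](0 : R), t] (EFin \o (fun r => dot (polar_density r) e)) /\
  (\int[mu]_(r in `](0 : R), t]) dot (polar_density r) e)%R = dot (l t - l 0) e.
Proof.
move=> t0 Vt.
have [N tN] : exists N, t <= N%:R.
  by exists (Num.trunc t).+1; rewrite ltW// truncnS_gt.
have mI : measurable (`](0 : R), t]%classic : set (measurableTypeR R)) by exact: measurable_itv.
have mf j : measurable_fun (setT : set (measurableTypeR R)) (fun r => dot (dens j r) e).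
  exact: (measurable_density2 V l (fun u _ => dot u e) j j).
have fle j r : `|dot (dens j r) e| <= `|e|.
  apply: le_trans (normr_dot_le Hnorm _ _) _; rewrite -[leRHS]mul1r ler_wpM2r//.
  exact: (density_le1 lV).
have int j s u : s <= u -> mu.-integrable `]s, u] (EFin \o (fun r => dot (dens j r) e)).
  move=> su; apply: (@integrable_LS _ _ _ _ _ `|e|) => //.
  exact: (@measurable_funS _ _ _ _ setT).
have mg : measurable_fun (setT : set (measurableTypeR R)) (fun r => dot (polar_density r) e).
  exact: measurable_polar_density.
have ig : mu.-integrable `](0 : R), t] (EFin \o (fun r => dot (polar_density r) e)).
  apply: (@integrable_LS _ _ _ _ _ `|e|) => //; first exact: (@measurable_funS _ _ _ _ setT).
  move=> r _ _; apply: le_trans (normr_dot_le Hnorm _ _) _; rewrite -[leRHS]mul1r ler_wpM2r//.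
  exact: polar_density_le1.
split => //.
have ic : mu.-integrable `](0 : R), t] (EFin \o (fun=> `|e|)).
  by apply: (@integrable_LS _ _ _ _ _ `| `|e| |) => //; exact: measurable_cst.
have [] := @dominated_convergence _ _ _ mu _ mI
  (fun j r => (dot (dens (phi j) r) e)%:E) (fun r => (dot (polar_density r) e)%:E) (EFin \o (fun=> `|e|)).
- move=> j; apply/measurable_EFinP; exact: (@measurable_funS _ _ _ _ setT).
- apply/measurable_EFinP; exact: (@measurable_funS _ _ _ _ setT).
- have := polar_ae N; apply: filterS => r rP; rewrite /= in_itv /= => /andP[r0 rt].
  apply: cvg_EFin; first by near=> j.
  have fin : (total r < +oo)%E by apply: rP; rewrite /= in_itv /= r0 (le_trans rt tN).
  exact: dot_polar_cvg.
- exact: ic.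
- by apply: aeW => r j _; rewrite lee_fin.
move=> _ _ cv.
have cvR : (\int[mu]_(r in `](0 : R), t]) dot (dens (phi j) r) e)%R @[j --> \oo] -->
    (\int[mu]_(r in `](0 : R), t]) dot (polar_density r) e)%R.
  by apply: fine_cvg; rewrite /= fineK//; exact: (integrable_fin_num mI ig).
apply: (cvg_unique (@Rhausdorff R) cvR).
apply/cvgrPdist_le => eps eps0.
have e0 : 0 < 2 * (`|e| + 1) by rewrite mulr_gt0// ltr_wpDl.
have [d d0 dP] := Vt _ (divr_gt0 eps0 e0).
have [M MP] : exists M, forall n, (M <= n)%N -> 2 ^- n <= d.
  exists (Num.trunc d^-1).+1 => n Mn.
  rewrite -[leRHS]invrK lef_pV2 ?posrE ?exprn_gt0 ?invr_gt0//.
  apply: le_trans (ltW (truncnS_gt _)) _; apply: le_trans (_ : n%:R <= _); first by rewrite ler_nat.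
  by rewrite -natrX ler_nat ltnW// ltn_expl.
exists M => // j /= Mj; set n := phi j.
have Mn : (M <= n)%N := leq_trans Mj (phi_ge j).
have p0 : 0 < 2 ^+ n :> R by rewrite exprn_gt0.
pose i := Num.trunc (t * 2 ^+ n).
have tp : 0 <= t * 2 ^+ n by rewrite mulr_ge0// ltW.
have /andP[i1 i2] := trunc_itv tp.
have tb : t <= grid n i.+1 by rewrite /grid ler_pdivlMr// ltW.
have bt : grid n i.+1 <= t + d.
  apply: le_trans (_ : t + 2 ^- n <= _); last by rewrite lerD2l MP.
  by rewrite /grid -natr1 mulrDl mul1r lerD2r ler_pdivrMr.
have Vb : V (grid n i.+1) - V t <= eps / (2 * (`|e| + 1)).
  apply: le_trans dP; rewrite lerD2r; exact: cumulative_is_nondecreasing.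
have h1 := @integral_density _ _ _ Hnorm V l lV e n i.+1.
rewrite (LS_add t0 tb (int _ _ _ (le_trans t0 tb))) in h1.
have h2 := LS_norm_le tb (int n _ _ tb) (fun r _ _ => fle n r).
have h3 : `|dot (l (grid n i.+1) - l t) e| <= (V (grid n i.+1) - V t) * `|e|.
  apply: le_trans (normr_dot_le Hnorm _ _) _; rewrite ler_wpM2r//; exact: lV.
have -> : (\int[mu]_(r in `](0 : R), t]) dot (dens n r) e)%R =
    dot (l t - l 0) e + (dot (l (grid n i.+1) - l t) e - (\int[mu]_(r in `]t, grid n i.+1]) dot (dens n r) e)%R).
  have -> : dot (l t - l 0) e = dot (l (grid n i.+1) - l 0) e - dot (l (grid n i.+1) - l t) e.
    by rewrite !dotDl !dotNl; ring.
  by rewrite -h1; ring.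
rewrite opprD addrA subrr sub0r normrN; apply: le_trans (ler_normB _ _) _.
apply: le_trans (lerD h3 h2) _.
rewrite [X in X + _]mulrC -mulr2n -mulr_natl mulrA.
apply: le_trans (ler_wpM2l _ Vb) _; first by rewrite mulr_ge0.
rewrite mulrCA ler_piMr ?(ltW eps0)// ler_pdivrMr// mul1r ler_pM2l// lerDl//.
Unshelve. all: by end_near. Qed.

End PolarExists.

Section PolarDecomposition.
Context {R : realType} {H : completeNormedModType R} (dot : {dot H for idfun}).
Hypothesis Hnorm : hilbert_norm dot.
Variables (l : R -> H).
Hypothesis lbv : BV_loc l.
Hypothesis lrc : forall s e : R, 0 <= s -> 0 < e -> exists2 d : R, 0 < d &
  forall t : R, s <= t -> t < s + d -> `|l t - l s| <= e.

(** Continued by 0 to the left of the origin, since a [cumulative] function lives on the whole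
    line. *)
Let vf (t : R) : R := Vr 0 (Num.max 0 t) l.

Let vfB s t : 0 <= s -> s <= t -> vf t - vf s = Vr s t l.
Proof.
move=> s0 st; rewrite /vf !max_r ?(le_trans s0)//.
by rewrite (VrD (BVfin lbv t) (lexx 0) s0 st (lexx t)); ring.
Qed.

Let vf_nd : nondecreasing vf.
Proof.
move=> s t st; have m0 : 0 <= Num.max 0 s by rewrite le_max lexx.
have mm : Num.max 0 s <= Num.max 0 t by rewrite ge_max !le_max lexx st orbT.
exact: (Vr_le (BVfin lbv _) (lexx 0) (lexx 0) m0 mm (lexx _)).
Qed.

Let vf_right t e : 0 < e -> exists2 d : R, 0 < d & forall r, t <= r -> r < t + d -> vf r - vf t <= e.
Proof.
move=> e0; have [t0|t0] := ltP t 0.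
  exists (- t); first by lra.
  by move=> r tr rt; rewrite /vf !max_l ?subrr ?ltW//; lra.
have t1 : t < t + 1 by lra.
have [d d0 dP] := Vr_right (BVfin lbv (t + 1)) t0 t1 (fun e => lrc t0) e0.
exists (Num.min d 1); first by rewrite lt_min d0 ltr01.
move=> r tr; rewrite -ltrBlDl lt_min => /andP[rd r1]; rewrite vfB//.
by apply: dP => //; lra.
Qed.

Let vf_rc : right_continuous vf.
Proof.
move=> t; apply/cvgrPdist_le => e e0; have [d d0 dP] := vf_right t e0.
near=> r; have tr : t < r by near: r; exact: nbhs_right_gt.
rewrite distrC ger0_norm ?subr_ge0 ?vf_nd ?(ltW tr)//.
apply: dP; first exact: ltW.
by near: r; apply: nbhs_right_lt; lra.
Unshelve. all: by end_near. Qed.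

Lemma polar_exists : exists (V : cumulative R R) (h : R -> H), polar_decomposition dot l V h.
Proof.
pose V : cumulative R R := HB.pack vf (isCumulative.Build R _ R vf vf_nd vf_rc).
have lV (s t : R) : 0 <= s -> s <= t -> `|l t - l s| <= V t - V s.
  by move=> s0 st; rewrite [leRHS](vfB s0 st); apply: (Vr_ge (BVfin lbv t) s0 st).
have [phi [phi_le phi_ge phi_cross]] := subsequence Hnorm lV.
have main e t : 0 <= t ->
    (lebesgue_stieltjes_measure V).-integrable `](0 : R), t] (EFin \o (fun r => dot (polar_density V l phi r) e)) /\
    (\int[lebesgue_stieltjes_measure V]_(r in `](0 : R), t]) dot (polar_density V l phi r) e)%R = dot (l t - l 0) e.
  move=> t0; apply: (integral_polar_density Hnorm lV phi_le phi_ge phi_cross) => // e' e'0.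
  have [d d0 dP] := vf_right t e'0; exists (d / 2); first by lra.
  by apply: dP; lra.
exists V, (polar_density V l phi); split.
- move=> s t /andP[s0 st]; rewrite (Var_fin (BVfin lbv t) s0 st (lexx t)).
  by congr (_%:E); rewrite -(vfB s0 st).
- by move=> r; exact: polar_density_le1.
- by move=> e; exact: measurable_polar_density.
move=> e s t /andP[s0 st]; have t0 := le_trans s0 st.
have [int_s Is] := main e s s0; have [it It] := main e t t0.
have := LS_add s0 st it; rewrite It Is => E.
have -> : dot (l t - l s) e = dot (l t - l 0) e - dot (l s - l 0) e by rewrite !dotDl !dotNl; ring.
by rewrite E; ring.
Qed.

End PolarDecomposition.

(** * The differential inclusion in the limit *)

Section EnergyLimit.
Context {R : realType} {H : completeNormedModType R} (dot : {dot H for idfun}).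
Hypothesis Hnorm : hilbert_norm dot.

Lemma energy_term_cvg (c : H) (a_ b_ : nat -> H) (a b : H) (e : R) :
  a_ n @[n --> \oo] --> a -> b_ n @[n --> \oo] --> b -> 0 < e ->
  exists N, forall n, (N <= n)%N ->
    dot c (a_ n - b_ n) - (`|a_ n| ^+ 2 - `|b_ n| ^+ 2) / 2 <=
    dot c (a - b) - (`|a| ^+ 2 - `|b| ^+ 2) / 2 + e.
Proof.
move=> ca cb e0.
have cv : dot c (a_ n - b_ n) - (`|a_ n| ^+ 2 - `|b_ n| ^+ 2) / 2 @[n --> \oo] -->
    dot c (a - b) - (`|a| ^+ 2 - `|b| ^+ 2) / 2.
  apply: cvgB; first by apply: (cvg_dotr Hnorm); exact: cvgB.
  apply: cvgM; last exact: cvg_cst.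
  by apply: cvgB; [exact: (cvg_norm2 _ ca)|exact: (cvg_norm2 _ cb)].
have /cvgrPdist_le/(_ _ e0)[N _ NP] := cv; exists N => n Nn.
by have := NP n Nn; rewrite ler_norml => /andP[+ _]; lra.
Qed.

(** The sides differ by |a - b|^2 / 2. This is the way back from the energy form to the linear one,
    q - b becoming the state x. *)
Lemma energy_term_le (q a b al : H) :
  dot (q - al) (a - b) - (`|a| ^+ 2 - `|b| ^+ 2) / 2 <= dot (q - b - al) (a - b).
Proof.
have := sqr_ge0 `|a - b|; rewrite !Hnorm !dotE (dotC dot b a); lra.
Qed.

End EnergyLimit.

Section PolarIntegral.
Context {R : realType} {H : completeNormedModType R} (dot : {dot H for idfun}).
Hypothesis Hnorm : hilbert_norm dot.
Variables (l : R -> H) (W : cumulative R R) (h : R -> H).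
Hypothesis lWh : polar_decomposition dot l W h.
Variables (x : R -> H) (al : H).
Hypothesis xc : cadlag x.

Definition polar_int (u v : R) : R :=
  (\int[lebesgue_stieltjes_measure W]_(r in `]u, v]) dot (x r - al) (h r))%R.

Lemma integrable_polar (u v : R) : 0 <= u -> u <= v ->
  (lebesgue_stieltjes_measure W).-integrable `]u, v] (EFin \o (fun r => dot (x r - al) (h r))).
Proof.
have [_ h1 mh _] := lWh; move=> u0 uv; have [B B0 BP] := cadlag_bounded v xc.
apply: (@integrable_LS _ _ _ _ _ (B + `|al|)) => //.
  exact: (measurable_cadlag_dot Hnorm).
move=> r ur rv; apply: le_trans (normr_dot_le Hnorm _ _) _.
rewrite -[leRHS]mulr1 ler_pM//; apply: le_trans (ler_normB _ _) _; rewrite lerD2r.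
by apply: BP => //; lra.
Qed.

Lemma polar_int_add (u v w : R) : 0 <= u -> u <= v -> v <= w ->
  polar_int u w = polar_int u v + polar_int v w.
Proof.
by move=> u0 uv vw; apply: LS_add => //; apply: integrable_polar => //; exact: le_trans vw.
Qed.

Lemma polar_int_norm (u v D : R) : 0 <= u -> u <= v ->
  (forall r, u < r -> r <= v -> `|x r - al| <= D) -> `|polar_int u v| <= D * (W v - W u).
Proof.
have [_ h1 _ _] := lWh; move=> u0 uv xD; apply: LS_norm_le => //; first exact: integrable_polar.
move=> r ur rv; apply: le_trans (normr_dot_le Hnorm _ _) _.
by rewrite -[leRHS]mulr1 ler_pM//; exact: xD.
Qed.

Lemma polar_int_ge (u v e : R) z : 0 <= u -> u <= v ->
  (forall r, u < r -> r <= v -> `|x r - z| <= e) ->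
  dot (z - al) (l v - l u) - e * (W v - W u) <= polar_int u v.
Proof.
have [_ h1 mh lh] := lWh; move=> u0 uv xe.
have uv' : 0 <= u <= v by rewrite u0.
have mI : measurable (`]u, v]%classic : set (measurableTypeR R)) by exact: measurable_itv.
have iz : (lebesgue_stieltjes_measure W).-integrable `]u, v] (EFin \o (fun r => dot (h r) (z - al))).
  apply: (@integrable_LS _ _ _ _ _ `|z - al|) => //.
    exact: (@measurable_funS _ _ _ _ setT).
  by move=> r _ _; apply: le_trans (normr_dot_le Hnorm _ _) _; rewrite -[leRHS]mul1r ler_wpM2r.
have ix := integrable_polar u0 uv.
rewrite dotC (lh _ u v uv') lerBlDr -lerBlDl.
rewrite /polar_int -(RintegralB mI iz ix).
apply: le_trans (ler_norm _) _; apply: LS_norm_le => //.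
  have := integrableB mI iz ix; congr (_.-integrable _ _); apply/funext => r /=; by rewrite EFinB.
move=> r ur rv; have -> : dot (h r) (z - al) - dot (x r - al) (h r) = dot (h r) (z - x r).
  by rewrite (dotC dot (x r - al)) -dotNr -dotDr; congr (dot _ _); rewrite opprB addrA subrK.
apply: le_trans (normr_dot_le Hnorm _ _) _; rewrite -[leRHS]mul1r ler_pM// distrC; exact: xe.
Qed.

End PolarIntegral.

Section LimitDifferential.
Context {R : realType} {H : completeNormedModType R} (dot : {dot H for idfun}).
Hypothesis Hnorm : hilbert_norm dot.
Variables (A : H -> set H) (Pi : H -> H).
Hypothesis PiP : gen_projection A Pi.
Variables (m x K : R -> H).
Hypotheses (mc : cadlag m) (xc : cadlag x) (Kc : cadlag K) (Kbv : BV_loc K).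
Hypothesis xK : forall t : R, 0 <= t -> x t + K t = m t.
Variables (m_ x_ k_ : nat -> R -> H) (lam : nat -> R -> R).
Hypothesis sol : forall n, (0 < n)%N -> SP dot A Pi (m_ n) (x_ n) (k_ n).
Hypothesis lamP : forall n, rescaling (lam n).
Hypothesis lam_id : forall e : R, 0 < e -> exists N, forall n, (N <= n)%N ->
  forall t, 0 <= t -> `|lam n t - t| <= e.
Hypothesis m_cvg : forall T e : R, 0 < e -> exists N, forall n, (N <= n)%N ->
  forall t, 0 <= t -> t <= T -> `|m_ n (lam n t) - m t| <= e.
Hypothesis x_cvg : forall T e : R, 0 <= T -> 0 < e -> exists N, forall n, (N <= n)%N ->
  forall t, 0 <= t -> t <= T -> `|x_ n (lam n t) - x t| <= e.
Hypothesis K_cvg : forall T e : R, 0 <= T -> 0 < e -> exists N, forall n, (N <= n)%N ->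
  forall t, 0 <= t -> t <= T -> `|k_ n (lam n t) - K t| <= e.
Hypothesis K_left : forall T e : R, 0 <= T -> 0 < e -> exists N, forall n, (N <= n)%N ->
  forall t, 0 <= t -> t <= T -> `|left_lim (k_ n) (lam n t) - left_lim K t| <= e.
Hypothesis Vbound : forall T : R, 0 <= T -> exists B N, 0 <= B /\ forall n, (N <= n)%N ->
  Vr 0 (lam n T) (k_ n) <= B.
Implicit Types (r s t u v w T e : R) (n p N : nat).

Local Notation Vn n u v := (Vr (lam n u) (lam n v) (k_ n)).

Lemma Lint_limit al be u v e : 0 <= u -> u < v -> 0 < e ->
  (forall q, u <= q -> q < v -> `|x q - x u| <= e) ->
  exists N, forall n, (N <= n)%N ->
    Lint dot x al be u v <= Lint dot (x_ n) al be (lam n u) (lam n v) + e * (3 * `|be| + 1) * (v - u).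
Proof.
move=> u0 uv e0 xe; have v0 := le_trans u0 (ltW uv).
set q0 := dot (x u - al) be; pose M := `|q0| + 2 * e * `|be| + 1.
have M0 : 0 < M by rewrite /M; have := normr_ge0 q0; have := mulr_ge0 (ltW e0) (normr_ge0 be); lra.
have e20 : 0 < e * (v - u) / (2 * M) by rewrite divr_gt0 ?mulr_gt0// subr_gt0.
have [N1 h1] := x_cvg v0 e0; have [N2 h2] := lam_id e20.
exists (maxn 1 (maxn N1 N2)) => n; rewrite !geq_max => /andP[n0 /andP[nN1 nN2]].
have lu0 := rescaling_ge0 (lamP n) u0.
have luv : lam n u <= lam n v := rescaling_le (lamP n) u0 (ltW uv).
have xne q : lam n u <= q -> q < lam n v -> `|x_ n q - x u| <= 2 * e.
  move=> uq qv; have [q' q'0 qE] := rescaling_surj (lamP n) (le_trans lu0 uq).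
  have uq' : u <= q' by apply: (rescaling_le_inv (lamP n)) => //; rewrite qE.
  have qv' : q' < v by apply: (rescaling_lt_inv (lamP n)) => //; rewrite qE.
  have a1 := h1 n nN1 q' q'0 (ltW qv'); have a2 := xe q' uq' qv'; rewrite qE in a1.
  by have := ler_distD (x q') (x_ n q) (x u); lra.
have := Lint_cst Hnorm al be xc u0 (ltW uv) xe.
have := Lint_cst Hnorm al be (SP_cadlag_x (sol n0)) lu0 luv xne.
rewrite -/q0 !ler_norml => /andP[b1 _] /andP[_ b2].
have := h2 n nN2 u u0; have := h2 n nN2 v v0; rewrite !ler_norml => /andP[c1 c2] /andP[c3 c4].
set d := e * (v - u) / (2 * M) in c1 c2 c3 c4.
have dM : 2 * d * M = e * (v - u) by rewrite /d; field; rewrite gt_eqF.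
have dl : `|(lam n v - lam n u) - (v - u)| <= 2 * d by rewrite ler_norml; lra.
have p1 : - (2 * d * `|q0|) <= ((lam n v - lam n u) - (v - u)) * q0.
  have : `|((lam n v - lam n u) - (v - u)) * q0| <= 2 * d * `|q0| by rewrite normrM ler_wpM2r.
  by rewrite ler_norml => /andP[].
have p2 : 2 * e * `|be| * (lam n v - lam n u) <= 2 * e * `|be| * (v - u + 2 * d).
  by rewrite ler_wpM2l ?mulr_ge0 ?(ltW e0)//; move: dl; rewrite ler_norml => /andP[_]; lra.
have d0 : 0 <= d by exact: ltW.
have -> : e * (3 * `|be| + 1) * (v - u) = e * `|be| * (v - u) + 2 * e * `|be| * (v - u) + e * (v - u) by ring.
rewrite -dM /M; move: b1 b2 p1 p2.
set bb := e * `|be|; rewrite -(mulrA 2 e) -/bb; nra.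
Qed.

(** Here [kv] is the value of k_n at the right end or its left limit there, so that intervals on
    either side of a point are covered. *)
Lemma local_limit al be u v e c (kv : nat -> H) kl : 0 <= u -> u < v -> 0 < e ->
  (forall q, u <= q -> q < v -> `|x q - x u| <= e) ->
  kv n @[n --> \oo] --> kl ->
  (exists N, forall n, (N <= n)%N -> Lint dot (x_ n) al be (lam n u) (lam n v) <=
     dot (m u - al) (kv n - k_ n (lam n u)) - (`|kv n| ^+ 2 - `|k_ n (lam n u)| ^+ 2) / 2
     + c * Vn n u v) ->
  exists N, forall n, (N <= n)%N -> Lint dot x al be u v <=
     dot (x u - al) (kl - K u) + c * Vn n u v + e * (3 * `|be| + 2) * (v - u).
Proof.
move=> u0 uv e0 xe kvl [N1 h1]; have [N2 h2] := Lint_limit al be u0 uv e0 xe.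
have ku : k_ n (lam n u) @[n --> \oo] --> K u.
  apply/cvgrPdist_le => e' e'0; have [N NP] := K_cvg u0 e'0; exists N => // n Nn.
  by rewrite distrC; exact: NP.
have e20 : 0 < e * (v - u) by rewrite mulr_gt0// subr_gt0.
have [N3 h3] := energy_term_cvg Hnorm (m u - al) kvl ku e20.
exists (maxn N1 (maxn N2 N3)) => n; rewrite !geq_max => /andP[nN1 /andP[nN2 nN3]].
have a1 := h1 n nN1; have a2 := h2 n nN2; have a3 := h3 n nN3.
have := energy_term_le Hnorm (m u) kl (K u) al.
have -> : m u - K u - al = x u - al by rewrite -xK// addrK.
have -> : e * (3 * `|be| + 2) * (v - u) = e * (3 * `|be| + 1) * (v - u) + e * (v - u) by ring.
lra.
Qed.


Section Steps.
Variables (W : cumulative R R) (h : R -> H).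
Hypothesis lWh : polar_decomposition dot (cont_part K) W h.
Variables (al be : H).
Hypothesis Aab : A al be.
Variables (F : {fset R}) (T D : R).
Hypotheses (D0 : 0 <= D) (xD : forall r : R, 0 <= r -> r <= T -> `|x r - al| <= D).

Local Notation l := (cont_part K).
Local Notation I u v := (polar_int dot W h x al u v).
Local Notation tau t := (jtail K F t).

Let WB u v : 0 <= u -> u <= v -> W v - W u = Vr u v l.
Proof.
move=> u0 uv; have [+ _ _ _] := lWh => /(_ u v); rewrite u0 => /(_ uv) VE.
by rewrite /Vr VE.
Qed.

Let W_le u v : 0 <= u -> u <= v -> W u <= W v.
Proof.
move=> u0 uv; rewrite -subr_ge0 WB//.
exact: (Vr_ge0 (BVfin (BV_cont_part Kc Kbv) v) u0 uv (lexx v)).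
Qed.

Let W_ge u v : 0 <= u -> u <= v -> `|l v - l u| <= W v - W u.
Proof.
by move=> u0 uv; rewrite WB//; apply: (Vr_ge (BVfin (BV_cont_part Kc Kbv) v)).
Qed.

Let W_left r e : 0 < r -> 0 < e -> exists2 d : R, 0 < d &
  forall v, 0 <= v -> r - d < v -> v <= r -> W r - W v <= e.
Proof.
move=> r0 e0.
have [e' e'0|d d0 dP] := @Vr_left _ _ _ _ (BVfin (BV_cont_part Kc Kbv) r) _ r0 (lexx r) _ e e0.
  have [d d0 dP] := cont_part_left Kc Kbv r0 e'0.
  exists (Num.min d r); first by rewrite lt_min d0.
  move=> s; rewrite ltrBlDr -ltrBlDl lt_min => /andP[sd sr] s_r; apply: dP => //; lra.
by exists d => // v v0 dv vr; rewrite WB//; exact: dP.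
Qed.

Let no_jump u v : 0 <= u -> u <= v -> (forall r, r \in F -> ~~ (u < r <= v)) ->
  `|K v - K u - (l v - l u)| <= tau v - tau u.
Proof.
move=> u0 uv noF; have := disc_part_jsum Kc Kbv F u0 uv.
rewrite /jsum big1_seq ?subr0; last by move=> r /andP[+ rF]; rewrite (negbTE (noF r rF)).
by rewrite cont_partB subKr.
Qed.

Lemma right_step r e : 0 <= r -> 0 < e -> exists2 d : R, 0 < d & forall v, r < v -> v < r + d -> v <= T ->
  exists N, forall n, (N <= n)%N ->
    Lint dot x al be r v <= I r v + 2 * e * Vn n r v + e * (3 * `|be| + 2) * (v - r)
      + e * (W v - W r) + D * (tau v - tau r).
Proof.
move=> r0 e0; have [d1 d10 h1] := cadlag_right mc r0 e0.
have [d2 d20 h2] := cadlag_right xc r0 e0; have [d3 d30 h3] := seq_gap F r.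
exists (Num.min d1 (Num.min d2 d3)); first by rewrite !lt_min d10 d20.
move=> v rv; rewrite -ltrBlDl !lt_min => /andP[vd1 /andP[vd2 vd3]] vT.
have v0 := le_trans r0 (ltW rv).
have [q rq qv|||N NP] := @local_limit al be r v e (2 * e) (fun n => k_ n (lam n v)) (K v) r0 rv e0.
- by apply: h2 => //; lra.
- apply/cvgrPdist_le => e' e'0; have [N NP] := K_cvg v0 e'0; exists N => // n Nn.
  by rewrite distrC; exact: NP.
- have [N NP] := m_cvg v e0; exists (maxn 1 N) => n; rewrite geq_max => /andP[n0 nN].
  apply: (energy Hnorm PiP (sol n0) Aab (rescaling_ge0 (lamP n) r0) (rescaling_le (lamP n) r0 (ltW rv))).
  move=> q rq qv; have [q' q'0 qE] := rescaling_surj (lamP n) (le_trans (rescaling_ge0 (lamP n) r0) rq).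
  have rq' : r <= q' by apply: (rescaling_le_inv (lamP n)) => //; rewrite qE.
  have qv' : q' <= v by apply: (rescaling_le_inv (lamP n)) => //; rewrite qE.
  have a1 := NP n nN q' q'0 qv'; rewrite qE in a1.
  have qd1 : q' < r + d1 by lra.
  have a2 := h1 q' rq' qd1; have := ler_distD (m q') (m_ n q) (m r); lra.
exists N => n Nn; apply: le_trans (NP n Nn) _.
have noF : forall q, q \in F -> ~~ (r < q <= v).
  move=> q qF; apply/negP => /andP[rq qv]; have [_ g] := h3 q qF.
  have : q <= r by apply: g; lra.
  lra.
have z1 := no_jump r0 (ltW rv) noF.
have z2 : dot (x r - al) (K v - K r - (l v - l r)) <= D * (tau v - tau r).
  apply: le_trans (dot_le Hnorm _ _) _; apply: ler_pM => //; apply: xD => //; lra.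
have z3 : dot (x r - al) (l v - l r) - e * (W v - W r) <= I r v.
  apply: (polar_int_ge Hnorm lWh) => // [|q rq qv]; first exact: ltW.
  by apply: h2; [exact: ltW|lra].
have -> : dot (x r - al) (K v - K r) = dot (x r - al) (K v - K r - (l v - l r)) + dot (x r - al) (l v - l r).
  by rewrite -dotDr subrK.
lra.
Qed.

(** The jump of K at r, possibly large, never enters: the energy inequality stops at the left limit,
    and the variation of the continuous part has no atom at r ([W_left]). The extra e (r - u) pays
    for stopping at some v < r. *)
Lemma left_step r e : 0 < r -> r <= T -> 0 < e -> exists2 d : R, 0 < d & forall u, 0 <= u -> r - d < u -> u < r ->
  exists N, forall n, (N <= n)%N ->
    Lint dot x al be u r <= I u r + 2 * e * Vn n u r + e * (3 * `|be| + 3) * (r - u)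
      + e * (W r - W u) + D * (tau r - tau u).
Proof.
move=> r0 rT e0; have e20 : 0 < e / 2 by lra.
have [d1 d10 h1] := cadlag_left mc r0 e20.
have [d2 d20 h2] := cadlag_left xc r0 e20; have [d3 d30 h3] := seq_gap F r.
exists (Num.min d1 (Num.min d2 d3)); first by rewrite !lt_min d10 d20.
move=> u u0; rewrite ltrBlDr -ltrBlDl !lt_min => /andP[ud1 /andP[ud2 ud3]] ur.
have ru0 : 0 < r - u by lra.
have xu q : u <= q -> q < r -> `|x q - x u| <= e.
  move=> uq qr; have := h2 q; have := h2 u; have := ler_distD (left_lim x r) (x q) (x u).
  rewrite (distrC (left_lim x r)) => a1 a2 a3.
  have : `|x u - left_lim x r| <= e / 2 by apply: a2; lra.
  have : `|x q - left_lim x r| <= e / 2 by apply: a3; lra.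
  lra.
have mu q : u <= q -> q < r -> `|m q - m u| <= e.
  move=> uq qr; have := h1 q; have := h1 u; have := ler_distD (left_lim m r) (m q) (m u).
  rewrite (distrC (left_lim m r)) => a1 a2 a3.
  have : `|m u - left_lim m r| <= e / 2 by apply: a2; lra.
  have : `|m q - left_lim m r| <= e / 2 by apply: a3; lra.
  lra.
have [|||N NP] := @local_limit al be u r e (2 * e) (fun n => left_lim (k_ n) (lam n r)) (left_lim K r) u0 ur e0.
- exact: xu.
- apply/cvgrPdist_le => e' e'0; have [N NP] := K_left (ltW r0) e'0; exists N => // n Nn.
  by rewrite distrC; apply: NP => //; exact: ltW.
- have [N NP] := m_cvg r e0; exists (maxn 1 N) => n; rewrite geq_max => /andP[n0 nN].
  have lu0 := rescaling_ge0 (lamP n) u0.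
  have := @energy_open _ _ _ Hnorm _ _ _ _ _ PiP (sol n0) al be (m u) _ _ (2 * e) Aab lu0 (rescaling_lt (lamP n) u0 ur).
  have cj : 0 <= 2 * e * `|jump (k_ n) (lam n r)| by rewrite mulr_ge0// mulr_ge0// ltW.
  rewrite (mulrBr (2 * e)) => E; apply: le_trans (E _) _; last by lra.
  move=> q uq qv; have [q' q'0 qE] := rescaling_surj (lamP n) (le_trans lu0 uq).
  have uq' : u <= q' by apply: (rescaling_le_inv (lamP n)) => //; rewrite qE.
  have qr' : q' < r by apply: (rescaling_lt_inv (lamP n)) => //; [exact: ltW|rewrite qE].
  have a1 := NP n nN q' q'0 (ltW qr'); rewrite qE in a1.
  have a2 := mu q' uq' qr'; have := ler_distD (m q') (m_ n q) (m u); lra.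
exists N => n Nn; apply: le_trans (NP n Nn) _.
have pick eta : 0 < eta -> exists v, [/\ u < v, v < r, W r - W v <= eta & `|K v - left_lim K r| <= eta].
  move=> eta0; have [d4 d40 h4] := W_left r0 eta0; have [d5 d50 h5] := cadlag_left Kc r0 eta0.
  pose d := Num.min (r - u) (Num.min d4 d5).
  have d0 : 0 < d by rewrite !lt_min ru0 d40.
  have [du [dd4 dd5]] : d <= r - u /\ d <= d4 /\ d <= d5.
    by rewrite /d !ge_min !lexx !orbT.
  by exists (r - d / 2); split; [lra|lra|apply: h4; lra|apply: h5; lra].
have z1 : `|left_lim K r - K u - (l r - l u)| <= tau r - tau u.
  apply/ler_addgt0Pr => eta eta0; have eta20 : 0 < eta / 2 by lra.
  have [v [uv vr Wv Kv]] := pick _ eta20; have v0 := le_trans u0 (ltW uv).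
  have noF : forall q, q \in F -> ~~ (u < q <= v).
    move=> q qF; apply/negP => /andP[uq qv]; have [g _] := h3 q qF.
    have : r <= q by apply: g; lra.
    lra.
  have b1 := no_jump u0 (ltW uv) noF; have b2 := jtail_le Kc Kbv F v0 (ltW vr).
  have b3 := W_ge v0 (ltW vr).
  have -> : left_lim K r - K u - (l r - l u) =
      (K v - K u - (l v - l u)) - (l r - l v) - (K v - left_lim K r).
    by apply: (eq_dot Hnorm) => ?; rewrite !dotE; ring.
  apply: le_trans (ler_normB _ _) _; apply: le_trans (lerD (ler_normB _ _) (lexx _)) _; lra.
have xuD : `|x u - al| <= D by apply: xD => //; lra.
have z2 : dot (x u - al) (left_lim K r - K u - (l r - l u)) <= D * (tau r - tau u).
  by apply: le_trans (dot_le Hnorm _ _) _; exact: ler_pM.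
have z3 : dot (x u - al) (l r - l u) - e * (W r - W u) <= I u r + e * (r - u).
  have eta0 : 0 < e * (r - u) / (2 * (D + 1)).
    by rewrite divr_gt0// mulr_gt0//; have := D0; lra.
  have [v [uv vr Wv _]] := pick _ eta0; have v0 := le_trans u0 (ltW uv).
  rewrite (polar_int_add Hnorm lWh al xc u0 (ltW uv) (ltW vr)).
  have c1 : dot (x u - al) (l v - l u) - e * (W v - W u) <= I u v.
    apply: (polar_int_ge Hnorm lWh) => // [|q uq qv]; first exact: ltW.
    by apply: xu; lra.
  have c2 : `|I v r| <= D * (W r - W v).
    apply: (polar_int_norm Hnorm lWh) => // [|q vq qr]; first exact: ltW.
    by apply: xD; lra.
  have c3 : dot (x u - al) (l r - l v) <= D * (W r - W v).
    by apply: le_trans (dot_le Hnorm _ _) _; apply: ler_pM => //; apply: W_ge => //; exact: ltW.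
  have c4 : 2 * (D * (W r - W v)) <= e * (r - u).
    have D10 : 0 < 2 * (D + 1) by have := D0; lra.
    have := ler_wpM2l (ltW D10) Wv; rewrite [X in _ <= X]mulrC divfK ?gt_eqF//.
    have := W_le v0 (ltW vr); nra.
  have c5 : e * (W v - W u) <= e * (W r - W u).
    by rewrite ler_pM2l// lerD2r; apply: W_le => //; exact: ltW.
  have -> : dot (x u - al) (l r - l u) = dot (x u - al) (l r - l v) + dot (x u - al) (l v - l u).
    by rewrite -dotDr addrA subrK.
  by move: c2; rewrite ler_norml => /andP[c2 _]; lra.
have -> : dot (x u - al) (left_lim K r - K u) =
    dot (x u - al) (left_lim K r - K u - (l r - l u)) + dot (x u - al) (l r - l u).
  by rewrite -dotDr subrK.
have -> : e * (3 * `|be| + 3) * (r - u) = e * (3 * `|be| + 2) * (r - u) + e * (r - u) by ring.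
lra.
Qed.

End Steps.


(** All error terms are additive in the interval and small in total: the variations of k_n are
    bounded uniformly in n, and F is chosen with tail at most eta / (2 (D + 1)). *)
Lemma limit_differential : differential_in dot A x (cont_part K).
Proof.
have lrc s e : 0 <= s -> 0 < e -> exists2 d : R, 0 < d &
    forall t, s <= t -> t < s + d -> `|cont_part K t - cont_part K s| <= e.
  exact: (cont_part_right Kc Kbv).
have [W [h lWh]] := polar_exists Hnorm (BV_cont_part Kc Kbv) lrc.
move=> s t al be /andP[s0 st] Aab; exists (polar_int dot W h x al s t).
  exists W, h; split => //; exact: (integrable_polar Hnorm lWh).
have t0 := le_trans s0 st.
rewrite -[X in _ - X]/(Lint dot x al be s t) subr_ge0; apply/ler_addgt0Pr => eta eta0.
have [Bx Bx0 xB] := cadlag_bounded t xc.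
have [D [D0 xD]] : exists D : R, 0 <= D /\ forall r, 0 <= r -> r <= t -> `|x r - al| <= D.
  exists (Bx + `|al|); split; first by rewrite addr_ge0.
  by move=> r r0 rt; apply: le_trans (ler_normB _ _) _; rewrite lerD2r xB.
have [B [NB [B0 BP]]] := Vbound t0.
have Wn u v : 0 <= u -> u <= v -> 0 <= W v - W u.
  by move=> _ uv; rewrite subr_ge0; exact: cumulative_is_nondecreasing.
have M0 : 0 < 2 * (B + (t - s) + (W t - W s) + 1) by have := Wn s t s0 st; lra.
pose eps := eta / (2 * (B + (t - s) + (W t - W s) + 1)).
have eps0 : 0 < eps by rewrite divr_gt0.
have D20 : 0 < 2 * (D + 1) by lra.
have [F FP] := jtail_small Kc Kbv t0 (divr_gt0 eta0 D20).
have tauP := @jtail_le _ _ _ Kc Kbv F.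
pose e := eps / (3 * `|be| + 3).
have be0 : 0 < 3 * `|be| + 3 by have := normr_ge0 be; lra.
have e0 : 0 < e by rewrite divr_gt0.
have eE : e * (3 * `|be| + 3) = eps by rewrite /e divfK// gt_eqF.
have e_le : 2 * e <= eps by rewrite -eE; have := mulr_ge0 (ltW e0) (normr_ge0 be); lra.
(* The inequality is asked for large n only, with a rank depending on the interval; transitivity
   takes the larger of two ranks. *)
pose P u v := exists N, forall n, (N <= n)%N ->
  Lint dot x al be u v <= polar_int dot W h x al u v
    + eps * (Vn n u v + (v - u) + (W v - W u)) + D * (jtail K F v - jtail K F u).
have Vge n u v : (0 < n)%N -> 0 <= u -> u <= v -> 0 <= Vn n u v.
  move=> n0 u0 uv; apply: (Vr_ge0 (BVfin (SP_bv (sol n0)) (lam n v))) => //.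
    exact: (rescaling_ge0 (lamP n)).
  exact: (rescaling_le (lamP n)).
have Prefl r : 0 <= r -> P r r.
  move=> r0; exists 1%N => n n0; have := Vge n r r n0 r0 (lexx r).
  rewrite Lint_xx /polar_int set_itvoc0 Rintegral_set0 !subrr => V0.
  by rewrite mulr0 !addr0 add0r mulr_ge0// ltW.
have [N NP] : P s t.
  apply: (@cousin _ P _ _ st) => [u v w su uv vw wt [N1 h1] [N2 h2]|r sr rt].
    exists (maxn 1 (maxn N1 N2)) => n; rewrite !geq_max => /andP[n0 /andP[nN1 nN2]].
    have u0 := le_trans s0 su; have v0 := le_trans u0 uv.
    rewrite (Lint_add Hnorm al be xc u0 uv vw) (polar_int_add Hnorm lWh al xc u0 uv vw).
    rewrite (VrD (BVfin (SP_bv (sol n0)) (lam n w)) (rescaling_ge0 (lamP n) u0)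
      (rescaling_le (lamP n) u0 uv) (rescaling_le (lamP n) v0 vw) (lexx _)).
    by have := h1 n nN1; have := h2 n nN2; lra.
  have r0 := le_trans s0 sr.
  have [d1 d10 h1] := right_step lWh Aab F xD r0 e0.
  have [d2 d20 h2] : exists2 d : R, 0 < d & forall u, s <= u -> r - d < u -> u < r -> P u r.
    move: (sr); rewrite le_eqVlt => /predU1P[<-|s_r]; first by exists 1 => // u; lra.
    have r_gt0 := le_lt_trans s0 s_r.
    have [d2 d20 h2] := left_step lWh Aab F D0 xD r_gt0 rt e0; exists d2 => // u su du ur.
    have u0 := le_trans s0 su.
    have [N NP] := h2 u u0 du ur; exists (maxn 1 N) => n; rewrite geq_max => /andP[n0 nN].
    have a := NP n nN; rewrite eE in a; apply: le_trans a _.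
    have b1 := ler_wpM2r (Vge n u r n0 u0 (ltW ur)) e_le.
    have e_le1 : e <= eps by lra.
    have b2 := ler_wpM2r (Wn u r u0 (ltW ur)) e_le1.
    lra.
  exists (Num.min d1 d2); first by rewrite lt_min d10.
  split=> [v rv|u su].
    rewrite -ltrBlDl lt_min => /andP[v1 _] vt; move: rv; rewrite le_eqVlt => /predU1P[<-|rv]; first exact: Prefl.
    have vd : v < r + d1 by lra.
    have [N NP] := h1 v rv vd vt; exists (maxn 1 N) => n; rewrite geq_max => /andP[n0 nN].
    apply: le_trans (NP n nN) _.
    have b1 := ler_wpM2r (Vge n r v n0 r0 (ltW rv)) e_le.
    have e_le1 : e <= eps by lra.
    have b2 := ler_wpM2r (Wn r v r0 (ltW rv)) e_le1.
    have b3 : e * (3 * `|be| + 2) * (v - r) <= eps * (v - r).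
      by rewrite ler_wpM2r -?eE; lra.
    lra.
  rewrite ltrBlDr -ltrBlDl lt_min => /andP[_ u2]; rewrite le_eqVlt => /predU1P[->|ur]; first exact: Prefl.
  by apply: h2 => //; lra.
pose n := maxn 1 (maxn N NB); have n0 : (0 < n)%N by rewrite leq_maxl.
have := NP n; rewrite !leq_max leqnn orbT => /(_ isT) main.
have VB : Vn n s t <= B.
  apply: le_trans (BP n _); last by rewrite !leq_max leqnn !orbT.
  apply: (Vr_le (BVfin (SP_bv (sol n0)) (lam n t)) (lexx 0)) => //.
    exact: (rescaling_ge0 (lamP n)).
  exact: (rescaling_le (lamP n)).
have b1 : eps * (Vn n s t + (t - s) + (W t - W s)) <= eta / 2.
  apply: le_trans (_ : eps * (B + (t - s) + (W t - W s) + 1) <= _).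
    by rewrite ler_pM2l//; lra.
  by rewrite /eps invfM mulrA -mulrA mulVf ?mulr1// gt_eqF//; lra.
have b2 : D * (jtail K F t - jtail K F s) <= eta / 2.
  have := FP s t s0 st (lexx t); rewrite ler_pdivlMr// => b.
  have := tauP s t s0 st; nra.
lra.
Qed.

End LimitDifferential.

Section Core.
Context {R : realType} {H : completeNormedModType R} (dot : {dot H for idfun}).
Hypothesis Hnorm : hilbert_norm dot.
Variables (A : H -> set H) (Pi : H -> H).
Hypothesis Amax : maximal_monotone dot A.
Hypothesis PiP : gen_projection A Pi.
Hypothesis Aint : (domain A)° !=set0.
Variable m : R -> H.
Hypotheses (mc : cadlag m) (m0A : closure (domain A) (m 0)).

(** The common core of the convergence statements: [lam] is the identity for locally uniform
    convergence and the given time change for J1. *)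
Theorem SP_stability (m_ x_ k_ : nat -> R -> H) (lam : nat -> R -> R) :
  (forall n, (0 < n)%N -> SP dot A Pi (m_ n) (x_ n) (k_ n)) ->
  (forall n, rescaling (lam n)) ->
  (forall e : R, 0 < e -> exists N, forall n, (N <= n)%N ->
    forall t, 0 <= t -> `|lam n t - t| <= e) ->
  (forall T e : R, 0 < e -> exists N, forall n, (N <= n)%N ->
    forall t, 0 <= t -> t <= T -> `|m_ n (lam n t) - m t| <= e) ->
  exists x k, SP dot A Pi m x k /\
    forall T e : R, 0 < e -> exists N, forall n, (N <= n)%N ->
      forall t, 0 <= t -> t <= T ->
        `|x_ n (lam n t) - x t| <= e /\ `|k_ n (lam n t) - k t| <= e.
Proof.
move=> sol lamP lam_id m_cvg.
have xcv := x_lim_cvg Hnorm Amax PiP Aint mc m0A sol lamP lam_id m_cvg.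
have kcv := k_lim_cvg Hnorm Amax PiP Aint mc m0A sol lamP lam_id m_cvg.
have [[xc kc] xd [kbv k0] xk xPi] := k_lim_SP Hnorm Amax PiP Aint mc m0A sol lamP lam_id m_cvg.
have kl := k_lim_left Hnorm Amax PiP Aint mc m0A sol lamP lam_id m_cvg.
have Vb (T : R) : 0 <= T -> exists B N, 0 <= B /\ forall n, (N <= n)%N -> Vr 0 (lam n T) (k_ n) <= B.
  move=> T0; have [B [Bx [N [B0 _ NP]]]] := uniform_bounds Hnorm Amax PiP Aint mc sol lamP lam_id m_cvg T0.
  by exists B, N; split => // n /NP[].
have dl := limit_differential Hnorm PiP mc xc kc kbv xk sol lamP lam_id m_cvg xcv kcv kl Vb.
exists (x_lim m k_ lam), (k_lim k_ lam); split; first by split.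
move=> T e e0; have [T0|T0] := leP 0 T; last by exists 0%N => n _ t t0; lra.
have [N1 h1] := xcv T e T0 e0; have [N2 h2] := kcv T e T0 e0.
exists (maxn N1 N2) => n; rewrite geq_max => /andP[n1 n2] t t0 tT.
by split; [exact: h1|exact: h2].
Qed.

End Core.

(** * The constant of the a priori bound *)

Section Modulus.
Context {R : realType} {E : normedModType R}.
Implicit Types (x : R -> E) (e d T a : R) (s : seq R).

Lemma partition_blocks x e T s a : path <%R a s -> last a s = T ->
  (forall i, (i < size s)%N -> osc_le x e (nth T (a :: s) i) (nth T (a :: s) i.+1)) ->
  blocks (osc_le x e) a T (size s).
Proof.
elim: s a => [|b s IH] a /=; first by move=> _ -> _; exact: blocks_nil.
move=> /andP[ab bs] lT osc; apply: blocks_cons ab (osc 0%N _) _ => //.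
by apply: IH => // i si; exact: (osc i.+1).
Qed.

(** The predecessor of the size appears because the last block is exempt from the lower bound d. *)
Lemma partition_size d T s a : path <%R a s -> last a s = T ->
  (forall i, (i.+1 < size s)%N -> d <= nth T (a :: s) i.+1 - nth T (a :: s) i) ->
  (size s).-1%:R * d <= T - a.
Proof.
elim: s a => [|b s IH] a /=; first by move=> _ -> _; rewrite mul0r subrr.
move=> /andP[ab bs] lT gap; case: s IH bs lT gap => [|c s] IH bs lT gap.
  by rewrite /= mul0r subr_ge0 -lT ltW.
have := IH b bs lT (fun i => gap i.+1); have := gap 0%N isT.
by rewrite /= -[(size s).+1%:R]natr1; lra.
Qed.

Lemma blocks_partition x e T a n : blocks (osc_le x e) a T n ->
  exists s d, [/\ path <%R a s, last a s = T, 0 < d,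
    forall i, (i < size s)%N -> d <= nth T (a :: s) i.+1 - nth T (a :: s) i &
    forall i, (i < size s)%N -> osc_le x e (nth T (a :: s) i) (nth T (a :: s) i.+1)].
Proof.
elim=> [t|b t u p bt Qbt _ [s [d [ps ls d0 gap osc]]]]; first by exists [::], 1; split.
exists (t :: s), (Num.min d (t - b)); split => //=.
- by rewrite bt.
- by rewrite lt_min d0 subr_gt0.
- move=> [|i] si /=; first by rewrite ge_min lexx orbT.
  by rewrite ge_min gap.
- by move=> [|i] si //=; exact: osc.
Qed.

Lemma modulus_small x e T : cadlag x -> 0 <= T -> 0 < e ->
  exists2 d : R, 0 < d & (cadlag_modulus x T d < e%:E)%E.
Proof.
move=> xc T0 e0; have e40 : 0 < e / 4 by rewrite divr_gt0.
have [n /blocks_partition[s [d [ps ls d0 gap osc]]]] := cadlag_blocks xc T0 e40.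
exists d => //; apply: (@le_lt_trans _ _ (e / 2)%:E); last by rewrite lte_fin; lra.
pose F i := ereal_sup [set `|x p.1 - x p.2|%:E | p in
         `[nth T (0 :: s) i, nth T (0 :: s) i.+1[ `*`
         `[nth T (0 :: s) i, nth T (0 :: s) i.+1[].
apply: (@le_trans _ _ (\big[maxe/0%E]_(0 <= i < size s) F i)).
  apply: ereal_inf_lbound; exists s => //; split; first by split => //; apply/eqP.
  by move=> i si; apply: gap; exact: ltnW.
rewrite big_mkord; apply: bigmax_le => [|i _]; first by rewrite lee_fin; lra.
apply: ge_ereal_sup => _ [[u v] [/= + +] <-]; rewrite !in_itv /= => /andP[u1 u2] /andP[v1 v2].
have := osc i (ltn_ord i) u u1 u2; have := osc i (ltn_ord i) v v1 v2.
rewrite lee_fin; have := ler_distD (x (nth T (0 :: s) i)) (x u) (x v).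
by rewrite (distrC (x (nth T (0 :: s) i)) (x v)); lra.
Qed.

Lemma modulus_blocks x e T d : 0 <= T -> 0 < d -> (cadlag_modulus x T d < e%:E)%E ->
  exists2 n, blocks (osc_le x e) 0 T n & n%:R <= T / d + 1.
Proof.
move=> T0 d0 /ereal_inf_lt[_ [s [[ps /eqP ls] gap] <-] small].
exists (size s); last first.
  have := partition_size ps ls gap; rewrite subr0 -ler_pdivlMr// => h.
  case: (size s) h => [|n]; first by rewrite addr_ge0// divr_ge0// ltW.
  by rewrite -natr1 lerD2r.
apply: partition_blocks => // i si r ir ri; rewrite -lee_fin; apply: le_trans (ltW small).
apply: (bigmax_sup_seq _ i) => //; first by rewrite mem_index_iota.
apply: ereal_sup_ubound; exists (r, nth T (0 :: s) i) => //.
split; rewrite /= in_itv /= ?ir ?ri// lexx /=; exact: le_lt_trans ir ri.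
Qed.

Lemma sup_normE x T B : 0 <= T -> (forall t, 0 <= t -> t <= T -> `|x t| <= B) ->
  exists S : R, [/\ sup_norm x T = S%:E, 0 <= S, S <= B & forall t, 0 <= t -> t <= T -> `|x t| <= S].
Proof.
move=> T0 xB; have le : (sup_norm x T <= B%:E)%E.
  apply: ge_ereal_sup => _ [t + <-]; rewrite /= in_itv /= => /andP[t0 tT].
  by rewrite lee_fin xB.
have ge t : 0 <= t -> t <= T -> (`|x t|%:E <= sup_norm x T)%E.
  by move=> t0 tT; apply: ereal_sup_ubound; exists t => //; rewrite /= in_itv /= t0.
have ge0 : (0 <= sup_norm x T)%E by apply: le_trans (ge 0 (lexx 0) T0); rewrite lee_fin.
have fin : sup_norm x T \is a fin_num by rewrite ge0_fin_numE// (le_lt_trans le (ltry _)).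
exists (fine (sup_norm x T)); rewrite fineK//; split => //.
- by rewrite -lee_fin fineK.
- by rewrite -lee_fin fineK.
- by move=> t t0 tT; rewrite -lee_fin fineK//; exact: ge.
Qed.

End Modulus.

Lemma blocks_weaken (R : realType) (Q Q' : R -> R -> Prop) s t n : blocks Q s t n ->
  (forall u v, s <= u -> u < v -> v <= t -> Q u v -> Q' u v) -> blocks Q' s t n.
Proof.
elim=> [u _|u v w p uv Quv bl IH QQ]; first exact: blocks_nil.
apply: (blocks_cons uv _ (IH _)).
  exact: QQ (lexx _) uv (blocks_le bl) Quv.
by move=> q r vq; apply: QQ; exact: le_trans (ltW uv) vq.
Qed.

Section Constant.
Context {R : realType} {H : completeNormedModType R} (dot : {dot H for idfun}).
Hypothesis Hnorm : hilbert_norm dot.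

Definition ball_condition (A : H -> set H) (a : H) (r0 mu : R) :=
  [/\ 0 < r0, closed_ball a r0 `<=` closure (domain A) &
    forall u w, closed_ball a r0 u -> A u w -> `|w| <= mu].

(** A, Pi, m and the solution are quantified after c, so c depends on the listed data only; g stands
    for the modulus of m. Admitting drivers m' close to m covers the approximations and, with m' =
    m, the limit. *)
Definition bounding_constant (a : H) (r0 mu T : R) (g : R -> \bar R) (c : R) :=
  forall A Pi m, gen_projection A Pi -> ball_condition A a r0 mu ->
    cadlag m -> cadlag_modulus m T = g ->
  forall m' x k, SP dot A Pi m' x k ->
    (forall t, 0 <= t -> t <= T -> `|m' t - m t| <= Num.min (r0 / 8) 1) ->
  ((sup_norm x T ^+ 2 + Var 0 T k
      <= sup_norm x T ^+ 2 + Var 0 T (cont_part k) + Var 0 T (disc_part k)) /\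
   (sup_norm x T ^+ 2 + Var 0 T (cont_part k) + Var 0 T (disc_part k)
      <= c%:E * (1 + sup_norm m T ^+ 2)))%E.

Lemma Var_le_parts (k : R -> H) T : 0 <= T -> cadlag k -> BV_loc k ->
  Vr 0 T k <= Vr 0 T (cont_part k) + Vr 0 T (disc_part k).
Proof.
move=> T0 kc kbv; have cbv := BV_cont_part kc kbv; have dbv := BV_disc_part kc kbv.
apply: le_trans (Vr_le_psi T0 (psi := fun t => Vr 0 t (cont_part k) + Vr 0 t (disc_part k)) _) _.
  move=> u v u0 uv vT.
  rewrite (VrD (BVfin cbv v) (lexx 0) u0 uv (lexx v)) (VrD (BVfin dbv v) (lexx 0) u0 uv (lexx v)).
  have h1 := Vr_ge (BVfin cbv v) u0 uv (lexx v); have h2 := Vr_ge (BVfin dbv v) u0 uv (lexx v).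
  have -> : k v - k u = (cont_part k v - cont_part k u) + (disc_part k v - disc_part k u).
    by rewrite cont_partB subrK.
  by apply: le_trans (ler_normD _ _) _; lra.
have := Vr_ge0 (BVfin cbv 0) (lexx 0) (lexx 0) (lexx 0).
have := Vr_ge0 (BVfin dbv 0) (lexx 0) (lexx 0) (lexx 0); lra.
Qed.

(** With Sg = 1 + sup |m|, the numbers B, p, q and K of [apriori] are at most constants times Sg, so
    p K + q and |x|^2 are at most constants times Sg^2 <= 2 (1 + sup |m|^2). The 6 / r0 is 3 times 2
    / r0: the parts of k have variations at most 2 V and V. *)
Lemma bounding_constant_exists a r0 mu T g d : 0 < r0 -> 0 <= mu -> 0 <= T -> 0 < d ->
  (g d < (r0 / 8)%:E)%E -> exists2 c : R, 0 < c & bounding_constant a r0 mu T g c.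
Proof.
move=> r0_gt0 mu0 T0 d0 gd; pose NN := T / d + 1.
have NN0 : 0 <= NN by rewrite addr_ge0// divr_ge0// ltW.
pose cB := 1 + `|a| + r0; pose cp := 6 * NN * cB + mu * T; pose cq := mu * T * cB.
pose cK := 2 * cp + 2 * cq + 1.
have a0 := normr_ge0 a; have muT : 0 <= mu * T by exact: mulr_ge0.
have cB0 : 0 <= cB by rewrite /cB; lra.
have cp0 : 0 <= cp by rewrite /cp addr_ge0// !mulr_ge0.
have cq0 : 0 <= cq by rewrite /cq mulr_ge0.
have cK0 : 0 <= cK by rewrite /cK; lra.
pose c := 2 * ((1 + cK) ^+ 2 + 6 / r0 * (cp * cK + cq)) + 1.
have r60 : 0 <= 6 / r0 by rewrite divr_ge0// ltW.
have cc0 : 0 <= 6 / r0 * (cp * cK + cq) by rewrite mulr_ge0// addr_ge0// mulr_ge0.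
have c0 : 0 < c by rewrite /c; have := sqr_ge0 (1 + cK); lra.
exists c => // A Pi m PiP [_ ballA ball_mu] mc mg m' x k sp mm.
have [kc kbv] := (SP_cadlag_k sp, SP_bv sp).
have [Bm _ mB] := cadlag_bounded T mc.
have [S [SE S0 _ mS]] := sup_normE T0 mB.
rewrite -mg in gd; have [n bl nN] := modulus_blocks T0 d0 gd.
have m'S t : 0 <= t -> t <= T -> `|m' t| <= S + 1.
  move=> t0 tT; have := mm t t0 tT; rewrite le_min => /andP[_ h].
  by have := mS t t0 tT; have := ler_normD (m' t - m t) (m t); rewrite subrK; lra.
have bl' : blocks (osc_le m' (r0 / 2)) 0 T n.
  apply: (blocks_weaken bl) => u v u0 uv vT Quv q uq qv.
  have := Quv q uq qv; have := mm q; have := mm u; rewrite le_min => h1 h2 h3.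
  have /andP[h1' _] : (`|m' u - m u| <= r0 / 8) && (`|m' u - m u| <= 1) by apply: h1; lra.
  have := h2; rewrite le_min => h2'.
  have /andP[h2'' _] : (`|m' q - m q| <= r0 / 8) && (`|m' q - m q| <= 1) by apply: h2'; lra.
  have := ler_distD (m q) (m' q) (m' u); have := ler_distD (m u) (m q) (m' u).
  by rewrite (distrC (m u)); lra.
have := apriori Hnorm r0_gt0 ballA ball_mu PiP sp T0 bl' m'S; cbv zeta.
set B := S + 1 + `|a| + r0; set p := 6 * n%:R * B + mu * T; set q := mu * T * B.
set K := 2 * p + 2 * q + 1 => -[kK VK].
pose Sg := 1 + S; have Sg1 : 1 <= Sg by rewrite /Sg; lra.
have Sg0 : 0 <= Sg by lra.
have B0 : 0 <= B by rewrite /B; lra.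
have BS : B <= cB * Sg.
  rewrite /B /cB /Sg; have : 0 <= (`|a| + r0) * S by rewrite mulr_ge0//; lra.
  lra.
have n0 : 0 <= n%:R :> R by [].
have pS : p <= cp * Sg.
  have h1 : n%:R * B <= NN * (cB * Sg) by apply: ler_pM.
  have h2 : mu * T <= mu * T * Sg by rewrite ler_peMr.
  rewrite /p /cp; lra.
have qS : q <= cq * Sg by rewrite /q /cq -[leRHS]mulrA ler_wpM2l.
have p0 : 0 <= p by rewrite /p addr_ge0// !mulr_ge0.
have q0 : 0 <= q by rewrite /q mulr_ge0.
have KS : K <= cK * Sg by rewrite /K /cK; lra.
have K0 : 0 <= K by rewrite /K; lra.
have xB t : 0 <= t -> t <= T -> `|x t| <= (1 + cK) * Sg.
  move=> t0 tT; have -> : x t = m' t - k t by rewrite -(SP_xk sp t0) addrK.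
  by apply: le_trans (ler_normB _ _) _; have := m'S t t0 tT; have := kK t t0 tT; rewrite /Sg in KS *; lra.
have [X [XE X0 XB _]] := sup_normE T0 xB.
have cbv := BV_cont_part kc kbv; have dbv := BV_disc_part kc kbv.
rewrite SE XE !(Var_fin (BVfin _ T) (lexx 0) T0 (lexx T))//.
rewrite -!EFin_expe -!EFinD -EFinM !lee_fin; split.
  by rewrite -addrA lerD2l Var_le_parts.
have h1 := Vr_cont_part kc kbv (lexx 0) T0; have h2 := Vr_disc_part kc kbv (lexx 0) T0.
have pK : p * K + q <= (cp * cK + cq) * Sg ^+ 2.
  have e1 : p * K <= (cp * Sg) * (cK * Sg) by apply: ler_pM.
  have e2 : cq * Sg <= cq * Sg * Sg by rewrite ler_peMr// mulr_ge0.
  rewrite expr2; lra.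
have h3 : 3 * (2 / r0 * (p * K + q)) <= 6 / r0 * (cp * cK + cq) * Sg ^+ 2.
  have -> : 3 * (2 / r0 * (p * K + q)) = 6 / r0 * (p * K + q) by ring.
  by rewrite -[leRHS]mulrA ler_wpM2l.
have h4 : X ^+ 2 <= (1 + cK) ^+ 2 * Sg ^+ 2.
  by rewrite -exprMn lerXn2r ?nnegrE// (le_trans X0).
have h5 : Sg ^+ 2 <= 2 * (1 + S ^+ 2) by rewrite /Sg; have := sqr_ge0 (S - 1); nra.
set W := (1 + cK) ^+ 2 + 6 / r0 * (cp * cK + cq).
have W0 : 0 <= W by rewrite /W; have := sqr_ge0 (1 + cK); lra.
have h6 := ler_wpM2l W0 h5.
have h7 := sqr_ge0 S.
rewrite /c; rewrite /W in h6 *; lra.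
Qed.

End Constant.

(** * Skorokhod convergence *)

Section Uniform.
Context {R : realType}.
Implicit Types (e T t : R).

Lemma ereal_cvg0P (u : nat -> \bar R) : (forall n, (0 <= u n)%E) ->
  u n @[n --> \oo] --> 0%E <-> forall e, 0 < e -> exists N, forall n, (N <= n)%N -> (u n <= e%:E)%E.
Proof.
move=> u0; split=> [/fine_cvgP[[N1 _ h1] /cvgrPdist_le h2] e e0|h].
  have [N2 _ h2'] := h2 e e0; exists (maxn N1 N2) => n; rewrite geq_max => /andP[n1 n2].
  rewrite -(fineK (h1 n n1)) lee_fin; have := h2' n n2.
  by rewrite /= sub0r normrN; apply: le_trans; exact: ler_norm.
apply/fine_cvgP; split.
  have [N NP] := h 1 ltr01; exists N => // n /NP h1.
  by rewrite ge0_fin_numE// (le_lt_trans h1 (ltry _)).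
apply/cvgrPdist_le => e e0; have [N NP] := h e e0; exists N => // n /NP h1.
have fn : u n \is a fin_num by rewrite ge0_fin_numE// (le_lt_trans h1 (ltry _)).
by rewrite /= sub0r normrN ger0_norm ?fine_ge0// -lee_fin fineK.
Qed.

Lemma sup_image_ge0 (E : normedModType R) (D : set R) (f : R -> E) : D !=set0 ->
  (0 <= ereal_sup [set `|f t|%:E | t in D])%E.
Proof.
move=> [t Dt]; apply: (@le_trans _ _ `|f t|%:E); first by rewrite lee_fin.
by apply: ereal_sup_ubound; exists t.
Qed.

Lemma sup_image_le (E : normedModType R) (D : set R) (f : R -> E) e :
  (ereal_sup [set `|f t|%:E | t in D] <= e%:E)%E <-> forall t, D t -> `|f t| <= e.
Proof.
split=> [le t Dt|le]; last by apply: ge_ereal_sup => _ [t Dt <-]; rewrite lee_fin le.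
by rewrite -lee_fin; apply: le_trans le; apply: ereal_sup_ubound; exists t.
Qed.

Let itv_neq0 T : 0 <= T -> `[0, T]%classic !=set0.
Proof. by move=> T0; exists 0; rewrite /= in_itv /= lexx. Qed.

Lemma sup_cvg0P (E : normedModType R) (f : nat -> R -> E) :
  (forall T, 0 < T -> ereal_sup [set `|f n t|%:E | t in `[0, T]] @[n --> \oo] --> 0%E) <->
  (forall T e, 0 < e -> exists N, forall n, (N <= n)%N -> forall t, 0 <= t -> t <= T -> `|f n t| <= e).
Proof.
have ge0 T : 0 < T -> forall n, (0 <= ereal_sup [set `|f n t|%:E | t in `[(0 : R)%R, T]])%E.
  by move=> T0 n; apply: sup_image_ge0; apply: itv_neq0; exact: ltW.
split=> [h T e e0|h T T0].
  have T1 : 0 < Num.max T 1 by rewrite lt_max ltr01 orbT.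
  have /(ereal_cvg0P (ge0 _ T1))/(_ e e0)[N NP] := h _ T1.
  exists N => n /NP /sup_image_le le t t0 tT; apply: le.
  by rewrite /= in_itv /= t0 le_max tT.
apply/(ereal_cvg0P (ge0 _ T0)) => e e0.
have [N NP] := h T e e0; exists N => n Nn; apply/sup_image_le => t.
by rewrite /= in_itv /= => /andP[]; exact: NP.
Qed.

Lemma sup_cvg0_rayP (f : nat -> R -> R) :
  ereal_sup [set `|f n t|%:E | t in `[0, +oo[] @[n --> \oo] --> 0%E <->
  (forall e, 0 < e -> exists N, forall n, (N <= n)%N -> forall t, 0 <= t -> `|f n t| <= e).
Proof.
have ge0 n : (0 <= ereal_sup [set `|f n t|%:E | t in `[(0 : R)%R, +oo[])%E.
  by apply: (@sup_image_ge0 R^o); exists 0; rewrite /= in_itv /= lexx.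
split=> [/(ereal_cvg0P ge0) h e e0|h].
  have [N NP] := h e e0; exists N => n /NP /(@sup_image_le R^o) le t t0; apply: le.
  by rewrite /= in_itv /= t0.
apply/(ereal_cvg0P ge0) => e e0; have [N NP] := h e e0; exists N => n Nn.
apply/(@sup_image_le R^o) => t; rewrite /= in_itv /= andbT; exact: NP.
Qed.

End Uniform.

Section Skorokhod.
Context {R : realType} {H : completeNormedModType R} (dot : {dot H for idfun}).
Hypothesis Hnorm : hilbert_norm dot.
Variables (A : H -> set H) (Pi : H -> H).
Hypothesis Amax : maximal_monotone dot A.
Hypothesis PiP : gen_projection A Pi.
Hypothesis Aint : (domain A)° !=set0.
Variable m : R -> H.
Hypotheses (mc : cadlag m) (m0A : closure (domain A) (m 0)).

Lemma SP_J1_stability (m_ x_ k_ : nat -> R -> H) :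
  (forall n, (0 < n)%N -> SP dot A Pi (m_ n) (x_ n) (k_ n)) -> J1_cvg m_ m ->
  exists x k : R -> H,
    [/\ cadlag x, cadlag k,
        J1_cvg (fun n t => (x_ n t, k_ n t, m_ n t)) (fun t => (x t, k t, m t)) &
        SP dot A Pi m x k].
Proof.
move=> sol [lam [lamP /sup_cvg0_rayP lam_id /sup_cvg0P m_cvg]].
have [x [k [xkSP xk_cvg]]] := SP_stability Hnorm Amax PiP Aint mc m0A sol
  (fun n => time_change_rescaling (lamP n)) lam_id m_cvg.
exists x, k; split => //; [exact: SP_cadlag_x xkSP|exact: SP_cadlag_k xkSP|].
exists lam; split => //; first exact/sup_cvg0_rayP.
apply/(@sup_cvg0P _ (H * H * H)%type) => T e e0.
have [N1 h1] := xk_cvg T e e0; have [N2 h2] := m_cvg T e e0.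
exists (maxn N1 N2) => n; rewrite geq_max => /andP[n1 n2] t t0 tT.
have [hx hk] := h1 n n1 t t0 tT; have hm := h2 n n2 t t0 tT.
by rewrite /Num.norm/= !ge_max hx hk hm.
Qed.

End Skorokhod.

Section RescalingTimeChange.
Context {R : realType}.

Lemma rescaling_time_change (lam : R -> R) : rescaling lam -> time_change lam.
Proof.
move=> lamP; split.
- split.
  + by move=> t; rewrite /= !in_itv /= !andbT; exact: (rescaling_ge0 lamP).
  + move=> s t; rewrite !inE /= !in_itv /= !andbT => s0 t0 E; apply: le_anti.
    by apply/andP; split; apply: (rescaling_le_inv lamP) => //; rewrite E.
  + move=> r; rewrite /= in_itv /= andbT => /(rescaling_surj lamP)[t t0 E]; exists t => //.
    by rewrite /= in_itv /= t0.
- move=> s t; rewrite !in_itv /= !andbT => s0 t0; exact: (rescaling_lt lamP).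
apply/continuous_within_itvcyP; split.
  move=> t; rewrite in_itv /= andbT => t0; apply/cvgrPdist_le => e e0.
  have lt0 : 0 < lam t by rewrite -(rescaling0 lamP) (rescaling_lt lamP).
  have [a a0 aE] : exists2 a, 0 <= a & lam a = Num.max 0 (lam t - e).
    by apply: (rescaling_surj lamP); rewrite le_max lexx.
  have [b b0 bE] : exists2 b, 0 <= b & lam b = lam t + e.
    by apply: (rescaling_surj lamP); lra.
  have at_ : a < t.
    by apply: (rescaling_lt_inv lamP) => //; [exact: ltW|rewrite aE gt_max lt0; lra].
  have tb : t < b by apply: (rescaling_lt_inv lamP) => //; [exact: ltW|rewrite bE; lra].
  near=> r.
  have ar : a <= r by near: r; exact: lt_le_nbhsr.
  have rb : r <= b by near: r; exact: lt_le_nbhsl.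
  have h1 := rescaling_le lamP a0 ar; have h2 := rescaling_le lamP (le_trans a0 ar) rb.
  have h3 : lam t - e <= lam a by rewrite aE le_max lexx orbT.
  by rewrite ler_norml; lra.
apply/cvgrPdist_le => e e0; rewrite (rescaling0 lamP).
have [b b0 bE] := rescaling_surj lamP (ltW e0).
have b1 : 0 < b by apply: (rescaling_lt_inv lamP) => //; rewrite bE (rescaling0 lamP).
near=> r; have r0 : 0 <= r by apply/ltW; near: r; exact: nbhs_right_gt.
have rb : r <= b by near: r; exact: nbhs_right_ltW.
rewrite sub0r normrN ger0_norm ?(rescaling_ge0 lamP)// -bE; exact: (rescaling_le lamP r0 rb).
Unshelve. all: by end_near. Qed.

End RescalingTimeChange.

(** * Discretizations along partitions *)

Section Discretization.
Context {R : realType} {E : normedModType R}.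
Variable p : nat -> R.
Hypothesis pP : is_partition p.
Implicit Types (s t r d e T : R) (i j n : nat) (lam : R -> R) (x : R -> E).

Let p0 : p 0%N = 0. Proof. by case: pP. Qed.

Let p_lt i j : (i < j)%N -> p i < p j.
Proof.
case: pP => _ pS _; elim: j => // j IH; rewrite ltnS leq_eqVlt => /predU1P[->//|ij].
exact: lt_trans (IH ij) (pS j).
Qed.

Let p_le i j : (i <= j)%N -> p i <= p j.
Proof. by rewrite leq_eqVlt => /predU1P[->//|/p_lt/ltW]. Qed.

Lemma first_point s : 0 <= s -> exists i, s <= p i /\ forall j, (j < i)%N -> p j < s.
Proof.
move=> s0; have ex : exists i, s <= p i.
  by case: pP => _ _ /cvgryPge/(_ s)[N _ /(_ N (leqnn N))]; exists N.
case: (ex_minnP ex) => i si imin; exists i; split => // j; apply: contraTT.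
by rewrite -leNgt -leqNgt; exact: imin.
Qed.

Lemma last_point t : 0 <= t -> exists i, p i <= t < p i.+1.
Proof.
move=> t0; have [i [ti lti]] := first_point t0.
have [->|tne] := eqVneq t (p i); first by exists i; rewrite lexx p_lt.
have {}ti : t < p i by rewrite lt_def eq_sym tne.
by case: i ti lti tne => [|i] ti lti _; [move: ti; rewrite p0; lra|exists i; rewrite ti ltW// lti].
Qed.

Lemma discretizationE x t i : p i <= t < p i.+1 -> discretization p x t = x (p i).
Proof.
move=> /andP[it ti]; apply: cvg_lim; first exact: norm_hausdorff.
apply: cvg_near_cst; exists i.+1 => // n /= ni.
rewrite (bigD1_seq i) /= ?mem_index_iota ?iota_uniq//.
rewrite indicE mem_set ?scale1r; last by rewrite /= in_itv /= it.
rewrite big1 ?addr0// => j ji; rewrite indicE memNset ?scale0r//= in_itv /= => /andP[jt tj].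
move: ji; rewrite neq_ltn => /orP[ji|ij].
  by have := le_lt_trans (p_le ji) (le_lt_trans it tj); rewrite ltxx.
by have := le_lt_trans (p_le ij) (le_lt_trans jt ti); rewrite ltxx.
Qed.

Definition first_point_after s q := exists i, [/\ q = p i, s <= q & forall j, (j < i)%N -> p j < s].

Lemma first_point_after_exists s d : 0 <= s -> 0 <= d -> (forall i, p i.+1 - p i <= d) ->
  exists q, first_point_after s q /\ q <= s + d.
Proof.
move=> s0 d0 gap; have [i [si lti]] := first_point s0; exists (p i); split; first by exists i.
case: i si lti => [|i] si lti; first by rewrite p0; lra.
by have := gap i; have := lti i (ltnSn i); lra.
Qed.

(** The value at w is that of x at the last partition point up to w. This point is not before q,
    hence not before s; it precedes q', hence t, because q' is the first partition point not before
    t. *)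
Lemma discretization_block s t q q' w : first_point_after s q -> first_point_after t q' ->
  q <= w -> w < q' -> 0 <= w -> exists r, [/\ s <= r, r < t & forall x, discretization p x w = x r].
Proof.
move=> [i0 [-> sq _]] [i1 [-> tq lti1]] qw wq' w0; have [i iw] := last_point w0.
exists (p i); split; last by move=> x; exact: discretizationE.
  have [i0i|ii0] := leqP i0 i; first exact: le_trans sq (p_le i0i).
  by move/andP: iw => [_ iw]; have := le_lt_trans qw iw; have := p_le ii0; lra.
apply: lti1; have [i1i|//] := leqP i1 i.
by move/andP: iw => [iw _]; have := p_le i1i; lra.
Qed.

End Discretization.

Section DiscretizationCvg.
Context {R : realType} {E : normedModType R}.
Implicit Types (s t r d e T : R) (i j n : nat) (lam : R -> R) (x : R -> E).

(* [lam] sends each end point of a block to the first partition point after it,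
   so that the last partition point before [lam t] stays in the block of [t]. *)
Lemma block_time_change x e s T n : 0 <= s -> blocks (osc_le x e) s T n ->
  exists2 d0 : R, 0 < d0 & forall p d, is_partition p -> (forall i, p i.+1 - p i <= d) ->
    0 <= d -> d < d0 ->
  exists lam, [/\ first_point_after p s (lam s),
    forall u v, s <= u -> u < v -> lam u < lam v,
    forall r, lam s <= r -> exists2 t, s <= t & lam t = r,
    forall t, s <= t -> t <= lam t <= t + d &
    forall t, s <= t -> t < T -> `|discretization p x (lam t) - x t| <= 2 * e].
Proof.
move=> s0 bl; elim: bl s0 => {s T n} [s|s t T n st osc bl IH] s0.
  exists 1 => // p d pP gap d0 _; have [q [qP qd]] := first_point_after_exists pP s0 d0 gap.
  have sq : s <= q by case: qP => i [].
  (* Beyond the last block a translation is enough. *)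
  exists (fun t => t + (q - s)); split.
  - by rewrite addrC subrK.
  - by move=> u v _ uv; rewrite ltrD2r.
  - by move=> r; rewrite addrC subrK => qr; exists (r - (q - s)); [lra|rewrite subrK].
  - by move=> t st; apply/andP; split; lra.
  - by move=> t st ts; have := lt_le_trans ts st; rewrite ltxx.
have t0 : 0 <= t by lra.
have ts0 : 0 < t - s by rewrite subr_gt0.
have [d0 d00 IHd] := IH t0; exists (Num.min d0 (t - s)); first by rewrite lt_min d00.
move=> p d pP gap dge0; rewrite lt_min => /andP[dd0 dts].
have [lam' [l1 l2 l3 l4 l5]] := IHd p d pP gap dge0 dd0.
have [q [qP qd]] := first_point_after_exists pP s0 dge0 gap.
have sq : s <= q by case: qP => i [].
have /andP[t1 t2] := l4 t (lexx t).
pose c := (lam' t - q) / (t - s).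
have cE : c * (t - s) = lam' t - q by rewrite /c divfK// gt_eqF.
(* Here q <= s + d < t <= lam' t, since d is smaller than the length of the block. *)
have c0 : 0 < c by rewrite divr_gt0//; lra.
pose lin r := q + (r - s) * c.
have lin_lt u v : u < v -> lin u < lin v by move=> uv; rewrite /lin ltrD2l ltr_pM2r//; lra.
have lint : lin t = lam' t by rewrite /lin mulrC cE; ring.
have lins : lin s = q by rewrite /lin subrr mul0r addr0.
exists (fun r => if r < t then lin r else lam' r); rewrite st lins; split => //.
- move=> u v su uv; have [ut|tu] := ltP u t; have [vt|tv] := ltP v t.
  + exact: lin_lt.
  + apply: lt_le_trans (lin_lt _ _ ut) _; rewrite lint.
    by move: tv; rewrite le_eqVlt => /predU1P[->//|tv]; rewrite ltW// l2.
  + lra.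
  + exact: l2.
- move=> r qr; have [rt|tr] := ltP r (lam' t).
    exists (s + (r - q) / c); first by rewrite lerDl divr_ge0 ?(ltW c0)// subr_ge0.
    have -> : s + (r - q) / c < t.
      by rewrite -ltrBrDl ltr_pdivrMr// mulrC cE; lra.
    by rewrite /lin addrAC subrr add0r divfK ?gt_eqF// addrC subrK.
  by have [r' tr' <-] := l3 r tr; exists r'; [lra|rewrite ltNge tr'].
- move=> r sr; have [rt|tr] := ltP r t; last exact: l4.
  (* The displacement of an affine map is a convex combination of those at the end points, q - s and
     lam' t - t, both in [0, d]. *)
  have -> : lin r = r + ((q - s) * (t - r) + (lam' t - t) * (r - s)) / (t - s).
    by rewrite /lin /c; field; rewrite gt_eqF.
  rewrite lerDl lerD2l; apply/andP; split.
    by rewrite divr_ge0 ?(ltW ts0)// addr_ge0// mulr_ge0//; lra.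
  rewrite ler_pdivrMr//.
  have -> : d * (t - s) = d * (t - r) + d * (r - s) by ring.
  by apply: lerD; rewrite ler_wpM2r//; lra.
- move=> r sr rT; have [rt|tr] := ltP r t; last exact: l5.
  have qr : q <= lin r.
    by move: sr; rewrite le_eqVlt => /predU1P[<-|/lin_lt]; rewrite lins// => /ltW.
  have rq : lin r < lam' t by rewrite -lint lin_lt.
  have lr0 : 0 <= lin r by lra.
  have [v [sv vt vE]] := @discretization_block R E p pP s t _ _ _ qP l1 qr rq lr0; rewrite vE.
  have := osc v sv vt; have := osc r sr rt; have := ler_distD (x s) (x v) (x r).
  by rewrite (distrC (x s)); lra.
Qed.

Lemma discretization_near x (p_ : nat -> nat -> R) T e : cadlag x -> 0 < e ->
  (forall n, is_partition (p_ n)) -> mesh (p_ n) @[n --> \oo] --> 0%E ->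
  exists N, forall n, (N <= n)%N -> exists lam, [/\ rescaling lam,
    forall t, 0 <= t -> `|lam t - t| <= e &
    forall t, 0 <= t -> t <= T -> `|discretization (p_ n) x (lam t) - x t| <= e].
Proof.
move=> xc e0 pP mesh0; have e20 : 0 < e / 2 by lra.
(* The estimate of [block_time_change] excludes the right end, so a horizon beyond T is used. *)
pose T' := Num.max T 0 + 1; have T'0 : 0 <= T' by rewrite addr_ge0// le_max lexx orbT.
have TT' : T < T' by rewrite /T' ltr_pwDr// le_max lexx.
have [nb bl] := cadlag_blocks xc T'0 e20.
have [d0 d00 h] := block_time_change (lexx 0) bl.
have mesh_ge0 n : (0 <= mesh (p_ n))%E.
  case: (pP n) => _ pS _; apply: (@le_trans _ _ (p_ n 1%N - p_ n 0%N)%:E).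
    by rewrite lee_fin subr_ge0 ltW.
  by apply: ereal_sup_ubound; exists 0%N.
pose d := Num.min (d0 / 2) e.
have dd0 : 0 < d by rewrite lt_min e0 divr_gt0.
have [dlt de] : d < d0 /\ d <= e.
  by split; [apply: (@le_lt_trans _ _ (d0 / 2)); [rewrite ge_min lexx|lra]|rewrite ge_min lexx orbT].
have [N NP] := (ereal_cvg0P mesh_ge0).1 mesh0 d dd0; exists N => n Nn.
have gap i : p_ n i.+1 - p_ n i <= d.
  rewrite -lee_fin; apply: le_trans (NP n Nn); apply: ereal_sup_ubound; by exists i.
have [lam [[i [l0 _ lti]] l2 l3 l4 l5]] := h (p_ n) d (pP n) gap (ltW dd0) dlt.
have p0 : p_ n 0%N = 0 by case: (pP n).
have lam0 : lam 0 = 0.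
  case: i l0 lti => [-> _|i _ /(_ 0%N isT)]; first exact: p0.
  by rewrite p0 ltxx.
exists lam; split.
- by split => // r r0; apply: l3; rewrite lam0.
- by move=> t t0; have /andP[a b] := l4 t t0; rewrite ler_norml; lra.
- move=> t t0 tT; have := l5 t t0 (le_lt_trans tT TT').
  by rewrite mulrC divfK.
Qed.

(** A diagonal argument: [discretization_near] gives time changes depending on horizon and
    precision, here j and 1 / (j + 1), whereas J1 convergence asks for a single sequence. *)
Lemma discretization_J1_cvg x (p_ : nat -> nat -> R) (x_ : nat -> R -> E) : cadlag x ->
  (forall n, is_partition (p_ n)) -> mesh (p_ n) @[n --> \oo] --> 0%E ->
  (forall n t, 0 <= t -> x_ n t = discretization (p_ n) x t) -> J1_cvg x_ x.
Proof.
move=> xc pP mesh0 x_E.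
pose good n j lam := [/\ rescaling lam,
    forall t, 0 <= t -> `|lam t - t| <= j.+1%:R^-1 &
    forall t, 0 <= t -> t <= j%:R -> `|x_ n (lam t) - x t| <= j.+1%:R^-1].
have goodE j : exists N, forall n, (N <= n)%N -> exists lam, good n j lam.
  have [|N NP] := @discretization_near x p_ j%:R j.+1%:R^-1 xc _ pP mesh0; first by rewrite invr_gt0.
  exists N => n /NP[lam [lamP lam_id h]]; exists lam; split => // t t0 tj.
  by rewrite x_E ?(rescaling_ge0 lamP)//; exact: h.
(* For each [n] we use the time change of the best precision [j <= n] available. *)
have best n : exists lam, rescaling lam /\ forall j, (j <= n)%N -> (exists l, good n j l) -> 
    exists2 j', (j <= j')%N & good n j' lam.
  have [[j0 j0n]|none] := pselect (exists2 j, (j <= n)%N & exists l, good n j l); last first.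
    exists idfun; split; first exact: rescaling_id.
    by move=> j jn jg; case: none; exists j.
  move=> gj0; pose P j := `[< (j <= n)%N /\ exists l, good n j l >].
  have exP : exists j, P j by exists j0; apply/asboolP.
  have Pn j : P j -> (j <= n)%N by move=> /asboolP[].
  case: (ex_maxnP exP Pn) => j /asboolP[jn [lam jg]] jmax.
  exists lam; split; first by case: jg.
  by move=> i i_n ig; exists j => //; apply: jmax; apply/asboolP.
have [lam lamP] := choice best.
have key e T : 0 < e -> exists N, forall n, (N <= n)%N ->
    (forall t, 0 <= t -> `|lam n t - t| <= e) /\
    (forall t, 0 <= t -> t <= T -> `|x_ n (lam n t) - x t| <= e).
  move=> e0; pose j := maxn (Num.trunc e^-1) (Num.trunc T).+1.
  have [N NP] := goodE j; exists (maxn N j) => n; rewrite geq_max => /andP[nN nj].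
  have [_ /(_ j nj (NP n nN))[j' jj' [_ h1 h2]]] := lamP n.
  have je : j'.+1%:R^-1 <= e.
    rewrite -[leRHS]invrK lef_pV2 ?posrE ?invr_gt0//; apply: le_trans (ltW (truncnS_gt _)) _.
    by rewrite ler_nat ltnS; apply: leq_trans jj'; exact: leq_maxl.
  have Tj : T <= j'%:R.
    apply: le_trans (ltW (truncnS_gt _)) _; rewrite ler_nat; apply: leq_trans jj'; exact: leq_maxr.
  split=> [t t0|t t0 tT]; first exact: le_trans (h1 t t0) je.
  exact: le_trans (h2 t t0 (le_trans tT Tj)) je.
exists lam; split.
- by move=> n; apply: rescaling_time_change; case: (lamP n).
- by apply/sup_cvg0_rayP => e e0; have [N NP] := key e 0 e0; exists N => n /NP[].
- by apply/sup_cvg0P => T e e0; have [N NP] := key e T e0; exists N => n /NP[].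
Qed.

End DiscretizationCvg.

(** * The constant as a function of the data, and the theorem *)

Section BoundConstant.
Context {R : realType} {H : completeNormedModType R} (dot : {dot H for idfun}).
Hypothesis Hnorm : hilbert_norm dot.

(** With the default 1 it is positive for all arguments; it is a genuine bound whenever some
    constant exists, as is the case for the modulus of a cadlag path under the ball condition. *)
Definition bound_constant (a : H) (r0 mu T : R) (g : R -> \bar R) : R :=
  xget 1 [set c | 0 < c /\ bounding_constant dot a r0 mu T g c].

Lemma bound_constant_gt0 a r0 mu T g : 0 < bound_constant a r0 mu T g.
Proof. by rewrite /bound_constant; case: xgetP => [c _ []|_]. Qed.

Lemma bound_constantP (A : H -> set H) (m : R -> H) a r0 mu T : 0 <= T -> cadlag m ->
  ball_condition A a r0 mu ->
  bounding_constant dot a r0 mu T (cadlag_modulus m T) (bound_constant a r0 mu T (cadlag_modulus m T)).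
Proof.
move=> T0 mc [r0_gt0 ballA ball_mu].
have r80 : 0 < r0 / 8 by rewrite divr_gt0.
have [d d0 small] := modulus_small mc T0 r80.
have mu0 := ball_mu_ge0 r0_gt0 ballA ball_mu.
have [c c0 cP] := bounding_constant_exists Hnorm a r0_gt0 mu0 T0 d0 small.
by rewrite /bound_constant; case: xgetP => [c' _ []//|/(_ c)]; case.
Qed.

Lemma A_sharp_ball_condition (A : H -> set H) a (r0 mu : R) : 0 < r0 ->
  closed_ball a r0 `<=` closure (domain A) -> (A_sharp A a r0 <= mu%:E)%E -> ball_condition A a r0 mu.
Proof.
move=> r0_gt0 ballA le; split => // u w ua Auw; rewrite -lee_fin; apply: le_trans le.
by apply: ereal_sup_ubound; exists w => //; exists u.
Qed.

End BoundConstant.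

Theorem theorem24 (R : realType) (H : completeNormedModType R)
    (dot : {dot H for idfun}) (Hnorm : hilbert_norm dot)
    (Hsep : separable (H := H)) :
  exists C : H -> R -> R -> R -> (R -> \bar R) -> R,
  (forall a r0 mu T gamma, 0 < C a r0 mu T gamma) /\
  forall (A : H -> set H) (Pi : H -> H) (m : R -> H),
  maximal_monotone dot A ->
  (domain A)° !=set0 ->
  gen_projection A Pi ->
  cadlag m ->
  closure (domain A) (m 0) ->
  (forall m_ x_ k_ : nat -> R -> H,
    (forall n, (0 < n)%N -> cadlag (m_ n)) ->
    (forall n, (0 < n)%N -> SP dot A Pi (m_ n) (x_ n) (k_ n)) ->
    (* (I) *)
    ((forall T : R, 0 < T ->
        sup_norm (fun t => m_ n t - m t) T @[n --> \oo] --> 0%E) ->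
      (* (j) *)
      (forall (T : R) (a : H) (r0 mu : R), 0 < T ->
        (domain A)° a -> 0 < r0 ->
        closed_ball a r0 `<=` closure (domain A) ->
        (A_sharp A a r0 <= mu%:E)%E ->
        exists2 n0 : nat, (0 < n0)%N & forall n, (n0 <= n)%N ->
          (sup_norm (x_ n) T ^+ 2 + Var 0 T (k_ n)
             <= sup_norm (x_ n) T ^+ 2 + Var 0 T (cont_part (k_ n))
                + Var 0 T (disc_part (k_ n)))%E /\
          (sup_norm (x_ n) T ^+ 2 + Var 0 T (cont_part (k_ n))
                + Var 0 T (disc_part (k_ n))
             <= (C a r0 mu T (cadlag_modulus m T))%:E
                * (1 + sup_norm m T ^+ 2))%E) /\
      exists x k : R -> H,
        [/\ cadlag x /\ cadlag k,
            (* (jj) *)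
            forall T : R, 0 < T ->
              (sup_norm (fun t => x_ n t - x t)%R T
                 + sup_norm (fun t => k_ n t - k t)%R T)%E
                @[n --> \oo] --> 0%E,
            forall (T : R) (a : H) (r0 mu : R), 0 < T ->
              (domain A)° a -> 0 < r0 ->
              closed_ball a r0 `<=` closure (domain A) ->
              (A_sharp A a r0 <= mu%:E)%E ->
              (sup_norm x T ^+ 2 + Var 0 T k
                 <= (C a r0 mu T (cadlag_modulus m T))%:E
                    * (1 + sup_norm m T ^+ 2))%E &
            (* (jjj) *)
            SP dot A Pi m x k]) /\
    (* (II) *)
    (J1_cvg m_ m ->
      exists x k : R -> H,
        [/\ cadlag x, cadlag k,
            J1_cvg (fun n t => (x_ n t, k_ n t, m_ n t))
                   (fun t => (x t, k t, m t)) &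
            SP dot A Pi m x k])) /\
  (* (III) *)
  (forall (p_ : nat -> nat -> R) (m_ x_ k_ : nat -> R -> H),
    (forall n, is_partition (p_ n)) ->
    mesh (p_ n) @[n --> \oo] --> 0%E ->
    (forall (n : nat) (t : R), 0 <= t -> m_ n t = discretization (p_ n) m t) ->
    (forall n, SP dot A Pi (m_ n) (x_ n) (k_ n)) ->
    exists x k : R -> H,
      [/\ cadlag x, cadlag k,
          J1_cvg (fun n t => (x_ n t, k_ n t, m_ n t))
                 (fun t => (x t, k t, m t)) &
          SP dot A Pi m x k]).
Proof.
exists (bound_constant dot); split; first by move=> *; exact: bound_constant_gt0.
move=> A Pi m Amax Aint PiP mc m0A; split; last first.
  move=> p_ m_ x_ k_ pP mesh0 mE sol.
  apply: (SP_J1_stability Hnorm Amax PiP Aint mc m0A (fun n _ => sol n)).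
  exact: (discretization_J1_cvg mc pP mesh0 mE).
move=> m_ x_ k_ _ sol; split; last first.
  by move=> mJ; exact: (SP_J1_stability Hnorm Amax PiP Aint mc m0A sol mJ).
move=> /sup_cvg0P m_cvg; split.
  move=> T a r0 mu T0 _ r0_gt0 ballA le.
  have ball := A_sharp_ball_condition r0_gt0 ballA le.
  have e0 : 0 < Num.min (r0 / 8) 1 by rewrite lt_min divr_gt0 ?ltr01.
  have [N NP] := m_cvg T _ e0; exists (maxn 1 N); first by rewrite leq_maxl.
  move=> n; rewrite geq_max => /andP[n0 nN].
  exact: (bound_constantP Hnorm (ltW T0) mc ball PiP ball mc erefl (sol n n0) (NP n nN)).
have id_cvg (e : R) : 0 < e -> exists N, forall n, (N <= n)%N ->
    forall t : R, 0 <= t -> `|(fun=> idfun) n t - t| <= e.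
  by move=> e0; exists 0%N => n _ t _; rewrite subrr normr0 ltW.
have [x [k [xkSP xk_cvg]]] := SP_stability Hnorm Amax PiP Aint mc m0A sol (fun=> rescaling_id) id_cvg m_cvg.
exists x, k; split => //.
- by split; [exact: SP_cadlag_x xkSP|exact: SP_cadlag_k xkSP].
- move=> T T0; rewrite -[X in _ --> X]adde0; apply: cvgeD => //.
    apply/sup_cvg0P: T T0 => T e e0; have [N NP] := xk_cvg T e e0.
    by exists N => n Nn t t0 tT; have [] := NP n Nn t t0 tT.
  apply/sup_cvg0P: T T0 => T e e0; have [N NP] := xk_cvg T e e0.
  by exists N => n Nn t t0 tT; have [] := NP n Nn t t0 tT.
move=> T a r0 mu T0 _ r0_gt0 ballA le.
have ball := A_sharp_ball_condition r0_gt0 ballA le.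
(* The limit solves the problem with driver m, so the same constant applies to it with m' = m. *)
have [|h1 h2] := bound_constantP Hnorm (ltW T0) mc ball PiP ball mc erefl xkSP; last exact: le_trans h1 h2.
by move=> t _ _; rewrite subrr normr0 le_min ler01 divr_ge0// ltW.
Qed.
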